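(* Let $K$ be an algebraically closed field of characteristic zero, $r\ge2$, $d\in\mathbb N^*$, $\tilde\nu_0\in\mathbb N$, $p\in\mathbb N^*$, $q_1,\dots,q_{r-1}\in\mathbb N$. Let $\tilde f,\tilde g\in K\left[\left[\left(\frac{x_1}{x_2^{q_1}}\right)^{1/p},\dots,\left(\frac{x_{r-1}}{x_r^{q_{r-1}}}\right)^{1/p},x_r^{1/p}\right]\right]$ and $\tilde y_0=\tilde f/\tilde g\in\mathcal K_r$. Assume that there is a nonzero polynomial $\tilde P(\underline x,y)\in K[[\underline x]][y]$ with $\tilde P(\underline x,\tilde y_0)=0$, $\deg_y\tilde P\le d$ and $(\underline x)$-adic order at most $\tilde\nu_0$. Let $q'_i\ge q_i$, $i=1,\dots,r-1$, be integers, not all zero, such that, in the variables $u_i:=\left(x_i/x_{i+1}^{q'_i}\right)^{1/p}$ ($i=1,\dots,r-1$), $u_r:=x_r^{1/p}$, the product $\tilde f\tilde g$ is monomialized, i.e. equal to a monomial in $\underline u$ times an invertible element of $K[[\underline u]]$. Define $\tilde L:\mathbb Z^r\to\mathbb Z$ as follows. Let $i_1<j_1<i_2<j_2<\cdots<i_\sigma<j_\sigma\le r$ be the indices such that, for $1\le i\le r$, one has ($i<r$ and $q'_i>0$) if and only if $i_k\le i\le j_k-1$ for some $k\in\{1,\dots,\sigma\}$; put $i_{\sigma+1}:=r+1$. Then $$\tilde L(\underline n):=\sum_{1\le i<i_1}n_i+\sum_{k=1}^{\sigma}\left(\sum_{i=i_k}^{j_k-1}q'_{j_k-1}q'_{j_k-2}\cdots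 q'_i\,n_i+\sum_{i=j_k}^{i_{k+1}-1}n_i\right).$$ For $\nu\in\mathbb N$ let $\mathcal Q_\nu$ be the set of all $\tilde Q_\nu\in K[[\underline x]][y]$ with $\deg_y\tilde Q_\nu\le d$ and $(\underline x)$-adic order at most $\tilde\nu_0$ such that $\tilde L(\underline n)\ge\nu$ for every $\frac1p\underline n\in\mathrm{Supp}\,\tilde Q_\nu(\underline x,\tilde y_0)$. Then there is an algorithm which, for every such data and every $\nu\in\mathbb N$, provides all the polynomials of $\mathcal Q_\nu$, by means of a parametric description of $\mathcal Q_\nu$. The input of the algorithm consists of $d,\tilde\nu_0,p,q_1,\dots,q_{r-1},q'_1,\dots,q'_{r-1},\nu$, the lexicographic valuations of $\tilde f$ and $\tilde g$ with respect to $\zeta_i:=(x_i/x_{i+1}^{q_i})^{1/p}$ ($i<r$), $\zeta_r:=x_r^{1/p}$, and a procedure which for any $k\in\mathbb N$ returns all coefficients of $\underline\zeta^{\underline n}$ with $n_1+\cdots+n_r\le k$ in $\tilde f$ and $\tilde g$.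
   Context: $\mathbb N=\mathbb Z_{\ge0}$, $\mathbb N^*=\mathbb N\setminus\{0\}$, $\underline x=(x_1,\dots,x_r)$, $\underline x^{\underline n}=x_1^{n_1}\cdots x_r^{n_r}$ and $|\underline i|=i_1+\cdots+i_r$. The field $\mathcal L_r$ is the union over $p\in\mathbb N^*$ of the fields $K((x_r^{1/p}))((x_{r-1}^{1/p}))\cdots((x_1^{1/p}))$ ($K$ being algebraically closed). Its elements are identified with generalized series $\sum_{\underline n\in\mathbb Z^r}c_{\underline n/p}\,\underline x^{\underline n/p}$ whose support $\mathrm{Supp}=\{\frac1p\underline n\mid c_{\underline n/p}\ne0\}\subset\frac1p\mathbb Z^r$ is well-ordered for the lexicographic order. $\mathcal K_r\subset\mathcal L_r$ is the union, over all $p\in\mathbb N^*$ and $(q_1,\dots,q_{r-1})\in\mathbb N^{r-1}$, of the fraction fields of the rings $K[[(x_1/x_2^{q_1})^{1/p},\dots,(x_{r-1}/x_r^{q_{r-1}})^{1/p},x_r^{1/p}]]$. $\mathrm{Supp}\,\tilde Q(\underline x,\tilde y_0)$ is the support of $\tilde Q(\underline x,\tilde y_0)\in\mathcal K_r$ expanded in this way. Since $q'_i\ge q_i$, the ring $K[[\underline\zeta]]$ is contained in $K[[\underline u]]$. The lexicographic valuation of a nonzero series in the variables $\underline\zeta$ is the lexicographically smallest exponent of its support. The $(\underline x)$-adic order of a nonzero $\tilde Q\in K[[\underline x]][y]$ is the largest $k$ such that $\tilde Q\in(\underline x)^kK[[\underline x]][y]$, where $(\underline x)$ is the ideal generated by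 $x_1,\dots,x_r$ (so polynomials of order at most $\tilde\nu_0$ are nonzero). Algorithms may use exact field operations and zero tests in $K$, and the given procedure for the coefficients of $\tilde f,\tilde g$. A parametric description of $\mathcal Q_\nu$ consists of an integer $N\ge\tilde\nu_0$ and finitely many $K$-linearly independent vectors $b_1,\dots,b_M\in K^{I_N}$, where $I_N=\{(\underline i,j)\mid \underline i\in\mathbb N^r,\ |\underline i|\le N,\ 0\le j\le d\}$, such that a polynomial $\tilde Q=\sum_{\underline i\in\mathbb N^r,\,0\le j\le d}a_{\underline i,j}\underline x^{\underline i}y^j$ belongs to $\mathcal Q_\nu$ if and only if $(a_{\underline i,j})_{(\underline i,j)\in I_N}=\sum_m\theta_mb_m$ for some $(\theta_1,\dots,\theta_M)\in K^M$ and $a_{\underline i,j}\ne0$ for some $(\underline i,j)$ with $|\underline i|\le\tilde\nu_0$. The coefficients with index outside $I_N$ are unconstrained. *)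

(* Defs.v *)
From HB Require Import structures.
From mathcomp Require Import all_boot all_order all_algebra.
From mathcomp Require Import boolp classical_sets fsbigop.
From mathcomp Require Import zify ring.
Set Implicit Arguments.
Unset Strict Implicit.
Unset Printing Implicit Defensive.
Import Order.TTheory GRing.Theory Num.Theory.
Local Open Scope ring_scope.

(* The field F((X)): the series are given by their coefficients. Products are
   compared through those of truncations, which are polynomials. *)
Section LaurentField.
Variable F : fieldType.
Implicit Types a b c : int -> F.

Definition vanish_below a (m : int) := forall n : int, n < m -> a n = 0.

Record laurent := Laurent {
  lcoef :> int -> F;
  lcoef_bounded : exists m, vanish_below lcoef m }.

HB.instance Definition _ := gen_eqMixin laurent.
HB.instance Definition _ := gen_choiceMixin laurent.

Lemma laurentP (s t : laurent) : (forall n, s n = t n) <-> s = t.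
Proof.
split=> [|-> //]; case: s t => [s hs] [t ht] /= /funext eq_st.
by case: t / eq_st ht => ht; rewrite (Prop_irrelevance hs ht).
Qed.

(* The coefficients of a product; only finitely many terms are nonzero. *)
Definition conv a b (n : int) : F := \sum_(i \in [set: int]) a i * b (n - i).

Let trunc a (m : int) N : {poly F} := \poly_(i < N) a (m + i%:Z).

Lemma conv_trunc a b ma mb N k : vanish_below a ma -> vanish_below b mb ->
  (k < N)%N -> conv a b (ma + mb + k%:Z) = (trunc a ma N * trunc b mb N)`_k.
Proof.
move=> a0 b0 ltkN; pose r := [seq ma + i%:Z | i <- iota 0 k.+1].
rewrite /conv (fsbigE r) //; last 2 first.
- by rewrite map_inj_uniq ?iota_uniq // => i j; lia.
- move=> i _; case: (ltrP i ma) => [/a0->|le_mi]; first by rewrite mul0r.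
  case: (ltrP (ma + k%:Z) i) => [lt_ki _|le_ik /negP[]].
    by rewrite b0 ?mulr0 //; lia.
  by apply/mapP; exists `|i - ma|%N; rewrite ?mem_iota; lia.
under eq_bigl do rewrite in_setT.
rewrite big_map coefM -[in LHS]/(index_iota 0 k.+1) big_mkord.
apply: eq_bigr => i _; have ltik := ltn_ord i.
by rewrite !coef_poly !ifT; [congr (a _ * b _); lia|lia..].
Qed.

Lemma conv_vanish a b ma mb : vanish_below a ma -> vanish_below b mb ->
  vanish_below (conv a b) (ma + mb).
Proof.
move=> a0 b0 n ltn; rewrite /conv fsbig1 // => i _.
case: (ltrP i ma) => [/a0->|le_mi]; first by rewrite mul0r.
by rewrite b0 ?mulr0 //; lia.
Qed.

Lemma vanish_le a m n : vanish_below a m -> n <= m -> vanish_below a n.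
Proof. by move=> a0 le_nm k lt_kn; apply/a0/(lt_le_trans lt_kn). Qed.

Lemma nat_above (m n : int) : m <= n -> {k : nat | n = m + k%:Z}.
Proof. by move=> le_mn; exists `|n - m|%N; lia. Qed.

Lemma convA a b c ma mb mc : vanish_below a ma -> vanish_below b mb ->
  vanish_below c mc -> conv a (conv b c) = conv (conv a b) c.
Proof.
move=> a0 b0 c0; apply/funext => n.
have bc0 := conv_vanish b0 c0; have ab0 := conv_vanish a0 b0.
case: (ltrP n (ma + mb + mc)) => [ltn|/nat_above[k ->]].
  by rewrite (conv_vanish ab0 c0 ltn) (conv_vanish a0 bc0) //; lia.
rewrite (conv_trunc (N := k.+1) ab0 c0) // -[ma + mb + mc]addrA.
rewrite (conv_trunc (N := k.+1) a0 bc0) //.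
transitivity ((trunc a ma k.+1 * (trunc b mb k.+1 * trunc c mc k.+1))`_k).
  rewrite !coefM; apply: eq_bigr => i _; congr (_ * _).
  rewrite [LHS]coef_poly ifT; last by lia.
  by rewrite (conv_trunc (N := k.+1) b0 c0); last by lia.
rewrite mulrA !coefM; apply: eq_bigr => i _; congr (_ * _).
rewrite [RHS]coef_poly ifT; last by have := ltn_ord i; lia.
by rewrite (conv_trunc (N := k.+1) a0 b0).
Qed.

Lemma convC a b ma mb : vanish_below a ma -> vanish_below b mb ->
  conv a b = conv b a.
Proof.
move=> a0 b0; apply/funext => n.
case: (ltrP n (ma + mb)) => [ltn|/nat_above[k ->]].
  by rewrite (conv_vanish a0 b0 ltn) (conv_vanish b0 a0) //; lia.
rewrite (conv_trunc (N := k.+1) a0 b0) // [ma + mb]addrC.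
by rewrite (conv_trunc (N := k.+1) b0 a0) // mulrC.
Qed.

Lemma convDl a b c ma mb mc : vanish_below a ma -> vanish_below b mb ->
  vanish_below c mc -> forall n : int,
  conv (fun n => a n + b n) c n = conv a c n + conv b c n.
Proof.
move=> a0 b0 c0 n; pose m := Num.min ma mb.
have a0' : vanish_below a m by apply: vanish_le a0 _; rewrite /m; lia.
have b0' : vanish_below b m by apply: vanish_le b0 _; rewrite /m; lia.
have ab0 : vanish_below (fun n => a n + b n) m.
  by move=> k ltk; rewrite a0' // b0' // addr0.
case: (ltrP n (m + mc)) => [ltn|/nat_above[k ->]].
  rewrite (conv_vanish ab0 c0 ltn) (conv_vanish a0' c0 ltn).
  by rewrite (conv_vanish b0' c0 ltn) addr0.
rewrite (conv_trunc (N := k.+1) ab0 c0) // (conv_trunc (N := k.+1) a0' c0) //.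
rewrite (conv_trunc (N := k.+1) b0' c0) // -coefD -mulrDl.
congr (coefp k (_ * _)).
by apply/polyP => i; rewrite coefD !coef_poly; case: ifP; rewrite ?addr0.
Qed.

(* c X^m *)
Definition lmonomial (c : F) (m : int) : laurent.
Proof.
exists (fun n => if n == m then c else 0); exists m => n ltnm.
by rewrite lt_eqF.
Defined.

Definition ladd (s t : laurent) : laurent.
Proof.
exists (fun n => s n + t n).
case: (lcoef_bounded s) (lcoef_bounded t) => [m sm] [m' tm].
by exists (Num.min m m') => n ltn; rewrite sm ?tm ?addr0 //; lia.
Defined.

Definition lopp (s : laurent) : laurent.
Proof.
exists (fun n => - s n).
by case: (lcoef_bounded s) => m sm; exists m => n /sm->; rewrite oppr0.
Defined.

Definition lmul (s t : laurent) : laurent.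
Proof.
exists (conv s t).
case: (lcoef_bounded s) (lcoef_bounded t) => [m sm] [m' tm].
by exists (m + m'); apply: conv_vanish.
Defined.

Fact laddA : associative ladd.
Proof. by move=> s t u; apply/laurentP => n /=; rewrite addrA. Qed.
Fact laddC : commutative ladd.
Proof. by move=> s t; apply/laurentP => n /=; rewrite addrC. Qed.
Fact ladd0 : left_id (lmonomial 0 0) ladd.
Proof. by move=> s; apply/laurentP => n /=; rewrite if_same add0r. Qed.
Fact laddN : left_inverse (lmonomial 0 0) lopp ladd.
Proof. by move=> s; apply/laurentP => n /=; rewrite if_same addNr. Qed.

HB.instance Definition _ := GRing.isZmodule.Build laurent laddA laddC ladd0 laddN.

Fact lmulA : associative lmul.
Proof.
move=> s t u; apply/laurentP => n /=.
case: (lcoef_bounded s) (lcoef_bounded t) (lcoef_bounded u) => [m sm] [m' tm] [m2 um].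
by rewrite (convA sm tm um).
Qed.
Fact lmulC : commutative lmul.
Proof.
move=> s t; apply/laurentP => n /=.
by case: (lcoef_bounded s) (lcoef_bounded t) => [m sm] [m' tm]; rewrite (convC sm tm).
Qed.
Fact lmul1 : left_id (lmonomial 1 0) lmul.
Proof.
move=> s; apply/laurentP => n /=; rewrite /conv (fsbigE [:: 0]) //=.
  by rewrite big_cons big_nil in_setT eqxx mul1r addr0 subr0.
by move=> i _; rewrite inE => /negPf->; rewrite mul0r.
Qed.
Fact lmulDl : left_distributive lmul ladd.
Proof.
move=> s t u; apply/laurentP => n /=.
case: (lcoef_bounded s) (lcoef_bounded t) (lcoef_bounded u) => [m sm] [m' tm] [m2 um].
by rewrite (convDl sm tm um).
Qed.
Fact lone_neq0 : lmonomial 1 0 != 0.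
Proof. by apply/eqP => /laurentP/(_ 0)/=/eqP; rewrite oner_eq0. Qed.

HB.instance Definition _ :=
  GRing.Zmodule_isComNzRing.Build laurent lmulA lmulC lmul1 lmulDl lone_neq0.

Fact laurent_order (s : laurent) : s != 0 ->
  exists2 m, s m != 0 & vanish_below s m.
Proof.
move=> nz_s; case: (lcoef_bounded s) => m sm.
have [n snz] : exists n, s n != 0.
  apply: contrapT => no; case/eqP: nz_s; apply/laurentP => n /=; rewrite if_same.
  by apply: contrapT => /eqP snz; apply: no; exists n.
have [k Dn] : {k : nat | n = m + k%:Z}.
  by apply: nat_above; rewrite leNgt; apply/negP => /sm/eqP; apply/negP.
have ex : exists k : nat, s (m + k%:Z) != 0 by exists k; rewrite -Dn.
case: (ex_minnP ex) => k0 sk0 min_k0; exists (m + k0%:Z) => // j ltj.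
case: (ltrP j m) => [/sm //|/nat_above[i Dj]].
by apply/eqP/negPn/negP; rewrite Dj => /min_k0; lia.
Qed.

Let psinv (w : nat -> F) := fix psinv n : seq F :=
  if n is n'.+1 then
    rcons (psinv n') ((w 0)^-1 * ((n' == 0)%:R -
      \sum_(i < n') w i.+1 * (psinv n')`_(n' - i.+1)))
  else [::].

Fact psinv_exists (w : nat -> F) : w 0%N != 0 ->
  exists v : nat -> F, forall n, \sum_(i < n.+1) w i * v (n - i)%N = (n == 0)%:R.
Proof.
move=> w0; have sz n : size (psinv w n) = n.
  by elim: n => //= n IHn; rewrite size_rcons IHn.
have nth_psinv n i : (i < n)%N -> (psinv w n)`_i = (psinv w i.+1)`_i.
  elim: n => // n IHn; rewrite ltnS leq_eqVlt => /predU1P[-> //|ltin].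
  by rewrite [psinv w n.+1]/= nth_rcons sz ltin IHn.
exists (fun n => (psinv w n.+1)`_n) => n; rewrite big_ord_recl subn0.
rewrite [psinv w n.+1]/= nth_rcons sz ltnn eqxx mulVKf //.
rewrite -[RHS](subrK (\sum_(i < n) w i.+1 * (psinv w n)`_(n - i.+1))).
congr (_ + _); apply: eq_bigr => i _; rewrite nth_psinv //.
by have := ltn_ord i; lia.
Qed.

Fact lmulV_exists (s : laurent) : s != 0 -> exists t, lmul t s = 1.
Proof.
case/laurent_order=> m sm0 sm; pose w (i : nat) := s (m + i%:Z).
have [|v Dv] := @psinv_exists w; first by rewrite /w addr0.
have tm : vanish_below (fun n => if n + m is Posz k then v k else 0) (- m).
  by move=> n ltn; case E: (n + m) => [k|//]; lia.
pose t := Laurent (ex_intro _ _ tm); exists t; rewrite lmulC.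
apply/laurentP => n /=; case: (ltrP n 0) => [ltn|/nat_above[k ->]].
  by rewrite (conv_vanish sm tm) ?addrN // lt_eqF.
have /= := conv_trunc sm tm (ltnSn k); rewrite addrN !add0r coefM => ->.
rewrite (_ : (k%:Z == 0) = (k == 0)) //.
have -> : (if k == 0 then 1 else 0) = (k == 0)%:R :> F by case: (k == 0).
rewrite -Dv; apply: eq_bigr => i _; have ltik := ltn_ord i.
rewrite !coef_poly !ifT; [congr (_ * _)|lia..].
by rewrite (_ : - m + _ + m = (k - i)%N); last lia.
Qed.

Definition linv (s : laurent) : laurent :=
  if pselect (exists t, lmul t s = 1) is left ex then sval (cid ex) else 0.

Fact lmulV (s : laurent) : s != 0 -> linv s * s = 1.
Proof.
by rewrite /linv; case: pselect => [ex _|no /lmulV_exists/no //]; case: cid.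
Qed.
Fact linv0 : linv 0 = 0.
Proof.
rewrite /linv; case: pselect => // ex; case: cid => t /= t0; move: t0.
rewrite -[lmul t 0]/(t * 0) mulr0 => /esym/eqP.
by rewrite oner_eq0.
Qed.

HB.instance Definition _ := GRing.ComNzRing_isField.Build laurent lmulV linv0.

End LaurentField.

(******************************************************************************)
(* With t_i = x_i^(1/p), the elements of K((t_r))((t_{r-1}))...((t_1)): the   *)
(* Laurent variable added last is t_1, that is, index 0. The coefficient at   *)
(* n : Z^r (gcoef s n) is that of x^(n/p) = t^n, so that all exponents are    *)
(* integers: they are the rational ones multiplied by p. Every element which  *)
(* occurs in a problem with ramification index p lies in this field.          *)
(******************************************************************************)
Fixpoint iter_laurent (K : fieldType) (r : nat) : fieldType :=
  if r is r'.+1 then laurent (iter_laurent K r') else K.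

Fixpoint gcoef (K : fieldType) (r : nat) :
    iter_laurent K r -> r.-tuple int -> K :=
  match r with
  | 0 => fun s _ => s
  | r'.+1 => fun s n => gcoef (lcoef s (thead n)) (behead_tuple n)
  end.

Fixpoint gmonomial (K : fieldType) (r : nat) : r.-tuple int -> iter_laurent K r :=
  match r with
  | 0 => fun _ => 1
  | r'.+1 => fun n => lmonomial (gmonomial K (behead_tuple n)) (thead n)
  end.

Fact behead_tupleE (T : Type) (r : nat) (c : T) (k : r.-tuple T) :
  behead_tuple [tuple of c :: k] = k :> r.-tuple T.
Proof. exact: val_inj. Qed.

Lemma gcoef_inj (K : fieldType) (r : nat) (s t : iter_laurent K r) :
  (forall n, gcoef s n = gcoef t n) -> s = t.
Proof.
elim: r => [|r IHr] in s t * => eq_st; first exact: (eq_st [tuple]).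
apply/laurentP => m; apply: IHr => n; have := eq_st [tuple of m :: n].
by rewrite /= !theadE behead_tupleE.
Qed.

Lemma gcoef_monomial (K : fieldType) (r : nat) (m n : r.-tuple int) :
  gcoef (gmonomial K m) n = (n == m)%:R.
Proof.
have gcoef0 r' (k : r'.-tuple int) : gcoef (0 : iter_laurent K r') k = 0.
  by elim: r' k => //= r' IHr k; rewrite if_same IHr.
elim: r => [|r IHr] in m n *; first by rewrite (tuple0 m) (tuple0 n) eqxx.
case/tupleP: m => a m; case/tupleP: n => b n.
rewrite /= !theadE -!val_eqE /= eqseq_cons.
by case: eqP => _; rewrite ?gcoef0 // !behead_tupleE IHr.
Qed.

Section Problem.
Variables (K : fieldType) (r : nat).
Implicit Types (s f g : iter_laurent K r) (P Q : {poly iter_laurent K r}).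
Implicit Types (m : r.-tuple nat) (n : r.-tuple int) (q : r.-1.-tuple nat).

(* The exponent of x^m in the variables t. *)
Definition xexp (p : nat) m : r.-tuple int := [tuple ((p * tnth m i)%N : int) | i < r].

(* The exponent of zeta^m in the variables t, for zeta_i = t_i / t_{i+1}^(q_i)
   (i < r) and zeta_r = t_r; here indices start from 0. *)
Definition zexp q m : r.-tuple int :=
  [tuple (tnth m i)%:Z -
         (if val i is i'.+1 then (nth 0%N q i' * nth 0%N m i')%N%:Z else 0) | i < r].

(* For E = xexp p, resp. zexp q, this is the ring K[[x]], resp. K[[zeta]]: E is
   then injective, and the coefficient of x^m, resp. zeta^m, in s is that of
   t^(E m). *)
Definition power_series (E : r.-tuple nat -> r.-tuple int) s :=
  forall n, gcoef s n != 0 -> exists m, n = E m.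

Definition in_Kx p := power_series (xexp p).
Definition in_Kzeta q := power_series (zexp q).

Definition xvar p (i : 'I_r) : iter_laurent K r :=
  gmonomial K (xexp p [tuple (j == i : nat) | j < r]).

(* s belongs to (x)^k, for the ideal (x) of K[[x]]. *)
Fixpoint in_xpow p (k : nat) s : Prop :=
  if k is k'.+1 then
    exists t : 'I_r -> iter_laurent K r,
      (forall i, in_xpow p k' (t i)) /\ s = \sum_i xvar p i * t i
  else in_Kx p s.

Definition in_Kx_poly p Q := forall j, in_Kx p Q`_j.

Definition xadic_order_le p Q (nu0 : nat) :=
  Q != 0 /\ forall k, (forall j, in_xpow p k Q`_j) -> (k <= nu0)%N.

Definition admissible_poly p d nu0 Q :=
  [/\ in_Kx_poly p Q, (size Q <= d.+1)%N & xadic_order_le p Q nu0].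

(* s is a monomial in the variables zeta times a unit of K[[zeta]]. *)
Definition monomialized q s :=
  exists m w, [/\ in_Kzeta q w, exists2 w', in_Kzeta q w' & w * w' = 1
                & s = gmonomial K (zexp q m) * w].

Definition lex_valuation q f m :=
  gcoef f (zexp q m) != 0 /\
  forall m', gcoef f (zexp q m') != 0 -> ((m : r.-tuplelexi nat) <= m')%O.

(* B is the sequence of the pairs (i_k, j_k); the indices of the variables start
   from 0, so that q_i > 0 makes sense for i < r - 1, and i_{sigma+1} is r. *)
Definition is_blocks q (B : seq (nat * nat)) :=
  [/\ sorted ltn (flatten [seq [:: b.1; b.2] | b <- B]),
      all (fun b => b.2 < r)%N B
    & forall i, (i < r)%N ->
        ((i.+1 < r)%N && (0 < nth 0 q i)%N) = has (fun b => b.1 <= i < b.2)%N B].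

Definition Ltilde q (B : seq (nat * nat)) n : int :=
  let i_ k := nth r (unzip1 B) k in
  let j_ k := nth r (unzip2 B) k in
  \sum_(0 <= i < i_ 0%N) n`_i +
  \sum_(k < size B)
    (\sum_(i_ k <= i < j_ k) (\prod_(i <= l < j_ k) nth 0 q l)%N%:Z * n`_i +
     \sum_(j_ k <= i < i_ k.+1) n`_i).

(* B is meant to satisfy is_blocks q' B, and y0 to be f / g. *)
Definition in_Qnu p d nu0 q' B (y0 : iter_laurent K r) (nu : nat) Q :=
  admissible_poly p d nu0 Q /\
  forall n, gcoef Q.[y0] n != 0 -> nu%:Z <= Ltilde q' B n.

End Problem.

(* Finite tables, as lists of index-value pairs. *)
Definition is_table (I : eqType) (V : Type) (D : pred I) (T : seq (I * V)) :=
  uniq (unzip1 T) /\ unzip1 T =i D.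

Definition entry (I : eqType) (V : nmodType) (T : seq (I * V)) (x : I) : V :=
  \sum_(e <- T | e.1 == x) e.2.

Definition is_coef_procedure (K : fieldType) (r : nat) (q : r.-1.-tuple nat)
    (f g : iter_laurent K r)
    (O : nat -> seq (seq nat * K) * seq (seq nat * K)) :=
  let lists_coefs s (T : seq (seq nat * K)) k :=
    is_table [pred m | (size m == r) && (sumn m <= k)%N] T /\
    forall m : r.-tuple nat, (sumn m <= k)%N ->
      entry T (tval m) = gcoef s (zexp q m) in
  forall k, lists_coefs f (O k).1 k /\ lists_coefs g (O k).2 k.

(* I_N *)
Definition index_set (r d N : nat) : pred (seq nat * nat) :=
  [pred ij | [&& size ij.1 == r, (sumn ij.1 <= N)%N & (ij.2 <= d)%N]].

Definition parametric_description (K : fieldType) (r p d nu0 : nat)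
    (S : {poly iter_laurent K r} -> Prop)
    (out : nat * seq (seq (seq nat * nat * K))) :=
  let: (N, bs) := out in
  let I_N := index_set r d N in
  let comb (theta : 'I_(size bs) -> K) (ij : seq nat * nat) : K :=
    \sum_m theta m * entry (nth [::] bs m) ij in
  [/\ (nu0 <= N)%N,
      forall b, b \in bs -> is_table I_N b,
      forall theta, (forall ij, I_N ij -> comb theta ij = 0) ->
        forall m, theta m = 0
    & forall Q, in_Kx_poly p Q -> (size Q <= d.+1)%N ->
        let a (i : r.-tuple nat) j := gcoef Q`_j (xexp p i) in
        S Q <->
        (exists theta, forall (i : r.-tuple nat) j, I_N (tval i, j) ->
           a i j = comb theta (tval i, j)) /\
        (exists (i : r.-tuple nat) j, (sumn i <= nu0)%N /\ a i j != 0)].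

(******************************************************************************)
(* Algorithms over a field. Programs are written in a simply typed functional *)
(* language with natural numbers, lists and their recursors (Goedel's T), and *)
(* abstract field elements, on which a program can only perform the field     *)
(* operations and zero tests; the only constants of the field are 0 and 1.    *)
(* An algorithm runs such a program in an unbounded loop, which makes the     *)
(* model Turing-complete. A procedure given in input is a value of function   *)
(* type, which programs can only apply. Programs do not depend on the field.  *)
(******************************************************************************)
Inductive ty : Set :=
  | TNat | TBool | TField
  | TProd of ty & ty | TList of ty | TFun of ty & ty.

Declare Scope ty_scope.
Delimit Scope ty_scope with ty.
Bind Scope ty_scope with ty.
Infix "**" := TProd (at level 40, left associativity) : ty_scope.
Infix "=>>" := TFun (at level 60, right associativity) : ty_scope.

Inductive var : seq ty -> ty -> Set :=
  | VZ G a : var (a :: G) a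
  | VS G a b : var G a -> var (b :: G) a.

Inductive tm (G : seq ty) : ty -> Set :=
  | Var a : var G a -> tm G a
  | Lam a b : tm (a :: G) b -> tm G (a =>> b)
  | App a b : tm G (a =>> b) -> tm G a -> tm G b
  | Zero : tm G TNat
  | Succ : tm G TNat -> tm G TNat
  | NatRec a : tm G a -> tm G (TNat =>> a =>> a) -> tm G TNat -> tm G a
  | TrueT : tm G TBool
  | FalseT : tm G TBool
  | If a : tm G TBool -> tm G a -> tm G a -> tm G a
  | Pair a b : tm G a -> tm G b -> tm G (a ** b)
  | Fst a b : tm G (a ** b) -> tm G a
  | Snd a b : tm G (a ** b) -> tm G b
  | Nil a : tm G (TList a)
  | Cons a : tm G a -> tm G (TList a) -> tm G (TList a)
  | ListRec a b : tm G b -> tm G (a =>> TList a =>> b =>> b) ->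
                  tm G (TList a) -> tm G b
  | FZero : tm G TField
  | FOne : tm G TField
  | FAdd : tm G TField -> tm G TField -> tm G TField
  | FOpp : tm G TField -> tm G TField
  | FMul : tm G TField -> tm G TField -> tm G TField
  | FInv : tm G TField -> tm G TField
  | FIsZero : tm G TField -> tm G TBool.

Section Semantics.
Variable K : fieldType.

Fixpoint sem (a : ty) : Type :=
  match a with
  | TNat => nat
  | TBool => bool
  | TField => K
  | TProd a b => sem a * sem b
  | TList a => seq (sem a)
  | TFun a b => sem a -> sem b
  end.

Fixpoint env (G : seq ty) : Type :=
  if G is a :: G' then (sem a * env G')%type else unit.

Fixpoint lookup G a (x : var G a) : env G -> sem a :=
  match x with
  | VZ _ _ => fun e => e.1
  | VS _ _ _ x' => fun e => lookup x' e.2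
  end.

Definition list_rec_sem A B (z : B) (h : A -> seq A -> B -> B) :=
  fix rec (l : seq A) : B := if l is x :: l' then h x l' (rec l') else z.

Fixpoint eval G a (t : tm G a) (e : env G) : sem a :=
  match t with
  | Var _ x => lookup x e
  | Lam _ _ b => fun v => eval b (v, e)
  | App _ _ u v => (eval u e) (eval v e)
  | Zero => 0%N
  | Succ u => (eval u e).+1
  | NatRec _ z h n => nat_rect _ (eval z e) (eval h e) (eval n e)
  | TrueT => true
  | FalseT => false
  | If _ c u v => if eval c e then eval u e else eval v e
  | Pair _ _ u v => (eval u e, eval v e)
  | Fst _ _ u => (eval u e).1
  | Snd _ _ u => (eval u e).2
  | Nil _ => [::]
  | Cons _ u v => eval u e :: eval v e
  | ListRec _ _ z h l => list_rec_sem (eval z e) (eval h e) (eval l e)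
  | FZero => 0
  | FOne => 1
  | FAdd u v => eval u e + eval v e
  | FOpp u => - eval u e
  | FMul u v => eval u e * eval v e
  | FInv u => (eval u e)^-1
  | FIsZero u => eval u e == 0
  end.

End Semantics.

Record algorithm (I O : ty) : Set := Algorithm {
  state : ty;
  init : tm [::] (I =>> state);
  step : tm [::] (state =>> state);
  halted : tm [::] (state =>> TBool);
  result : tm [::] (state =>> O) }.

(* The loop stops, and its first final state yields y. *)
Definition returns (K : fieldType) I O (A : algorithm I O)
    (x : sem K I) (y : sem K O) : Prop :=
  let run k := iter k (eval (step A) (tt : env K [::])) (eval (init A) tt x) in
  let stop k := eval (halted A) (tt : env K [::]) (run k) in
  exists k, [/\ stop k, forall k', (k' < k)%N -> ~~ stop k'
              & y = eval (result A) (tt : env K [::]) (run k)].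

Definition coef_table : ty := TList (TList TNat ** TField).

(* d, nu0, p, nu; q, q'; the two valuations; the coefficients of f and g. *)
Definition input : ty :=
  TNat ** TNat ** TNat ** TNat ** TList TNat ** TList TNat **
  TList TNat ** TList TNat ** (TNat =>> coef_table ** coef_table).

(* N and the list of the vectors b_m, as tables indexed by I_N. *)
Definition output : ty := TNat ** TList (TList (TList TNat ** TNat ** TField)).

(* Main.v *)
(* Put A = Q(x, y_0) g^d, a combination of the monomials x^i f^j g^(d-j) with the
   coefficients of Q. Since g is a monomial in u times a unit, Q lies in Q_nu if
   and only if every exponent of A has weight L >= c, with c = nu + d L(g). As
   L(x^i) >= |i|, the coefficients of A of weight < c only involve the
   coefficients of Q with |i| < c, and linearly; the difficulty is to bound
   effectively the exponents at which these coefficients have to be tested.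
   Let D = m d. Counting unknowns and equations produces polynomials c_0, ..., c_m
   in t = x^(1/p), not all zero, supported on the cube [0, n]^r, and S in K[t][y],
   such that
     c_0 + c_1 Q + ... + c_m Q^m = S P + W,
   where W vanishes on the cube [0, n']^r. Here n' is slightly larger than
   n (w_1 + ... + w_r), the w_i being the weights of the t_i. The c_l are not all
   zero because P has a term of small t-degree, so that S P vanishes on a large
   cube only if S = 0. At y_0, the relation becomes
     sum_l c_l A^l g^(D-dl) = V, with V of weight > n'.
   If l_0 is the least l with c_l <> 0, comparison of initial exponents (for the
   weight, then the lexicographic order) shows that the one of A divides the one
   of c_(l_0) g^(D-d l_0). If A has weight < c, its initial exponent is therefore
   bounded, and finitely many linear conditions characterize Q_nu. *)
Require Import Defs.
From mathcomp Require Import all_boot all_order all_algebra.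
From mathcomp Require Import boolp zify ring.
Set Implicit Arguments.
Unset Strict Implicit.
Unset Printing Implicit Defensive.
Import Order.TTheory GRing.Theory Num.Theory.
Local Open Scope ring_scope.

(** * Exponents and Cauchy products *)

(** The obstacle is that u_i has weight 0 whenever q'_i > 0: infinitely many monomials of K[[u]] may
    have weight < c, so the condition on A is not visibly finite. The bound also has to be computed
    without P, of which only the existence is known. An exact relation between the powers of Q
    modulo P would have coefficients built from those of P, with no computable bound on their
    initial exponents. A relation valid on a cube is enough: all w_i being at least 1, an exponent
    of t outside [0, n']^r has weight > n', beyond the initial terms that are compared. P enters
    only through one term of x-degree at most nu0, hence of t-degree at most B = p nu0. S is
    supported on [0, n' - B]^r; its unknowns match all equations except d layers of the cube and a
    boundary term. The choice of m pays for the former, that of n for the latter. Three systems of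
    coordinates occur: t for the unknowns, zeta for the given coefficients, u for divisibility.
    Exponents are lists of naturals in each of them, and the changes of coordinates are
    unitriangular, hence preserve the lexicographic order. *)

Fixpoint zipw (op : nat -> nat -> nat) (l m : seq nat) : seq nat :=
  if l is a :: l' then op a (head 0%N m) :: zipw op l' (behead m) else [::].

Local Notation addl := (zipw addn).
Local Notation subl := (zipw subn).
Local Notation leql := (all2 leq).
Definition dot (l m : seq nat) : nat := sumn (zipw muln l m).

Fixpoint below (m : seq nat) : seq (seq nat) :=
  if m is a :: m' then [seq i :: k | i <- iota 0 a.+1, k <- below m'] else [:: [::]].

Lemma below_cons a m :
  below (a :: m) = [seq i :: k | i <- iota 0 a.+1, k <- below m].
Proof. by []. Qed.

Lemma size_zipw op l m : size (zipw op l m) = size l.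
Proof. by elim: l m => //= a l IHl m; rewrite IHl. Qed.

Lemma mem_below k m : (k \in below m) = leql k m.
Proof.
elim: m k => [|a m IHm] [|i k] //; rewrite below_cons.
  by apply/negP => /allpairsP [[x y] []].
rewrite [RHS]/= -IHm; apply/allpairsP/andP => [[[x y] [xi ym [-> ->]]]|[ia km]].
  by move: xi; rewrite mem_iota.
by exists (i, k); rewrite mem_iota.
Qed.

Lemma uniq_below m : uniq (below m).
Proof.
elim: m => // a m IHm; rewrite below_cons.
apply: allpairs_uniq; rewrite ?iota_uniq //.
by move=> [x y] [x' y'] _ _ [-> ->].
Qed.

Lemma size_below r n : size (below (nseq r n)) = (n.+1 ^ r)%N.
Proof.
elim: r => // r IHr; rewrite [nseq _ _]/= below_cons.
by rewrite size_allpairs size_iota IHr expnS.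
Qed.

Lemma size_leql k m : leql k m -> size k = size m.
Proof. by rewrite all2E => /andP[/eqP]. Qed.

Lemma leql_trans k m n : leql k m -> leql m n -> leql k n.
Proof.
elim: k m n => [|a k IHk] [|b m] [|c n] //= /andP[ab km] /andP[bc mn].
by rewrite (leq_trans ab bc) (IHk _ _ km mn).
Qed.

Lemma leqlP k m : reflect (exists2 l, size l = size k & m = addl k l) (leql k m).
Proof.
apply: (iffP idP) => [|[l sz_l ->]].
  elim: k m => [|a k IHk] [|b m] //=; first by exists [::].
  case/andP=> ab /IHk[l szl ->]; exists ((b - a)%N :: l); rewrite /= ?szl //.
  by rewrite subnKC.
by elim: k l sz_l => [|a k IHk] [|b l] //= [/IHk->]; rewrite leq_addr.
Qed.

Lemma addlK k m : size m = size k -> subl (addl k m) k = m.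
Proof.
elim: k m => [|a k IHk] [|b m] //= [sz]; rewrite IHk //.
by rewrite addKn.
Qed.

Lemma addlI k m m' : size m = size k -> size m' = size k ->
  addl k m = addl k m' -> m = m'.
Proof. by move=> sz sz' /(congr1 (subl^~ k)); rewrite !addlK. Qed.

Lemma addlC k m : size m = size k -> addl k m = addl m k.
Proof. by elim: k m => [|a k IHk] [|b m] //= [sz]; rewrite IHk // addnC. Qed.

Lemma subl_eq k m l : size k = size m -> size l = size m ->
  leql k m -> subl m k = l <-> m = addl k l.
Proof.
move=> sz szl /leqlP[x szx ->]; rewrite addlK //.
split=> [->//|]; apply: addlI => //; congruence.
Qed.

Local Notation lexl a b := ((a : seqlexi nat) <= b)%O.

Lemma lexl_cons a b k m :
  lexl (a :: k) (b :: m) = (a < b)%N || (a == b) && lexl k m.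
Proof. by rewrite lexi_cons !leEnat; case: ltngtP. Qed.

Lemma lexl_anti a b : lexl a b -> lexl b a -> a = b.
Proof. by move=> ab ba; apply/(@le_anti _ (seqlexi nat))/andP. Qed.

Lemma lexl_add k l m : size l = size k -> size m = size k ->
  lexl (addl k l) (addl k m) = lexl l m.
Proof.
elim: k l m => [|a k IHk] [|b l] [|c m] //= [sz] [sz'].
by rewrite !lexl_cons IHk // ltn_add2l eqn_add2l.
Qed.

Lemma leql_lexl a b : leql a b -> lexl a b.
Proof.
elim: a b => [|x a IHa] [|y b] //= /andP[xy /IHa ab].
by rewrite lexl_cons ab andbT orbC -leq_eqVlt.
Qed.

(** For lists of a fixed length the lexicographic order is a well-order: take the least possible
    head, then the least tail among the members with that head. *)
Lemma lexl_min r (P : seq nat -> Prop) :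
  (exists2 m, size m = r & P m) ->
  exists m, [/\ size m = r, P m & forall m', size m' = r -> P m' -> lexl m m'].
Proof.
elim: r P => [|r IHr] P [m szm Pm].
  by exists m; split=> // m' /size0nil->; rewrite (size0nil szm).
case: m szm Pm => // a m [szm] Pm.
have ex : exists a, `[< exists2 m, size m = r & P (a :: m) >].
  by exists a; apply/asboolP; exists m.
case: (ex_minnP ex) => a0 /asboolP exa0 min_a0.
have [k [szk Pk min_k]] := IHr _ exa0.
exists (a0 :: k); split=> //=; first by rewrite szk.
case=> // b m' [szm'] Pm'; rewrite lexl_cons.
have: (a0 <= b)%N by apply: min_a0; apply/asboolP; exists m'.
rewrite leq_eqVlt => /predU1P[eb|->//]; rewrite eb eqxx min_k ?orbT //.
by rewrite eb.
Qed.

Section Cauchy.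
Variable R : pzRingType.
Implicit Types a b : seq nat -> R.

(** The values lie in an arbitrary ring because they are taken in [K], but also in [{poly K}] for
    series with polynomial coefficients. *)
Definition cauchy (m : seq nat) a b : R := \sum_(k <- below m) a k * b (subl m k).

Lemma eq_cauchy m a a' b b' :
  (forall k, size k = size m -> a k = a' k) ->
  (forall k, size k = size m -> b k = b' k) -> cauchy m a b = cauchy m a' b'.
Proof.
move=> aa' bb'; rewrite /cauchy; apply: eq_big_seq => k.
by rewrite mem_below => /size_leql szk; rewrite aa' // bb' // size_zipw.
Qed.

Lemma cauchy_cons i m a b :
  cauchy (i :: m) a b =
  \sum_(j < i.+1) cauchy m (fun k => a (nat_of_ord j :: k)) (fun k => b ((i - j)%N :: k)).
Proof.
by rewrite /cauchy below_cons big_allpairs_dep -[iota _ _]/(index_iota 0 i.+1) big_mkord.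
Qed.

Lemma cauchy_neq0 m a b : cauchy m a b != 0 ->
  exists k l, [/\ size k = size m, size l = size m, m = addl k l, a k != 0 & b l != 0].
Proof.
move=> nz; have [k km] : exists2 k, k \in below m & a k * b (subl m k) != 0.
  apply/hasP; apply: contraNT nz => /hasPn z; apply/eqP.
  by rewrite /cauchy big_seq big1 // => k /z; rewrite negbK => /eqP.
rewrite mem_below in km => nzk; have szk := size_leql km.
exists k, (subl m k); split; rewrite ?size_zipw //.
- by apply/subl_eq; rewrite ?size_zipw.
- by apply: contraNneq nzk => ->; rewrite mul0r.
- by apply: contraNneq nzk => ->; rewrite mulr0.
Qed.

End Cauchy.

(** * Initial exponents for a weight refined by the lexicographic order *)

Section Lead.
Variables (r : nat) (wt : seq nat -> nat).
Hypothesis wtD : forall k l, size k = r -> size l = r -> wt (addl k l) = (wt k + wt l)%N.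

Local Notation key m := (wt m :: m).

(** Putting the weight in front of the list turns the refined order into a lexicographic one, so
    that [lexl_min] applies. The weight is a parameter because several are used: the weight L, the
    total degree, the constant 0 (the plain lexicographic order) and a single coordinate. *)
Definition lead (R : pzRingType) (a : seq nat -> R) m :=
  [/\ size m = r, a m != 0
    & forall k, size k = r -> a k != 0 -> lexl (key m) (key k)].

Lemma lead_exists (R : pzRingType) (a : seq nat -> R) k :
  size k = r -> a k != 0 -> exists m, lead a m.
Proof.
move=> szk ak; pose P k' := exists2 m, k' = key m & a m != 0.
have [|m [szm [m' def_m am'] min_m]] := @lexl_min r.+1 P.
  by exists (key k); rewrite /= ?szk //; exists k.
move: szm; rewrite def_m /= => -[szm]; exists m'; split=> // l szl al.
by rewrite -def_m; apply: min_m; rewrite /= ?szl //; exists l.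
Qed.

Lemma lead_unique (R : pzRingType) (a : seq nat -> R) m m' :
  lead a m -> lead a m' -> m = m'.
Proof.
case=> szm am minm [szm' am' minm'].
by have [] := lexl_anti (minm _ szm' am') (minm' _ szm am).
Qed.

Lemma key_add k l : size k = r -> size l = r -> key (addl k l) = addl (key k) (key l).
Proof. by move=> szk szl /=; rewrite wtD. Qed.

Lemma lead_wt (R : pzRingType) (a : seq nat -> R) m k :
  lead a m -> size k = r -> a k != 0 -> (wt m <= wt k)%N.
Proof. by case=> _ _ minm szk /(minm _ szk); rewrite lexl_cons leq_eqVlt; lia. Qed.

Lemma lexl_key_add k l k' l' :
  size k = r -> size l = r -> size k' = r -> size l' = r ->
  lexl (key k) (key k') -> lexl (key l) (key l') ->
  lexl (key (addl k l)) (key (addl k' l')).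
Proof.
move=> szk szl szk' szl' kk' ll'; rewrite !key_add //.
apply: (@le_trans _ (seqlexi nat) (addl (key k) (key l'))).
  by rewrite lexl_add //= ?szk ?szl ?szl'.
by rewrite !(@addlC _ (key l')) ?lexl_add //= ?szk ?szk' ?szl'.
Qed.

(** In any other decomposition k + l with nonzero coefficients, both keys are at least the minimal
    ones; as the order is compatible with addition, this forces k = m. *)
Lemma cauchy_lead (R : idomainType) (a b : seq nat -> R) m m' :
  lead a m -> lead b m' -> cauchy (addl m m') a b = a m * b m'.
Proof.
move=> [szm am minm] [szm' bm' minm']; rewrite /cauchy.
have mb : m \in below (addl m m').
  by rewrite mem_below; apply/leqlP; exists m'; rewrite // szm'.
rewrite (bigD1_seq m) ?uniq_below //= addlK ?szm' // big1_seq ?addr0 //.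
move=> k /andP[km]; rewrite mem_below => lek; have szk := size_leql lek.
rewrite size_zipw szm in szk.
set l := subl _ k; have szl : size l = r by rewrite !size_zipw.
have def_l : addl m m' = addl k l.
  by apply/subl_eq; rewrite ?size_zipw ?szk ?szm.
case: (eqVneq (a k) 0) => [->|ak]; first by rewrite mul0r.
case: (eqVneq (b l) 0) => [->|bl]; first by rewrite mulr0.
have le1 := minm _ szk ak; have le2 := minm' _ szl bl.
have keyml : lexl (key (addl k l)) (key (addl m l)).
  by rewrite -def_l; apply: lexl_key_add.
case/negP: km; apply/eqP; rewrite !key_add // in keyml.
rewrite !(@addlC _ (key l)) ?lexl_add //= ?szk ?szm ?szl // in keyml.
by case: (lexl_anti keyml le1) => _.
Qed.

Lemma lead_mul (R : idomainType) (a b c : seq nat -> R) m m' :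
  (forall k, size k = r -> c k = cauchy k a b) ->
  lead a m -> lead b m' -> lead c (addl m m').
Proof.
move=> def_c lead_a lead_b; have [szm am minm] := lead_a.
have [szm' bm' minm'] := lead_b; have sz : size (addl m m') = r by rewrite size_zipw.
split=> [//||k szk]; first by rewrite def_c // cauchy_lead // mulf_neq0.
rewrite def_c // => /cauchy_neq0[i [j [szi szj -> ai bj]]].
apply: lexl_key_add => //; first by rewrite szi.
- by rewrite szj.
- by apply: minm; rewrite ?szi.
- by apply: minm'; rewrite ?szj.
Qed.

End Lead.

(** * Coordinates of iterated Laurent series *)

(* [zexp] on lists, with first coordinate shifted by [- c]: this is what zexp
   induces on the tail of an exponent. *)
Fixpoint zexpc (c : nat) (q m : seq nat) : seq int :=
  if m is m0 :: m' then
    (m0%:Z - c%:Z) :: zexpc (head 0%N q * m0) (behead q) m'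
  else [::].

(* For c = 0, the exponent of t^a in the variables zeta. *)
Fixpoint tcoord (c : nat) (q a : seq nat) : seq nat :=
  if a is a0 :: a' then
    (a0 + c)%N :: tcoord (head 0 q * (a0 + c)) (behead q) a'
  else [::].

Lemma size_zexpc c q m : size (zexpc c q m) = size m.
Proof. by elim: m c q => //= a m IHm c q; rewrite IHm. Qed.

Lemma size_tcoord c q m : size (tcoord c q m) = size m.
Proof. by elim: m c q => //= a m IHm c q; rewrite IHm. Qed.

Lemma zexpc_inj c q : injective (zexpc c q).
Proof.
move=> m m'; elim: m m' c q => [|a m IHm] [|b m'] c q //= [Eab].
have -> : a = b by lia.
by move/IHm->.
Qed.

Lemma zexpc_tcoord c q a : zexpc c q (tcoord c q a) = map Posz a.
Proof. by elim: a c q => //= x a IHa c q; rewrite IHa PoszD addrK. Qed.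

(** With an empty [q] the coordinates are those in t. Thus [zsupp 0 [::]] is K[[t]], and one theory
    covers K[[t]], K[[zeta]] and K[[u]]. *)
Lemma zexpc_nil m : zexpc 0 [::] m = map Posz m.
Proof. by elim: m => //= a m ->; rewrite subr0. Qed.

Lemma zexpc_nth c q m i : (i < size m)%N ->
  nth 0 (zexpc c q m) i =
  (nth 0 m i)%:Z - (if i is i'.+1 then (nth 0 q i' * nth 0 m i')%N%:Z else c%:Z).
Proof.
elim: m c q i => // a m IHm c q [|i] //= lti.
by rewrite IHm //; case: i lti => [|i] _; rewrite ?nth0 ?nth_behead.
Qed.

Lemma zexpE r (q : r.-1.-tuple nat) (m : r.-tuple nat) :
  tval (zexp q m) = zexpc 0 q m.
Proof.
apply: (@eq_from_nth _ 0); rewrite ?size_zexpc ?size_tuple // => i lti.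
rewrite zexpc_nth ?size_tuple // -[i]/(nat_of_ord (Ordinal lti)).
by rewrite -tnth_nth tnth_mktuple (tnth_nth 0%N).
Qed.

Definition leqn (q q' : seq nat) := forall i, (nth 0 q i <= nth 0 q' i)%N.

(** One has zeta_i = u_i t_(i+1)^(q'_i - q_i), and t_(i+1) is itself a monomial in u: exponents can
    only grow from zeta to u. *)
Lemma zexpc_le c c' q q' m : (c <= c')%N -> leqn q q' ->
  exists2 m', zexpc c q m = zexpc c' q' m' & leql m m'.
Proof.
elim: m c c' q q' => [|a m IHm] c c' q q' lec leq_q; first by exists [::].
have [||m' Em lem] := IHm (head 0 q * a)%N (head 0 q' * (a + (c' - c)))%N
  (behead q) (behead q').
- by rewrite leq_mul ?leq_addr // -!nth0.
- by move=> i; rewrite !nth_behead.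
exists ((a + (c' - c))%N :: m'); last by rewrite /= leq_addr.
by rewrite /= Em; congr (_ :: _); lia.
Qed.

(** The change of coordinates is unitriangular: as long as the preceding coordinates of a and b
    agree, the next ones undergo the same shift. *)
Lemma lexl_zexpc c c' q q' a a' b b' :
  zexpc c q a = zexpc c' q' a' -> zexpc c q b = zexpc c' q' b' ->
  lexl a b -> lexl a' b'.
Proof.
elim: a c c' q q' a' b b' => [|x a IHa] c c' q q' [|x' a'] [|y b] [|y' b'] //=.
case=> Ex Ea [Ey Eb]; rewrite !lexl_cons => /orP[ltxy|/andP[/eqP exy leab]].
  by apply/orP; left; lia.
have exy' : x' = y' by lia.
move: Ea Eb; rewrite -exy -exy' => Ea Eb; rewrite eqxx (IHa _ _ _ _ _ _ _ Ea Eb) ?orbT //.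
Qed.

Section Coefficients.
Variable K : fieldType.

Fixpoint gco (r : nat) : iter_laurent K r -> seq int -> K :=
  match r with
  | 0 => fun s _ => s
  | r'.+1 => fun s n => gco (lcoef s (head 0 n)) (behead n)
  end.

Lemma gcoE r (s : iter_laurent K r) (n : r.-tuple int) : gcoef s n = gco s n.
Proof.
elim: r s n => // r IHr s n; case/tupleP: n => n0 n /=.
by rewrite theadE behead_tupleE IHr.
Qed.

Lemma gco_inj r (s t : iter_laurent K r) :
  (forall n, size n = r -> gco s n = gco t n) -> s = t.
Proof.
by move=> st; apply: gcoef_inj => n; rewrite !gcoE st ?size_tuple.
Qed.

Lemma gcoD r (s t : iter_laurent K r) n : gco (s + t) n = gco s n + gco t n.
Proof. by elim: r s t n => // r IHr s t n; rewrite /= -IHr. Qed.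

Lemma gcoN r (s : iter_laurent K r) n : gco (- s) n = - gco s n.
Proof. by elim: r s n => // r IHr s n; rewrite /= -IHr. Qed.

Lemma gco0 r n : gco (0 : iter_laurent K r) n = 0.
Proof. by elim: r n => //= r IHr n; rewrite if_same IHr. Qed.

Lemma gco_sum r I (s : seq I) (P : pred I) (F : I -> iter_laurent K r) n :
  gco (\sum_(i <- s | P i) F i) n = \sum_(i <- s | P i) gco (F i) n.
Proof. by apply: (big_morph (fun s => gco s n)) => [s1 s2|]; rewrite ?gcoD ?gco0. Qed.

Definition zco r c q (s : iter_laurent K r) m := gco s (zexpc c q m).

Lemma zcoE r (q : r.-1.-tuple nat) (s : iter_laurent K r) (m : r.-tuple nat) :
  gcoef s (zexp q m) = zco 0 q s m.
Proof. by rewrite gcoE zexpE. Qed.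

Definition zsupp r c q (s : iter_laurent K r) :=
  forall n, size n = r -> gco s n != 0 -> exists2 m, size m = r & n = zexpc c q m.

Lemma in_KzetaE r (q : r.-1.-tuple nat) (s : iter_laurent K r) :
  in_Kzeta q s <-> zsupp 0 q s.
Proof.
split=> [s_q n szn|s_q n].
  have /eqP szn' := szn; rewrite -[n]/(tval (Tuple szn')) -gcoE => /s_q[m ->].
  by exists m; rewrite ?size_tuple ?zexpE.
rewrite gcoE => nz; have [|m /eqP szm En] := s_q n _ nz; first exact: size_tuple.
by exists (Tuple szm); apply/val_inj/(etrans En)/esym/zexpE.
Qed.

(** The recursive form of [zsupp], suited to products: zeta_1^i carries t_2^(-q_1 i), so the
    coefficient of t_1^(i - c) lies in the cone of the other variables shifted by q_1 i. *)
Fixpoint cone (r : nat) (c : nat) (q : seq nat) : iter_laurent K r -> Prop :=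
  match r with
  | 0 => fun _ => True
  | r'.+1 => fun s =>
      vanish_below s (- c%:Z) /\
      forall i : nat, cone (head 0 q * i) (behead q) (lcoef s (i%:Z - c%:Z))
  end.

Lemma zsuppP r c q (s : iter_laurent K r) : zsupp c q s <-> cone c q s.
Proof.
elim: r c q s => [|r IHr] c q s; first by split=> // _ n; exists [::] => //; apply/size0nil.
split=> [s_q | [s_c s_q] n].
  split=> [n0 ltn|i].
    apply: gco_inj => n szn; rewrite gco0; apply: contrapT => /eqP sn.
    have [|[|m0 m] //= _ [En]] := s_q (n0 :: n) _ sn; first by rewrite /= szn.
    by move: ltn; rewrite En; lia.
  apply/IHr => n szn sn.
  have [|[|m0 m] //= [szm] [/addIr[Ei] ->]] := s_q (i%:Z - c%:Z :: n) _ sn.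
    by rewrite /= szn.
  by exists m; rewrite // Ei.
case: n => // n0 n [szn] /=; have [/s_c->|/nat_above[k ->]] := ltrP n0 (- c%:Z).
  by rewrite gco0 eqxx.
rewrite addrC => sn; have [m szm ->] := (IHr _ _ _).2 (s_q k) n szn sn.
by exists (k :: m); rewrite //= szm.
Qed.

End Coefficients.

Lemma conv_sum (F : fieldType) (a b : int -> F) (ma mb : int) (k : nat) :
  vanish_below a ma -> vanish_below b mb ->
  Defs.conv a b (ma + mb + k%:Z) = \sum_(i < k.+1) a (ma + i%:Z) * b (mb + (k - i)%N%:Z).
Proof.
move=> a0 b0; rewrite (conv_trunc (N := k.+1) a0 b0) // coefM.
apply: eq_bigr => i _; have := ltn_ord i.
by rewrite !coef_poly ltnS => lei; rewrite !ifT //; lia.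
Qed.

Section Product.
Variable K : fieldType.

(** Shifts add up under products: the terms j and i - j of the convolution have shifts q_1 j and q_1
    (i - j), whose sum does not depend on j. Hence the two independent shifts in the statement. *)
Lemma coneM_zcoM r c c' q (s t : iter_laurent K r) : cone c q s -> cone c' q t ->
  cone (c + c') q (s * t) /\
  forall m, size m = r -> zco (c + c') q (s * t) m = cauchy m (zco c q s) (zco c' q t).
Proof.
elim: r c c' q s t => [|r IHr] c c' q s t.
  move=> _ _; split=> // m /size0nil->.
  by rewrite /cauchy big_cons big_nil addr0.
case=> s_c s_q [t_c t_q].
have st_i i : lcoef (s * t) (i%:Z - (c + c')%N%:Z) =
    \sum_(j < i.+1) lcoef s (j%:Z - c%:Z) * lcoef t ((i - j)%N%:Z - c'%:Z).
  rewrite (_ : _ - _ = - c%:Z + - c'%:Z + i%:Z); last by lia.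
  rewrite [LHS](conv_sum _ s_c t_c); apply: eq_bigr => j _.
  by rewrite ![_ + _%:Z]addrC.
have IH i (j : 'I_i.+1) : cone (head 0 q * i) (behead q)
     (lcoef s (j%:Z - c%:Z) * lcoef t ((i - j)%N%:Z - c'%:Z)) /\
  forall m, size m = r -> zco (head 0 q * i) (behead q)
     (lcoef s (j%:Z - c%:Z) * lcoef t ((i - j)%N%:Z - c'%:Z)) m =
   cauchy m (zco (head 0 q * j) (behead q) (lcoef s (j%:Z - c%:Z)))
            (zco (head 0 q * (i - j)) (behead q) (lcoef t ((i - j)%N%:Z - c'%:Z))).
  have := IHr _ _ _ _ _ (s_q j) (t_q (i - j)%N).
  by rewrite -mulnDr subnKC // -ltnS.
split.
  split=> [n ltn|i].
    by have := conv_vanish s_c t_c; apply; rewrite -opprD -PoszD.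
  apply/zsuppP => n szn; rewrite st_i gco_sum => nz.
  have [j _ nzj] : exists2 j, j \in index_enum 'I_i.+1 &
      gco (lcoef s (j%:Z - c%:Z) * lcoef t ((i - j)%N%:Z - c'%:Z)) n != 0.
    apply/hasP; apply: contraNT nz => /hasPn z; apply/eqP.
    by rewrite big_seq big1 // => j /z; rewrite negbK => /eqP.
  by have [/zsuppP + _] := IH i j; apply.
case=> // i m [szm]; rewrite cauchy_cons.
transitivity (gco (lcoef (s * t) (i%:Z - (c + c')%N%:Z))
  (zexpc (head 0 q * i) (behead q) m)); first by [].
rewrite st_i gco_sum; apply: eq_bigr => j _.
by have [_ /(_ m szm)] := IH i j.
Qed.

Variables (r : nat) (q : seq nat).
Implicit Types s t : iter_laurent K r.

Local Notation R := (@zsupp K r 0 q).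

Lemma zsuppM s t : R s -> R t -> R (s * t).
Proof. by move=> /zsuppP Rs /zsuppP Rt; apply/zsuppP; case: (coneM_zcoM Rs Rt). Qed.

Lemma zcoM s t m : R s -> R t -> size m = r ->
  zco 0 q (s * t) m = cauchy m (zco 0 q s) (zco 0 q t).
Proof. by move=> /zsuppP Rs /zsuppP Rt; case: (coneM_zcoM Rs Rt) => _; apply. Qed.

Lemma zsupp0 : R 0.
Proof. by move=> n _; rewrite gco0 eqxx. Qed.

Lemma zsuppD s t : R s -> R t -> R (s + t).
Proof.
move=> Rs Rt n szn; rewrite gcoD; case: (eqVneq (gco s n) 0) => [->|nz _]; last exact: Rs.
by rewrite add0r; apply: Rt.
Qed.

Lemma zsuppN s : R s -> R (- s).
Proof. by move=> Rs n szn; rewrite gcoN oppr_eq0; apply: Rs. Qed.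

Lemma zsupp_sum I (x : seq I) (P : pred I) (F : I -> iter_laurent K r) :
  (forall i, P i -> R (F i)) -> R (\sum_(i <- x | P i) F i).
Proof. by move=> RF; apply: big_ind => //; [apply: zsupp0 | apply: zsuppD]. Qed.

End Product.

(** * The weight L *)

(* The coefficients of L: [1 - a], truncated, restarts the product outside the
   blocks, where a = 0. *)
Definition weights (q : seq nat) : seq nat :=
  foldr (fun a ws => (a * head 0 ws + (1 - a))%N :: ws) [:: 1%N] q.

Lemma size_weights q : size (weights q) = (size q).+1.
Proof. by elim: q => //= a q ->. Qed.

Lemma weights_gt0 q i : (i <= size q)%N -> (0 < nth 0 (weights q) i)%N.
Proof.
elim: q i => [|a q IHq] [|i] //=; last exact: IHq.
by move=> _; have := IHq 0%N isT; rewrite nth0; case: a => [|a]; nia.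
Qed.

Lemma weights_rec q i : (i < size q)%N ->
  nth 0 (weights q) i =
  (nth 0 q i * nth 0 (weights q) i.+1 + (1 - nth 0 q i))%N.
Proof. elim: q i => [|a q IHq] [|i] //=; exact: IHq. Qed.

Lemma weights_last q : nth 0 (weights q) (size q) = 1%N.
Proof. by elim: q. Qed.

Definition wdot (ws : seq nat) (n : seq int) : int :=
  \sum_(i < size ws) (nth 0 ws i)%:Z * nth 0 n i.

Lemma wdot_cons w ws n : wdot (w :: ws) n = w%:Z * head 0 n + wdot ws (behead n).
Proof.
rewrite /wdot /= big_ord_recl /= nth0; congr (_ + _).
by apply: eq_bigr => i _; rewrite nth_behead.
Qed.

Lemma wdot_nat ws m : wdot ws (map Posz m) = (dot ws m)%:Z.
Proof.
elim: ws m => [|w ws IHws] m; first by rewrite /wdot big_ord0.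
by rewrite wdot_cons /dot /= PoszD -IHws; case: m => [|a m] //=; rewrite ?mulr0 ?muln0.
Qed.

Lemma dotDr ws k l : size l = size k -> dot ws (addl k l) = (dot ws k + dot ws l)%N.
Proof.
rewrite /dot; elim: ws k l => //= w ws IHws [|a k] [|b l] //= => [_|[szl]].
  by have := IHws [::] [::] erefl; rewrite /=; lia.
by rewrite IHws //; lia.
Qed.

Lemma leq_dot ws k m : leql k m -> (dot ws k <= dot ws m)%N.
Proof.
by case/leqlP=> l szl ->; rewrite dotDr // leq_addr.
Qed.

(* The subtraction is exact if ws = weights q' for some q' >= q. *)
Definition zdot (q ws m : seq nat) : nat :=
  (dot ws m - dot (behead ws) (zipw muln q m))%N.

Lemma wdot_zexpc c q ws m : (size m = size ws)%N -> (size ws <= (size q).+1)%N ->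
  wdot ws (zexpc c q m) =
  (dot ws m)%:Z - (dot (behead ws) (zipw muln q m))%:Z - (head 0 ws * c)%N%:Z.
Proof.
elim: ws c q m => [|w ws IHws] c q [|a m] //=.
  by move=> _ _; rewrite /wdot big_ord0 /dot /=; lia.
case=> szm szw; rewrite wdot_cons /= IHws //; last first.
  by move: szw; rewrite size_behead; case: q; case: (size ws) => //=; lia.
rewrite /dot /=; case: q szw => [|b q] szw; case: ws szm szw {IHws} => [|w' ws] //=;
  rewrite ?PoszD ?PoszM; lia.
Qed.

(** No truncation occurs: q_i m_i w_(i+1) <= w_i m_i, because w_i >= q'_i w_(i+1) and q'_i >= q_i.
    In other words every zeta_i has nonnegative weight. *)
Lemma zdot_weights (q q' m : seq nat) :
  size q = size q' -> size m = (size q').+1 -> leqn q q' ->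
  wdot (weights q') (zexpc 0 q m) = (zdot q (weights q') m)%:Z.
Proof.
move=> szq szm leqq; rewrite wdot_zexpc ?size_weights ?szq // muln0 subr0.
rewrite /zdot subzn //.
elim: q' q m szq szm leqq => [|b q' IHq] [|a q] [|x m] //= [szq] [szm] leqq.
have := IHq _ _ szq szm (fun i => leqq i.+1); have := leqq 0%N; rewrite /dot /=.
have -> : weights q' = head 0%N (weights q') :: behead (weights q') by case: q' {IHq szq szm leqq}.
rewrite /=; set h := head _ _; set t := behead _; move=> /= leab.
set S1 := sumn _; set S2 := sumn (zipw muln t _) => IH.
have: (h * (a * x) <= (b * h + (1 - b)) * x)%N; last by lia.
rewrite mulnDl (mulnC b) -mulnA; apply: leq_trans (leq_addr _ _).
by rewrite leq_mul2l leq_mul2r leab !orbT.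
Qed.

Lemma weights_prod q i j : (i <= j)%N -> (j <= size q)%N -> nth 0%N (weights q) j = 1%N ->
  (forall l, (i <= l < j)%N -> (0 < nth 0 q l)%N) ->
  nth 0%N (weights q) i = (\prod_(i <= l < j) nth 0 q l)%N.
Proof.
move=> leij ltjq w1; rewrite -(subKn leij).
elim: (j - i)%N (leq_subr i j) => [|k IHk] lek pos.
  by rewrite subn0 w1 big_geq.
have Ek : (j - k.+1).+1 = (j - k)%N by lia.
rewrite big_ltn ?Ek; last lia; rewrite weights_rec ?Ek; last lia.
rewrite IHk; last by move=> l ?; apply: pos; lia.
  by have := pos (j - k.+1)%N; case: (nth _ _ _) => [|a]; lia.
by lia.
Qed.

Lemma weights1 q i : (i <= size q)%N -> ((i < size q) && (0 < nth 0 q i))%N = false ->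
  nth 0%N (weights q) i = 1%N.
Proof.
rewrite leq_eqVlt => /predU1P[->|lti]; first by rewrite weights_last.
by rewrite lti weights_rec //=; case: (nth _ _ _) => // _; lia.
Qed.

(** The starting index s is free so that, once the first block is removed, the induction restarts at
    its end [b2]. Weights are 1 before the block, and products inside it. *)
Lemma Ltilde_from (q : seq nat) (n : seq int) (B : seq (nat * nat)) (s : nat) :
  let r := (size q).+1 in
  sorted ltn (flatten [seq [:: b.1; b.2] | b <- B]) ->
  all (fun b => b.2 < r)%N B -> (s <= nth r (unzip1 B) 0)%N ->
  (forall i, (s <= i < r)%N ->
     ((i.+1 < r)%N && (0 < nth 0 q i)%N) = has (fun b => b.1 <= i < b.2)%N B) ->
  \sum_(s <= i < nth r (unzip1 B) 0) n`_i +
  \sum_(k < size B)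
    (\sum_(nth r (unzip1 B) k <= i < nth r (unzip2 B) k)
       (\prod_(i <= l < nth r (unzip2 B) k) nth 0 q l)%N%:Z * n`_i +
     \sum_(nth r (unzip2 B) k <= i < nth r (unzip1 B) k.+1) n`_i) =
  \sum_(s <= i < r) (nth 0 (weights q) i)%:Z * n`_i.
Proof.
move=> r; elim: B s => [|[b1 b2] B IHB] s.
  move=> _ _ /= ltsr qB; rewrite big_ord0 addr0; apply: eq_big_nat => i lti.
  by rewrite weights1 ?mul1r //; [lia|have := qB i lti; rewrite ltnS].
move=> srt /= /andP[b2r allB] les qB.
have /= b1min := order_path_min ltn_trans srt.
have b12 : (b1 < b2)%N by case/andP: b1min.
have pathB : path ltn b2 (flatten [seq [:: b.1; b.2] | b <- B]).
  by move: srt => /= /andP[].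
have b2min := order_path_min ltn_trans pathB.
have inB b : b \in B -> (b2 < b.1)%N.
  move=> bB; apply: (allP b2min); apply/flattenP; exists [:: b.1; b.2].
    by apply/mapP; exists b.
  by rewrite inE eqxx.
have noB i : (i <= b2)%N -> has (fun b => b.1 <= i < b.2)%N B = false.
  by move=> lei; apply/hasPn => -[x y] /inB /= ltb; apply/negP => /andP[]; lia.
have le2 : (b2 <= nth r (unzip1 B) 0)%N.
  by case: (B) inB => [|b B'] inB /=; [lia|apply/ltnW/inB; rewrite inE eqxx].
rewrite big_ord_recl /=.
rewrite -[X in _ + X]addrA.
rewrite (big_cat_nat (n := b1) (p := r)) //=; last lia.
rewrite (big_cat_nat (m := b1) (n := b2) (p := r)) //=; try lia.
congr (_ + (_ + _)).
- apply: eq_big_nat => i /andP[lei lti].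
  rewrite weights1 ?mul1r //; first lia.
  by rewrite -[(i < size q)%N]ltnS qB ?noB; lia.
- apply: eq_big_nat => i /andP[lei lti]; rewrite -(@weights_prod q i b2) //; try lia.
    by rewrite weights1 // -[(b2 < size q)%N]ltnS qB ?noB ?ltnn ?andbF //; lia.
  move=> l lel; have := qB l; rewrite (_ : (b1 <= l < b2)%N = true) /=; last lia.
  by move=> /(_ ltac:(lia))/andP[].
apply: IHB => //; first exact: path_sorted pathB.
move=> i /andP[lei ltir]; rewrite qB ?ltir ?andbT; last lia.
by rewrite [(i < b2)%N]ltnNge lei andbF.
Qed.

Lemma LtildeE r (q : r.-1.-tuple nat) B (n : r.-tuple int) : (0 < r)%N ->
  is_blocks q B -> Ltilde q B n = wdot (weights q) n.
Proof.
move=> r0 [srt allB qB]; have szq : (size q).+1 = r by rewrite size_tuple prednK.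
rewrite /Ltilde /wdot size_weights szq.
rewrite -[in RHS](big_mkord xpredT (fun i => (nth 0 (weights q) i)%:Z * n`_i)).
have := @Ltilde_from q n B 0%N; rewrite szq; apply=> //.
Qed.

(** * Kernels of linear systems *)

Section Kernel.
Variables (K : fieldType) (I : eqType) (s : seq I).
Implicit Types (a b c : I -> K) (bs cs : seq (I -> K)).

Definition form c a : K := \sum_(i <- s) a i * c i.

(** One step of Gaussian elimination, using only field operations and zero tests. The first vector
    on which [phi] is nonzero is the pivot: it is dropped and corrects the later ones, while the
    earlier ones already lie in the kernel. *)
Fixpoint elim_form (phi : (I -> K) -> K) bs : seq (I -> K) :=
  if bs is b :: bs' then
    if phi b == 0 then b :: elim_form phi bs'
    else [seq (fun i => b' i - phi b' * (phi b)^-1 * b i) | b' <- bs']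
  else [::].

(** Vectors are functions on the whole of I, but only their values on [s] are compared; this avoids
    matrices and is directly computable. *)
Fixpoint span bs a : Prop :=
  if bs is b :: bs' then exists x, span bs' (fun i => a i - x * b i)
  else forall i, i \in s -> a i = 0.

Fixpoint free bs : Prop :=
  if bs is b :: bs' then ~ span bs' b /\ free bs' else True.

Lemma formB c a b x : form c (fun i => a i - x * b i) = form c a - x * form c b.
Proof.
by rewrite /form mulr_sumr -sumrB; apply: eq_bigr => i _; rewrite mulrBl mulrA.
Qed.

Lemma form0 c a : (forall i, i \in s -> a i = 0) -> form c a = 0.
Proof. by move=> a0; rewrite /form big_seq big1 // => i /a0->; rewrite mul0r. Qed.

Lemma eq_span bs a b : (forall i, a i = b i) -> span bs a -> span bs b.
Proof. by move/funext->. Qed.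

Lemma span_scale bs a x : span bs a -> span bs (fun i => x * a i).
Proof.
elim: bs a => [|b bs IHbs] a /=; first by move=> a0 i /a0->; rewrite mulr0.
case=> y /IHbs span_a; exists (x * y); apply: eq_span span_a => i.
by rewrite mulrBr mulrA.
Qed.

Lemma span_reduce c bs b a : form c b != 0 ->
  span [seq (fun i => b' i - form c b' * (form c b)^-1 * b i) | b' <- bs] a <->
  (exists x, span bs (fun i => a i - x * b i)) /\ form c a = 0.
Proof.
move=> cb; elim: bs a => [|b' bs IHbs] a /=.
  split=> [a0|[[x a_xb] ca] i si].
    by split; [exists 0 => i /a0->; rewrite mul0r subr0 | apply: form0].
  have /eqP := form0 c a_xb; rewrite formB ca sub0r oppr_eq0 mulf_eq0 (negPf cb).
  by rewrite orbF => /eqP x0; have := a_xb i si; rewrite x0 mul0r subr0.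
split=> [[y /IHbs[[x sp]]]|[[x [y sp]] ca]].
  rewrite formB formB divfK // subrr mulr0 subr0 => ca; split=> //.
  exists (x - y * (form c b' * (form c b)^-1)), y.
  by apply: eq_span sp => i; ring.
exists y; apply/IHbs; rewrite formB formB divfK // subrr mulr0 subr0; split=> //.
exists (x + y * (form c b' * (form c b)^-1)).
by apply: eq_span sp => i; ring.
Qed.

Lemma span_elim c bs a :
  span (elim_form (form c) bs) a <-> span bs a /\ form c a = 0.
Proof.
elim: bs a => [|b bs IHbs] a /=; first by split=> [a0|[]//]; rewrite form0.
case: eqP => [cb|/eqP cb]; last exact: span_reduce.
split=> [[x /IHbs[sp]]|[[x sp] ca]].
  by rewrite formB cb mulr0 subr0 => ca; split=> //; exists x.
by exists x; apply/IHbs; rewrite formB cb mulr0 subr0.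
Qed.

Lemma free_reduce c bs b : form c b != 0 -> ~ span bs b -> free bs ->
  free [seq (fun i => b' i - form c b' * (form c b)^-1 * b i) | b' <- bs].
Proof.
move=> cb; elim: bs => //= b' bs IHbs nsp [nsp' fr]; split; last first.
  apply: IHbs => // sp; apply: nsp; exists 0.
  by apply: eq_span sp => i; rewrite mul0r subr0.
move=> /span_reduce -/(_ cb)[[x sp] _].
set z := form c b' * (form c b)^-1 in sp.
have {}sp : span bs (fun i => b' i - (z + x) * b i).
  by apply: eq_span sp => i; ring.
(* If the coefficient of b vanishes, b' depends on [bs]; otherwise b depends on b' and [bs]. Both
   contradict freeness. *)
have [zx0|zx0] := eqVneq (z + x) 0.
  apply: nsp'; apply: eq_span sp => i.
  by rewrite zx0 mul0r subr0.
apply: nsp; exists (z + x)^-1; apply: eq_span (span_scale (- (z + x)^-1) sp) => i.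
by field.
Qed.

Lemma free_elim c bs : free bs -> free (elim_form (form c) bs).
Proof.
elim: bs => //= b bs IHbs [nsp fr]; case: eqP => [cb|/eqP cb].
  by split; [case/span_elim | apply: IHbs].
exact: free_reduce.
Qed.

Lemma size_elim phi bs : (size bs <= (size (elim_form phi bs)).+1)%N.
Proof. by elim: bs => //= b bs IHbs; case: ifP; rewrite //= size_map. Qed.

Definition unit_vectors (t : seq I) := [seq (fun i => (i == j)%:R : K) | j <- t].

Lemma span_units t a :
  span (unit_vectors t) a <-> forall i, i \in s -> i \notin t -> a i = 0.
Proof.
elim: t a => [|j t IHt] a /=; first by split=> a0 i si => [_|]; apply: a0.
split=> [[x /IHt a0] i si|a0].
  rewrite inE negb_or => /andP[/negPf ij it].
  by have := a0 i si it; rewrite ij mulr0 subr0.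
exists (a j); apply/IHt => i si it; case: eqP => [->|/eqP ij].
  by rewrite mulr1 subrr.
by rewrite mulr0 subr0 a0 // inE negb_or ij.
Qed.

Lemma free_units t : uniq t -> {subset t <= s} -> free (unit_vectors t).
Proof.
elim: t => //= j t IHt /andP[jt ut] ts; split; last first.
  by apply: IHt => // i it; apply: ts; rewrite inE it orbT.
move/span_units => /(_ j (ts j (mem_head _ _)) jt)/eqP.
by rewrite eqxx oner_eq0.
Qed.

Definition kernel (phis : seq ((I -> K) -> K)) : seq (I -> K) :=
  foldr elim_form (unit_vectors s) phis.

Lemma span_kernel cs a :
  span (kernel (map form cs)) a <-> forall c, c \in cs -> form c a = 0.
Proof.
elim: cs => [|c cs IHcs] /=.
  by split=> // _; apply/span_units => i ->.
split=> [/span_elim[/IHcs a0 ca] c'|a0].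
  by rewrite inE => /predU1P[->|/a0].
apply/span_elim; split; last exact/a0/mem_head.
by apply/IHcs => c' cc'; apply: a0; rewrite inE cc' orbT.
Qed.

Lemma free_kernel cs : uniq s -> free (kernel (map form cs)).
Proof.
move=> us; elim: cs => [|c cs IHcs] /=; first exact: free_units.
exact: free_elim.
Qed.

Lemma size_kernel phis : (size s <= size (kernel phis) + size phis)%N.
Proof.
elim: phis => [|phi phis IH] /=; first by rewrite size_map addn0.
by apply: leq_trans IH _; rewrite addnS -addSn leq_add2r size_elim.
Qed.

Lemma spanE bs a : span bs a <-> exists theta : nat -> K, forall i, i \in s ->
  a i = \sum_(m < size bs) theta m * nth (fun=> 0) bs m i.
Proof.
elim: bs a => [|b bs IHbs] a /=.
  split=> [a0|[theta a0] i /a0->]; last by rewrite big_ord0.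
  by exists (fun=> 0) => i /a0->; rewrite big_ord0.
split=> [[x /IHbs[theta Da]]|[theta Da]].
  exists (fun m => if m is m'.+1 then theta m' else x) => i si.
  by rewrite big_ord_recl /= -(Da i si) addrC subrK.
exists (theta 0%N); apply/IHbs; exists (fun m => theta m.+1) => i si.
by rewrite (Da i si) big_ord_recl /= addrAC subrr add0r.
Qed.

Lemma freeP bs : free bs -> forall theta : nat -> K,
  (forall i, i \in s -> \sum_(m < size bs) theta m * nth (fun=> 0) bs m i = 0) ->
  forall m, (m < size bs)%N -> theta m = 0.
Proof.
elim: bs => //= b bs IHbs [nsp fr] theta eq0.
have theta0 : theta 0%N = 0.
  apply: contrapT => /eqP nz; apply: nsp.
  apply/spanE; exists (fun m => - (theta 0%N)^-1 * theta m.+1) => i si.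
  have := eq0 i si; rewrite big_ord_recl /= => /eqP; rewrite addr_eq0 => /eqP Eb.
  rewrite -[LHS](mulKf nz) Eb mulrN -mulNr mulr_sumr.
  by apply: eq_bigr => m _; rewrite mulrA.
case=> // m ltm; apply: (IHbs fr (fun m => theta m.+1)) => // i si.
by have := eq0 i si; rewrite big_ord_recl /= theta0 mul0r add0r.
Qed.

(** The elimination run by the algorithm also serves as a dimension count: each form costs at most
    one vector, so one is left, and it is nonzero by freeness. *)
Lemma nonzero_solution cs : uniq s -> (size cs < size s)%N ->
  exists a, (exists2 i, i \in s & a i != 0) /\ forall c, c \in cs -> form c a = 0.
Proof.
move=> us ltcs; have := size_kernel (map form cs); rewrite size_map.
have := free_kernel cs us; have := @span_kernel cs.
case: (kernel _) => [|b bs] spk /= fr szk; first by move: ltcs szk; lia.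
exists b; split; last first.
  apply/spk; exists 1; apply/spanE; exists (fun=> 0) => i si.
  by rewrite mul1r subrr big1 // => m _; rewrite mul0r.
apply: contrapT => b0; case: fr => nsp _; apply: nsp.
apply/spanE; exists (fun=> 0) => i si; rewrite big1 => [|m _]; last by rewrite mul0r.
by apply: contrapT => /eqP bi; apply: b0; exists i.
Qed.

End Kernel.

(** * Power series in t *)

Lemma sumn_addl k l : size l = size k -> sumn (addl k l) = (sumn k + sumn l)%N.
Proof. by elim: k l => [|a k IHk] [|b l] //= [/IHk->]; lia. Qed.

Lemma leql_sumn k m : leql k m -> (sumn k <= sumn m)%N.
Proof. by case/leqlP=> l /sumn_addl + -> => ->; rewrite leq_addr. Qed.

Lemma leql_nseq r k m : size m = r -> (sumn m <= k)%N -> leql m (nseq r k).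
Proof.
by elim: m r k => [|a m IHm] [|r] k //= [szm] lek; rewrite IHm //; lia.
Qed.

Lemma leql_nseqD r m1 m2 k1 k2 :
  leql m1 (nseq r k1) -> leql m2 (nseq r k2) -> leql (addl m1 m2) (nseq r (k1 + k2)).
Proof.
elim: m1 m2 r => [|a m1 IH] [|b m2] [|r] //= /andP[ak m1k] /andP[bk m2k].
by rewrite leq_add // IH.
Qed.

Lemma leql_nseq_dot q e N : size e = (size q).+1 -> (dot (weights q) e <= N)%N ->
  leql e (nseq (size q).+1 N).
Proof.
have : all (leq 1) (weights q).
  by apply/(all_nthP 0%N) => i; rewrite size_weights => /weights_gt0.
rewrite -size_weights /dot; elim: (weights q) e => [|w ws IHws] [|a e] //=.
move=> /andP[w0 ws0] [sze] leN; rewrite IHws ?andbT //; last by lia.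
by have : (a <= w * a)%N := leq_pmull a w0; lia.
Qed.

Lemma dot_nseq q r n : (size q).+1 = r -> dot (weights q) (nseq r n) = (sumn (weights q) * n)%N.
Proof.
move=> <-; rewrite -(size_weights q) /dot.
by elim: (weights q) => //= w ws ->; rewrite mulnDl.
Qed.

Lemma leql_tcoord c q e e' : leql e e' -> forall c', (c <= c')%N ->
  leql (tcoord c q e) (tcoord c' q e').
Proof.
elim: e e' c q => [|a e IHe] [|b e'] c q //= /andP[ab ee'] c' cc'.
by rewrite leq_add //= IHe // leq_mul // leq_add.
Qed.

Lemma zipw_muln_addl q k l : size l = size k ->
  zipw muln q (addl k l) = addl (zipw muln q k) (zipw muln q l).
Proof.
elim: q k l => //= a q IHq [|x k] [|y l] //= => [_|[szl]].
  by have := IHq [::] [::] erefl; rewrite /= muln0 => <-.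
by rewrite IHq // mulnDr.
Qed.

Lemma zdotD q q' k l : size q = size q' -> leqn q q' ->
  size k = (size q').+1 -> size l = (size q').+1 ->
  zdot q (weights q') (addl k l) = (zdot q (weights q') k + zdot q (weights q') l)%N.
Proof.
move=> szq leqq szk szl.
have E m : size m = (size q').+1 -> (zdot q (weights q') m)%:Z =
    (dot (weights q') m)%:Z - (dot (behead (weights q')) (zipw muln q m))%:Z.
  by move=> szm; rewrite -zdot_weights // wdot_zexpc ?size_weights ?szq // muln0 subr0.
have := E (addl k l); rewrite size_zipw zipw_muln_addl ?szl // => /(_ szk).
rewrite !dotDr ?size_zipw ?szl // => /[dup].
by have := E k szk; have := E l szl; lia.
Qed.

Lemma zdot_tcoord q q' e : size q = size q' -> leqn q q' -> size e = (size q').+1 ->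
  zdot q (weights q') (tcoord 0 q e) = dot (weights q') e.
Proof.
move=> szq leqq sze; have := @zdot_weights q q' (tcoord 0 q e) szq.
by rewrite size_tcoord zexpc_tcoord wdot_nat => /(_ sze leqq) [].
Qed.

Section Series.
Variables (K : fieldType) (r : nat).
Local Notation F := (iter_laurent K r).

Lemma gco1 r' n : size n = r' -> gco (1 : iter_laurent K r') n = (n == nseq r' 0)%:R.
Proof.
elim: r' n => [|r' IHr] [|a n] // [szn].
transitivity (gco (if a == 0 then 1 else 0 : iter_laurent K r') n) => //.
by rewrite /= eqseq_cons; case: eqP => _ /=; rewrite ?gco0 // IHr.
Qed.

Lemma zexpc_nseq0 q n : zexpc 0 q (nseq n 0%N) = nseq n 0.
Proof. by elim: n q => //= n IHn q; rewrite muln0 IHn. Qed.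

Lemma zsupp1 q : zsupp 0 q (1 : F).
Proof.
move=> n szn; rewrite gco1 //; case: (n =P _) => [-> _|_]; last by rewrite eqxx.
by exists (nseq r 0%N); rewrite ?size_nseq ?zexpc_nseq0.
Qed.

Lemma zsuppX q (s : F) k : zsupp 0 q s -> zsupp 0 q (s ^+ k).
Proof.
move=> Rs; elim: k => [|k IHk]; first exact: zsupp1.
by rewrite exprS; apply: zsuppM.
Qed.

Lemma zco_sum q I (x : seq I) (P : pred I) (f : I -> F) m :
  zco 0 q (\sum_(i <- x | P i) f i) m = \sum_(i <- x | P i) zco 0 q (f i) m.
Proof. exact: gco_sum. Qed.

Lemma zco_neq0 q (s : F) m : zco 0 q s m != 0 -> s != 0.
Proof. by apply: contraNneq => ->; rewrite /zco gco0. Qed.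

Lemma zsupp_neq0 q (s : F) : zsupp 0 q s -> s != 0 ->
  exists2 m, size m = r & zco 0 q s m != 0.
Proof.
move=> Rs nz; apply: contrapT => no; case/eqP: nz; apply: gco_inj => n szn.
rewrite gco0; apply: contrapT => /eqP sn; have [m szm En] := Rs n szn sn.
by apply: no; exists m; rewrite // /zco -En.
Qed.

Lemma zsupp_le q q' (s : F) : leqn q q' -> zsupp 0 q s -> zsupp 0 q' s.
Proof.
move=> leq_q Rs n szn /(Rs n szn)[m szm ->].
have [m' -> /size_leql szm'] := zexpc_le m (leqnn 0) leq_q.
by exists m'; rewrite -?szm'.
Qed.

Lemma zco_nil r' (s : iter_laurent K r') m : zco 0 [::] s m = gco s (map Posz m).
Proof. by rewrite /zco zexpc_nil. Qed.

Lemma zco_tcoord q (s : F) e : zco 0 q s (tcoord 0 q e) = zco 0 [::] s e.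
Proof. by rewrite /zco zexpc_tcoord zexpc_nil. Qed.

Lemma zsupp_nil_tcoord q (s : F) m : zsupp 0 [::] s -> size m = r -> zco 0 q s m != 0 ->
  exists2 e, size e = r & m = tcoord 0 q e.
Proof.
move=> Rs szm sm; have [|e sze] := Rs _ _ sm; first by rewrite size_zexpc.
rewrite zexpc_nil -(zexpc_tcoord 0 q) => /zexpc_inj->.
by exists e.
Qed.

Lemma leqn_nil q : leqn [::] q.
Proof. by move=> i; rewrite nth_nil. Qed.

Definition lseries r' (a : nat -> iter_laurent K r') : iter_laurent K r'.+1.
Proof.
exists (fun n : int => if n is Posz k then a k else 0).
by exists 0 => -[].
Defined.

Fixpoint gser r' : (seq nat -> K) -> iter_laurent K r' :=
  match r' return (seq nat -> K) -> iter_laurent K r' with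
  | 0 => fun phi => phi [::]
  | r1.+1 => fun phi => lseries (fun k => gser r1 (fun m => phi (k :: m)))
  end.

Lemma zco_gser r' phi m : size m = r' -> zco 0 [::] (gser r' phi) m = phi m.
Proof.
elim: r' phi m => [|r' IHr] phi [|a m] // [szm].
by rewrite zco_nil /= -zco_nil IHr.
Qed.

Lemma zsupp_gser r' phi : zsupp 0 [::] (gser r' phi).
Proof.
elim: r' phi => [|r' IHr] phi [|[a|a] n] //= => [_ _|[szn]|_].
- by exists [::].
- case/(IHr _ _ szn) => m szm ->; exists (a :: m); rewrite //= ?szm // subr0.
  by rewrite mul0n.
by rewrite gco0 eqxx.
Qed.

End Series.

Section PolySeries.
Variables (K : fieldType) (r : nat).
Local Notation F := (iter_laurent K r).
Implicit Types P S Q : {poly F}.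
Local Notation Rt := (zsupp 0 [::]).
Local Notation tco := (zco 0 [::]).

Definition Rtpoly P := forall j, Rt P`_j.

(** Views K[[t]][y] inside the series in t over K[y]. The latter being a domain, initial
    coefficients in t multiply. *)
Definition polyco P (m : seq nat) : {poly K} := \poly_(j < size P) tco P`_j m.

Lemma zco0 c q m : zco c q (0 : F) m = 0.
Proof. exact: gco0. Qed.

Lemma coef_polyco P m j : (polyco P m)`_j = tco P`_j m.
Proof. by rewrite coef_poly; case: ltnP => // leSj; rewrite nth_default ?zco0. Qed.

Lemma RtpolyM P S : Rtpoly P -> Rtpoly S -> Rtpoly (P * S).
Proof. by move=> RP RS j; rewrite coefM; apply: zsupp_sum => i _; apply: zsuppM. Qed.

Lemma RtpolyC s : Rt s -> Rtpoly s%:P.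
Proof. by move=> Rs j; rewrite coefC; case: ifP => // _; apply: zsupp0. Qed.

Lemma RtpolyX Q l : Rtpoly Q -> Rtpoly (Q ^+ l).
Proof.
move=> RQ; elim: l => [|l IHl]; first exact/RtpolyC/zsupp1.
by rewrite exprS; apply: RtpolyM.
Qed.

Lemma polycoM P S m : Rtpoly P -> Rtpoly S -> size m = r ->
  polyco (P * S) m = cauchy m (polyco P) (polyco S).
Proof.
move=> RP RS szm; apply/polyP => j; rewrite coef_polyco coefM zco_sum /cauchy.
rewrite coef_sum; under [RHS]eq_bigr => k _ do rewrite coefM.
rewrite exchange_big; apply: eq_bigr => i _; rewrite zcoM //.
by apply: eq_bigr => k _; rewrite !coef_polyco.
Qed.

(* Initial forms for the total degree in t: the product of those of P and S
   is not divisible by any t_i^(n'+1). *)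
Lemma gauss P S B n n' k : Rtpoly P -> Rtpoly S -> size k = r -> polyco P k != 0 ->
  (sumn k <= B)%N -> (B + n <= n')%N ->
  (forall m, size m = r -> polyco S m != 0 -> leql m (nseq r n)) ->
  (forall m, leql m (nseq r n') -> polyco (P * S) m = 0) ->
  forall m, size m = r -> polyco S m = 0.
Proof.
move=> RP RS szk Pk leB len S_n PS0 m szm; apply: contrapT => /eqP Sm.
have sumnD x y : size x = r -> size y = r -> sumn (addl x y) = (sumn x + sumn y)%N.
  by move=> szx szy; apply: sumn_addl; rewrite szx szy.
have [mP lP] := lead_exists sumn szk Pk; have [mS lS] := lead_exists sumn szm Sm.
have [szP P0 _] := lP; have [szS S0 _] := lS.
have le_mP : (sumn mP <= B)%N := leq_trans (lead_wt lP szk Pk) leB.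
have: polyco (P * S) (addl mP mS) != 0.
  rewrite polycoM ?size_zipw // (cauchy_lead sumnD lP lS) mulf_neq0 //.
(* The exponent mP + mS lies in the cube [0, n']^r, since mP has total degree at most B and mS lies
   in [0, n]^r. *)
case/negP; apply/eqP/PS0; have := leql_nseqD (leql_nseq szP le_mP) (S_n _ szS S0).
move/leql_trans; apply; rewrite all2E !size_nseq eqxx /=.
apply/(all_nthP (0, 0)%N) => i; rewrite size2_zip ?size_nseq // => lti.
by rewrite nth_zip ?size_nseq //= !nth_nseq lti.
Qed.

End PolySeries.

(** * A relation between powers of Q modulo P *)

(** Exchanges a sum over the divisors of an exponent, as in a Cauchy product, for one over the
    unknowns, as in a linear form. *)
Lemma big_seq_swap (V : nmodType) (I : eqType) (s1 s2 : seq I) (F : I -> V) :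
  uniq s1 -> uniq s2 ->
  \sum_(i <- s1) (if i \in s2 then F i else 0) =
  \sum_(i <- s2) (if i \in s1 then F i else 0).
Proof.
move=> u1 u2; rewrite -!big_mkcond -[LHS]big_filter -[RHS]big_filter.
apply: perm_big; apply: uniq_perm; rewrite ?filter_uniq // => i.
by rewrite !mem_filter andbC.
Qed.

Section Relation.
Variables (K : fieldType) (r : nat).
Local Notation F := (iter_laurent K r).
Implicit Types P S Q : {poly F}.
Local Notation Rt := (zsupp 0 [::]).
Local Notation tco := (zco 0 [::]).
Local Notation box n := (below (nseq r n)).

Lemma box_size n e : e \in box n -> size e = r.
Proof. by rewrite mem_below => /size_leql->; rewrite size_nseq. Qed.

Definition on_box n (g : seq nat -> K) e := if e \in box n then g e else 0.

Lemma cauchy_gser n g (s : F) e : size e = r -> Rt s ->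
  tco (gser r (on_box n g) * s) e =
  \sum_(k <- box n) g k * (if k \in below e then tco s (subl e k) else 0).
Proof.
move=> sze Rs; rewrite zcoM //; last exact: zsupp_gser.
pose G k := g k * tco s (subl e k).
transitivity (\sum_(k <- below e) if k \in box n then G k else 0).
  rewrite /cauchy; apply: eq_big_seq => k; rewrite mem_below => /size_leql szk.
  by rewrite zco_gser ?szk // /on_box; case: ifP => // _; rewrite mul0r.
rewrite big_seq_swap ?uniq_below //; apply: eq_bigr => k _.
by case: ifP => // _; rewrite mulr0.
Qed.

(* The unknowns are the coefficients of the c_l and of S; the equations say that
   the relation holds modulo the ideal of the t_i^(n'+1). *)
Lemma truncated_relation P Q (k : seq nat) (d B m n N n' : nat) :
  Rtpoly P -> (size P <= d.+1)%N -> size k = r -> polyco P k != 0 ->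
  (sumn k <= B)%N -> Rtpoly Q -> (size Q <= d.+1)%N -> (0 < m)%N -> (B + N <= n')%N ->
  ((m * d).+1 * n'.+1 ^ r < m.+1 * n.+1 ^ r + (m * d - d).+1 * N.+1 ^ r)%N ->
  exists (c : nat -> F) S,
  let W := \sum_(l < m.+1) (c l)%:P * Q ^+ l - S * P in
  [/\ forall l, Rt (c l),
      forall l e, size e = r -> tco (c l) e != 0 -> leql e (nseq r n),
      exists l, (l <= m)%N && (c l != 0),
      Rtpoly W /\ (size W <= (m * d).+1)%N
    & forall j e, leql e (nseq r n') -> tco W`_j e = 0].
Proof.
move=> RP szP szk Pk leB RQ szQ m0 leN count.
(* An unknown (b, l, e) is the coefficient of t^e in c_l if b is true, and of t^e y^l in S if b is
   false. The degree of S is at most md - d, so that S P has degree at most md, like the powers of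
   Q. *)
pose idx b L n : seq (bool * nat * seq nat) := [seq (b, l, e) | l <- iota 0 L, e <- box n].
pose s := idx true m.+1 n ++ idx false (m * d - d).+1 N.
pose eqs := [seq (j, e) | j <- iota 0 (m * d).+1, e <- box n'].
(* The equation (j, e) expresses that the coefficient of t^e y^j in W is zero. *)
pose cf (je : nat * seq nat) (x : bool * nat * seq nat) : K :=
  let: (j, e) := je in let: (b, l, e1) := x in
  if e1 \in below e then
    if b then tco (Q ^+ l)`_j (subl e e1)
    else - (if l \in iota 0 j.+1 then tco P`_(j - l) (subl e e1) else 0)
  else 0.
have uidx b L n1 : uniq (idx b L n1).
  by apply: allpairs_uniq; rewrite ?iota_uniq ?uniq_below // => -[x y] [x' y'] _ _ [-> ->].
have us : uniq s.
  rewrite cat_uniq !uidx andbT /=; apply/hasPn => _ /allpairsP[x [_ _ ->]].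
  by apply/allpairsP => -[y [_ _]].
have [|g [[x0 sx0 gx0] sol]] := @nonzero_solution K _ s (map cf eqs) us.
  by rewrite size_map [size s]size_cat !size_allpairs !size_iota !size_below.
pose c (l : nat) := gser r (on_box n (fun e => g (true, l, e))).
pose sS (l : nat) := gser r (on_box N (fun e => g (false, l, e))).
pose S := \poly_(l < (m * d - d).+1) sS l.
have RS : Rtpoly S.
  by move=> j; rewrite coef_poly; case: ifP => _; [exact: zsupp_gser|exact: zsupp0].
have Rc l : Rt (c l) by exact: zsupp_gser.
exists c, S => W.
have RW : Rtpoly W.
  move=> j; rewrite coefB; apply: zsuppD; last exact/zsuppN/RtpolyM.
  rewrite coef_sum; apply: zsupp_sum => l _.
  by apply: RtpolyM; [apply: RtpolyC | apply: RtpolyX].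
have W0 j e : leql e (nseq r n') -> (j <= m * d)%N -> tco W`_j e = 0.
  move=> len' ltj; have sze : size e = r by rewrite (size_leql len') size_nseq.
  have -> : tco W`_j e = form s (cf (j, e)) g.
    rewrite coefB coef_sum /zco gcoD gcoN gco_sum -!/(zco 0 [::] _ e).
    rewrite /form big_cat !big_allpairs_dep -[iota 0 m.+1]/(index_iota 0 m.+1) big_mkord.
    congr (_ + _).
      apply: eq_bigr => l _; rewrite coefCM; apply: cauchy_gser => //.
      exact: RtpolyX.
    rewrite coefM zco_sum.
    pose G l := \sum_(e1 <- box N) g (false, l, e1) *
      (if e1 \in below e then tco P`_(j - l) (subl e e1) else 0).
    transitivity (- \sum_(l <- iota 0 j.+1) if l \in iota 0 (m * d - d).+1 then G l else 0).
      congr (- _); rewrite -[iota 0 j.+1]/(index_iota 0 j.+1) big_mkord.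
      apply: eq_bigr => l _; rewrite coef_poly mem_iota /= add0n; case: ifP => _.
        exact: cauchy_gser.
      by rewrite mul0r zco0.
    rewrite big_seq_swap ?iota_uniq // -sumrN; apply: eq_bigr => l _.
    case: ifP => lj; last first.
      by rewrite oppr0 big1 // => e1 _; rewrite /cf lj oppr0 if_same mulr0.
    rewrite -sumrN; apply: eq_bigr => e1 _; rewrite /cf lj.
    by case: ifP => _; rewrite ?mulrN ?mulr0 ?oppr0.
  apply: sol; apply/map_f/allpairsP; exists (j, e).
  by rewrite mem_iota mem_below.
have szW : (size W <= (m * d).+1)%N.
  rewrite (leq_trans (size_polyD _ _)) // geq_max size_polyN; apply/andP; split.
    apply: (leq_trans (size_sum _ _ _)); apply/bigmax_leqP => l _.
    rewrite mul_polyC (leq_trans (size_scale_leq _ _)) //.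
    rewrite (leq_trans (size_poly_exp_leq _ _)) // ltnS.
    have lel : (l <= m)%N := ltn_ord l.
    by rewrite mulnC leq_mul // -subn1 leq_subLR add1n.
  rewrite (leq_trans (size_polyMleq _ _)) //.
  have szS : (size S <= (m * d - d).+1)%N := size_poly _ _.
  have : (d <= m * d)%N by rewrite leq_pmull.
  by rewrite -subn1 leq_subLR => ?; apply: leq_trans (leq_add szS szP) _; lia.
have W0' j e : leql e (nseq r n') -> tco W`_j e = 0.
  move=> len'; case: (leqP j (m * d)) => [/(W0 j e len')//|ltj].
  by rewrite nth_default ?zco0 // (leq_trans szW).
split=> //.
  move=> l e sze; rewrite zco_gser // /on_box -mem_below.
  by case: ifP => //; rewrite eqxx.
apply: contrapT => noc.
have c0 l : (l <= m)%N -> c l = 0.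
  by move=> lel; apply: contrapT => /eqP cl; apply: noc; exists l; rewrite lel.
have g0 e l : e \in box n -> (l <= m)%N -> g (true, l, e) = 0.
  move=> eb /c0 cl; have := @zco_gser K r (on_box n (fun e => g (true, l, e))) e (box_size eb).
  by rewrite -/(c l) cl zco0 /on_box eb.
have PS0 e : leql e (nseq r n') -> polyco (P * S) e = 0.
  move=> len'; apply/polyP => j; rewrite coef_polyco coef0.
  have := W0' j e len'; rewrite /W big1 ?add0r => [|l _].
    by rewrite coefN /zco gcoN mulrC => /eqP; rewrite oppr_eq0 => /eqP.
  by rewrite c0 ?mul0r // -ltnS.
have SN e : size e = r -> polyco S e != 0 -> leql e (nseq r N).
  move=> sze; apply: contraR => eN; apply/eqP/polyP => j.
  rewrite coef_polyco coef0 coef_poly; case: ifP => _; last exact: zco0.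
  by rewrite zco_gser // /on_box mem_below (negPf eN).
have S0 := gauss RP RS szk Pk leB leN SN PS0.
case/negP: gx0; apply/eqP; move: sx0; rewrite mem_cat => /orP[] /allpairsP[[l e]].
  by case; rewrite mem_iota => /= ltl eb ->; apply: g0.
case; rewrite mem_iota => /= ltl eb ->.
have := S0 e (box_size eb) => /(congr1 (fun p : {poly K} => p`_l)).
rewrite coef_polyco coef0 coef_poly ltl zco_gser ?(box_size eb) //.
by rewrite /on_box eb.
Qed.

End Relation.

(** * Bound on the initial exponent *)

Lemma homogenize (F : fieldType) (W : {poly F}) (f g : F) D : (size W <= D.+1)%N -> g != 0 ->
  W.[f / g] * g ^+ D = \sum_(j < D.+1) W`_j * (f ^+ j * g ^+ (D - j)).
Proof.
move=> szW g0; rewrite (horner_coef_wide _ szW) mulr_suml; apply: eq_bigr => j _.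
rewrite -!mulrA expr_div_n; congr (_ * _).
have -> : g ^+ D = g ^+ (D - j) * g ^+ j by rewrite -exprD subnK // -ltnS.
by rewrite mulrCA mulfVK ?expf_neq0 // mulrC.
Qed.

Section Bound.
Variables (K : fieldType) (r : nat) (q : seq nat).
Hypothesis szq : (size q).+1 = r.
Local Notation F := (iter_laurent K r).
Local Notation Rt := (zsupp 0 [::]).
Local Notation Ru := (zsupp 0 q).
Local Notation uco := (zco 0 q).
Local Notation wt := (zdot q (weights q)).
Implicit Types (s t f g : F).

(** In this section [q] stands for the exponents q'_i which define u. For [wt], the variable u_i has
    weight 0 if q'_i > 0 and 1 otherwise, hence the need for the lexicographic refinement. *)
Definition ulead s m := lead r wt (uco s) m.

Lemma wtD k l : size k = r -> size l = r -> wt (addl k l) = (wt k + wt l)%N.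
Proof. by rewrite -szq; apply: zdotD => // i. Qed.

Lemma ulead_exists s : Ru s -> s != 0 -> exists m, ulead s m.
Proof. by move=> Rs /(zsupp_neq0 Rs)[m szm sm]; apply: lead_exists szm sm. Qed.

Lemma ulead_mul s t m m' : Ru s -> Ru t -> ulead s m -> ulead t m' ->
  ulead (s * t) (addl m m').
Proof.
move=> Rs Rt; apply: (lead_mul wtD) => k szk; exact: zcoM.
Qed.

Lemma ulead_exp s m k : Ru s -> ulead s m ->
  exists m', [/\ ulead (s ^+ k) m', sumn m' = (k * sumn m)%N & wt m' = (k * wt m)%N].
Proof.
move=> Rs ls; have szm : size m = r by case: ls.
elim: k => [|k [m' [ls' Em' wm']]].
  have [m1 l1] := ulead_exists (@zsupp1 K r q) (oner_neq0 F); exists m1.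
  have szm1 : size m1 = r by case: l1.
  have := ulead_mul (@zsupp1 K r q) (@zsupp1 K r q) l1 l1; rewrite mulr1 => l11.
  (* As 1 = 1 * 1, its initial exponent satisfies m1 = m1 + m1, so its degree and weight are 0. *)
  have Em1 := lead_unique l1 l11; split=> //.
    by move/(congr1 sumn): Em1; rewrite sumn_addl //; lia.
  by move/(congr1 wt): Em1; rewrite wtD //; lia.
have szm' : size m' = r by case: ls'.
exists (addl m m'); rewrite exprS; split.
- by apply: ulead_mul => //; apply: zsuppX.
- by rewrite sumn_addl ?szm ?szm' // Em' mulSn.
by rewrite wtD // wm' mulSn.
Qed.

Lemma Rt_Ru s : Rt s -> Ru s.
Proof. exact/zsupp_le/leqn_nil. Qed.

Lemma wt_tcoord e : size e = r -> wt (tcoord 0 q e) = dot (weights q) e.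
Proof. by rewrite -szq; apply: zdot_tcoord => // i. Qed.

Definition high n' s := forall m, size m = r -> uco s m != 0 -> (n' < wt m)%N.

Lemma high_sum n' I (x : seq I) (f : I -> F) :
  (forall i, high n' (f i)) -> high n' (\sum_(i <- x) f i).
Proof.
move=> hf; apply: big_ind => // [m _|s t hs ht m szm]; first by rewrite zco0 eqxx.
rewrite /zco gcoD; case: (eqVneq (uco s m) 0) => [|/(hs m szm)//].
by rewrite /zco => ->; rewrite add0r; apply: ht.
Qed.

Lemma high_mul n' s t : Ru s -> Ru t -> high n' s -> high n' (s * t).
Proof.
move=> Rs Ru_t hs m szm; rewrite zcoM // => /cauchy_neq0[k [l [szk szl -> sk _]]].
by rewrite wtD ?szk ?szl //; apply: leq_trans (hs k _ sk) (leq_addr _ _); rewrite szk.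
Qed.

(** All weights w_i are at least 1, so an exponent of t which leaves the cube has weight > n'. This
    turns a truncation on a cube into a condition on weights, which makes sense in K[[u]]. *)
Lemma high_box n' s : Rt s -> (forall e, leql e (nseq r n') -> zco 0 [::] s e = 0) ->
  high n' s.
Proof.
move=> Rs s0 m szm sm; have [e sze Em] := zsupp_nil_tcoord Rs szm sm.
move: sm; rewrite Em zco_tcoord wt_tcoord // ltnNge => se; apply: contraNN se => le_n'.
by apply/eqP/s0; rewrite -szq leql_nseq_dot ?szq.
Qed.

(* Nothing is known about S, but A S has to cancel the initial term of T. *)
Lemma lead_division (A T S V : F) l0 mA mT n' :
  Ru A -> Ru T -> Ru S -> high n' V -> A ^+ l0 * (T + A * S) = V ->
  ulead A mA -> ulead T mT -> (l0 * wt mA + wt mT <= n')%N -> (sumn mA <= sumn mT)%N.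
Proof.
move=> RA RT RS hV EV lA lT lew.
have [m1 [lA1 Em1 wm1]] := ulead_exp l0 RA lA.
have szA : size mA = r by case: lA.
have szT : size mT = r by case: lT.
have szm1 : size m1 = r by case: lA1.
have RA1 : Ru (A ^+ l0) by apply: zsuppX.
have l0' := ulead_mul RA1 RT lA1 lT; set m0 := addl m1 mT in l0'.
have [szm0 m0nz m0min] := l0'.
have wm0 : (wt m0 <= n')%N by rewrite wtD // wm1.
have ES : A ^+ l0 * A * S = V - A ^+ l0 * T by rewrite -EV; ring.
have coS m : uco (A ^+ l0 * A * S) m = uco V m - uco (A ^+ l0 * T) m.
  by rewrite ES /zco gcoD gcoN.
have V0 : uco V m0 = 0.
  by apply: contrapT => /eqP /(hV _ szm0); lia.
have S0 : uco (A ^+ l0 * A * S) m0 != 0 by rewrite coS V0 sub0r oppr_eq0.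
have nzS : S != 0 by apply: contraNneq S0 => ->; rewrite mulr0 zco0.
have [mS lS] := ulead_exists RS nzS; have szS : size mS = r by case: lS.
have lAS := ulead_mul (zsuppM RA1 RA) RS (ulead_mul RA1 RA lA1 lA) lS.
set m2 := addl _ mS in lAS; have [szm2 m2nz m2min] := lAS.
have le20 := m2min _ szm0 S0.
have w20 : (wt m2 <= wt m0)%N by move: le20; rewrite lexl_cons; lia.
(* Up to [V], whose exponents have weight > n', the series A^(l0+1) S and - A^l0 T coincide. This
   compares them at [m0] and also at [m2], whose weight is at most that of [m0]. *)
have le02 : lexl (wt m0 :: m0) (wt m2 :: m2).
  apply: m0min => //; apply: contraNneq m2nz => z; rewrite coS z subr0.
  by apply/eqP; apply: contrapT => /eqP /(hV _ szm2); lia.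
(* Hence m1 + mA + mS = m1 + mT. Total degrees are enough to bound the exponent of A. *)
have [_] := lexl_anti le02 le20.
move/(congr1 sumn); rewrite /m0 /m2 !sumn_addl ?size_zipw ?szm1 ?szA ?szS ?szT //.
by lia.
Qed.

(** The last lower bound on n' keeps the initial term of A^l0 c_(l0) g^(md - d l0) out of the reach
    of V: c_(l0) is supported on [0, n]^r, so its initial weight is at most n times the sum of the
    w_i. *)
Lemma lead_bound (P Q : {poly F}) (k : seq nat) (d B m n N n' C : nat) f g mA mg :
  Rtpoly P -> (size P <= d.+1)%N -> size k = r -> polyco P k != 0 ->
  (sumn k <= B)%N -> Rtpoly Q -> (size Q <= d.+1)%N -> (0 < m)%N -> (B + N <= n')%N ->
  ((m * d).+1 * n'.+1 ^ r < m.+1 * n.+1 ^ r + (m * d - d).+1 * N.+1 ^ r)%N ->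
  Ru f -> Ru g -> g != 0 -> P.[f / g] = 0 ->
  ulead g mg -> ulead (Q.[f / g] * g ^+ d) mA -> (wt mA <= C)%N ->
  (m * C + sumn (weights q) * n + m * d * wt mg <= n')%N ->
  (sumn mA <= sumn (tcoord 0 q (nseq r n)) + m * d * sumn mg)%N.
Proof.
move=> RP szP szk Pk leB RQ szQ m0 leN count Rf Rg g0 Pfg lg lA wA len'.
have [c [S]] := truncated_relation RP szP szk Pk leB RQ szQ m0 leN count.
set W := _ - _; case=> Rc c_n exc [RW szW] W0.
case: (ex_minnP exc) => l0 /andP[le_l0 c0] min_l0.
set A := _ * g ^+ d in lA.
have RA : Ru A.
  rewrite /A (homogenize _ szQ g0); apply: zsupp_sum => j _.
  by apply: zsuppM; [apply/Rt_Ru/RQ | apply: zsuppM; apply: zsuppX].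
pose V := W.[f / g] * g ^+ (m * d).
have hV : high n' V.
  rewrite /V (homogenize _ szW g0); apply: high_sum => j; apply: high_mul.
  - exact/Rt_Ru/RW.
  - by apply: zsuppM; apply: zsuppX.
  by apply: high_box => // e; apply: W0.
have EV : V = \sum_(l < m.+1) c l * (A ^+ l * g ^+ (m * d - d * l)).
  rewrite /V /W !hornerE Pfg mulr0 subr0 horner_sum mulr_suml.
  apply: eq_bigr => l _; rewrite hornerM hornerC horner_exp -mulrA; congr (_ * _).
  have lel : (d * l <= m * d)%N by rewrite mulnC leq_mul // -ltnS.
  by rewrite /A exprMn -mulrA -exprM -exprD subnKC.
pose T := c l0 * g ^+ (m * d - d * l0).
pose S' := \sum_(l < m.+1 | (l0 < l)%N) c l * (A ^+ (l - l0).-1 * g ^+ (m * d - d * l)).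
have RT : Ru T by apply: zsuppM; [apply: Rt_Ru | apply: zsuppX].
have RS' : Ru S'.
  apply: zsupp_sum => l _; apply: zsuppM; first exact: Rt_Ru.
  by apply: zsuppM; apply: zsuppX.
have [mc lc] := ulead_exists (Rt_Ru (Rc l0)) c0.
have [szc cnz _] := lc.
have [e sze Emc] := zsupp_nil_tcoord (Rc l0) szc cnz.
have en : leql e (nseq r n) by apply: (c_n l0) => //; rewrite -(zco_tcoord q) -Emc.
have [m1 [lg1 Em1 wm1]] := ulead_exp (m * d - d * l0) Rg lg.
have lT := ulead_mul (Rt_Ru (Rc l0)) (zsuppX (k := _) Rg) lc lg1.
have szm1 : size m1 = r by case: lg1.
have wmc : (wt mc <= sumn (weights q) * n)%N.
  by rewrite Emc wt_tcoord // -(dot_nseq _ szq) leq_dot.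
have smc : (sumn mc <= sumn (tcoord 0 q (nseq r n)))%N.
  by rewrite Emc; apply/leql_sumn/leql_tcoord.
have := @lead_division A T S' V l0 mA _ n' RA RT RS' hV _ lA lT.
rewrite sumn_addl ?szm1 ?szc // wtD // Em1 wm1 => H.
apply: leq_trans (H _ _) _.
(* By minimality of [l0], only the term of index [l0] survives among those with l <= l0; the others
   are divisible by A^(l0+1). *)
- rewrite EV mulrDr /T (bigID (fun l : 'I_m.+1 => (l <= l0)%N)) /=; congr (_ + _).
    rewrite (bigD1 (inord l0 : 'I_m.+1)) ?inordK //= big1 ?addr0; first by ring.
    move=> l /andP[lel nel]; have [->|cl] := eqVneq (c l) 0; first by rewrite mul0r.
    have := min_l0 l; rewrite cl -ltnS ltn_ord => /(_ isT) le0.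
    by case/eqP: nel; apply: val_inj; rewrite /= inordK //; apply/eqP; rewrite eqn_leq lel.
  rewrite /S' !mulr_sumr; apply: eq_big => [l|l]; first by rewrite ltnNge.
  move=> ltl; rewrite (_ : (l : nat) = l0 + (l - l0).-1.+1)%N; last by lia.
  by rewrite {1}exprD exprS; rewrite (_ : (l0 + _ - l0).-1 = (l - l0).-1); [ring|lia].
- have : (l0 * wt mA <= m * C)%N by apply: leq_mul.
  have : ((m * d - d * l0) * wt mg <= m * d * wt mg)%N by rewrite leq_mul // leq_subr.
  by lia.
have : ((m * d - d * l0) * sumn mg <= m * d * sumn mg)%N by rewrite leq_mul // leq_subr.
by lia.
Qed.

End Bound.

(** * Numbers of unknowns and equations; divisors of monomials *)

(** Bounds the number of points lost when the side of a cube shrinks from x to x - B: each of the r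
    + 1 directions costs at most B x^r. *)
Lemma expn_sub_bound x B r :
  (x ^ r.+1 <= (x - B) ^ r.+1 + r.+1 * B * x ^ r)%N.
Proof.
elim: r => [|r IHr]; first by rewrite !expn1 expn0; lia.
have : (x * x ^ r.+1 <= x * (x - B) ^ r.+1 + r.+1 * B * x ^ r.+1)%N.
  by apply: leq_trans (leq_mul (leqnn x) IHr) _; rewrite mulnDr (expnS x r); lia.
have : (x * (x - B) ^ r.+1 <= (x - B) ^ r.+2 + B * x ^ r.+1)%N.
  have lexB : (x <= (x - B) + B)%N by lia.
  apply: leq_trans (leq_mul lexB (leqnn _)) _; rewrite mulnDl -expnS leq_add2l.
  by rewrite leq_mul // leq_exp2r // leq_subr.
by rewrite -expnS; lia.
Qed.

(** Put x = n' + 1 and y = n + 1; there are r + 1 variables. The unknowns of S leave d x^(r+1)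
    equations and a boundary term. As x <= (W + 1) y, the choice of m gives d x^(r+1) <= (m - 1)
    y^(r+1) ([E1]), and n is large enough for y^(r+1) to exceed the boundary term ([E2]). The part
    beta of n' leaves room for the weights of A and g. *)
Lemma more_unknowns (r d B W beta : nat) :
  let m := (d * W.+1 ^ r.+1 + 1)%N in
  let n := (beta + B + m * d * r.+1 * B * W.+1 ^ r.+1)%N in
  let n' := (W * n + beta)%N in
  (0 < d)%N -> (0 < W)%N ->
  (B <= n')%N /\
  ((m * d).+1 * n'.+1 ^ r.+1 <
   m.+1 * n.+1 ^ r.+1 + (m * d - d).+1 * (n' - B).+1 ^ r.+1)%N.
Proof.
move=> m n n' d0 W0.
have leBn : (beta + B <= n)%N by rewrite leq_addr.
have lenn' : (n <= W * n)%N by rewrite leq_pmull.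
have leB : (B <= n')%N by rewrite /n'; lia.
split=> //; set x := n'.+1; set y := n.+1.
have -> : (n' - B).+1 = (x - B)%N by rewrite /x; lia.
have lexy : (x <= W.+1 * y)%N.
  rewrite /x /y /n' mulSn !mulnS; lia.
have E1 : (d * x ^ r.+1 <= (m - 1) * y ^ r.+1)%N.
  rewrite /m addnK -mulnA leq_mul2l -expnMn leq_exp2r // lexy orbT //.
have dmd : (d <= m * d)%N by rewrite leq_pmull // /m addn1.
have E2 : ((m * d - d).+1 * (r.+1 * B * x ^ r) < y ^ r.+1)%N.
  apply: (@leq_ltn_trans (n * y ^ r)); last by rewrite expnS ltn_pmul2r ?expn_gt0.
  apply: (@leq_trans (m * d * (r.+1 * B * (W.+1 ^ r.+1 * y ^ r)))).
    apply: leq_mul; first by move: dmd d0; set D := (m * d)%N; lia.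
    rewrite leq_mul2l; apply/orP; right.
    apply: (@leq_trans (W.+1 ^ r * y ^ r)); first by case: (r) => // r'; rewrite -expnMn leq_exp2r.
    by rewrite leq_mul2r leq_exp2l ?leqnSn ?orbT //; lia.
  rewrite !mulnA leq_mul2r; apply/orP; right.
  by rewrite /n leq_addl.
have E3 := expn_sub_bound x B r.
have E4 : ((m * d - d).+1 * x ^ r.+1 <=
    (m * d - d).+1 * (x - B) ^ r.+1 + (m * d - d).+1 * (r.+1 * B * x ^ r))%N.
  by rewrite -mulnDr leq_mul2l E3 orbT.
have -> : (m * d).+1 = (d + (m * d - d).+1)%N by move: dmd; set D := (m * d)%N; lia.
rewrite mulnDl; have : ((m - 1) * y ^ r.+1 + y ^ r.+1 <= m.+1 * y ^ r.+1)%N.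
  by rewrite -mulSnr leq_mul2r; apply/orP; right; lia.
by lia.
Qed.

Section Monomials.
Variable K : fieldType.

Fixpoint gmon r (n : seq int) : iter_laurent K r :=
  match r return iter_laurent K r with
  | 0 => 1
  | r'.+1 => lmonomial (gmon r' (behead n)) (head 0 n)
  end.

Lemma gmonE r (n : r.-tuple int) : gmonomial K n = gmon r n.
Proof.
elim: r n => // r IHr n; case/tupleP: n => a n /=.
by rewrite theadE behead_tupleE IHr.
Qed.

Definition zsubl (n n' : seq int) : seq int := [seq x.1 - x.2 | x <- zip n n'].

Lemma size_zsubl n n' : size n = size n' -> size (zsubl n n') = size n'.
Proof. by move=> sz; rewrite size_map size2_zip ?sz. Qed.

Lemma lcoef_monomialM (F : fieldType) (a : F) m (s : laurent F) n :
  lcoef (lmonomial a m * s) n = a * lcoef s (n - m).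
Proof.
have am : vanish_below (lmonomial a m) m by move=> k ltk /=; rewrite lt_eqF.
have [ms sm] := lcoef_bounded s.
have [ltn|/nat_above[k ->]] := ltrP n (m + ms).
  by rewrite [LHS](conv_vanish am sm ltn) sm ?mulr0 //; lia.
rewrite [LHS](conv_sum _ am sm) big_ord_recl big1 ?addr0 => [|i _]; last first.
  by rewrite /= -[X in _ == X]addr0 (inj_eq (addrI m)) mul0r.
by rewrite /= eqxx subn0; congr (_ * lcoef s _); lia.
Qed.

Lemma gco_gmonM r n (s : iter_laurent K r) n' : size n = r -> size n' = r ->
  gco (gmon r n * s) n' = gco s (zsubl n' n).
Proof.
elim: r n s n' => [|r IHr] [|a n] s [|b n'] //; first by rewrite mul1r.
move=> [szn] [szn'].
transitivity (gco (lcoef (lmonomial (gmon r n) a * s) b) n'); first by [].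
by rewrite lcoef_monomialM IHr.
Qed.

Lemma zsubl_zexpc c c' q m k : size k = size m ->
  zsubl (zexpc (c + c') q (addl m k)) (zexpc c q m) = zexpc c' q k.
Proof.
elim: m k c c' q => [|a m IHm] [|b k] c c' q //= [szk].
rewrite /zsubl /= -/(zsubl _ _) mulnDr IHm //; congr (_ :: _); lia.
Qed.

Lemma zexpc_addl c c' q m k : size k = size m ->
  zexpc (c + c') q (addl m k) = [seq x.1 + x.2 | x <- zip (zexpc c q m) (zexpc c' q k)].
Proof.
elim: m k c c' q => [|a m IHm] [|b k] c c' q //= [szk].
by rewrite mulnDr IHm //; congr (_ :: _); lia.
Qed.

Lemma gmonM r n n' : size n = r -> size n' = r ->
  gmon r n * gmon r n' = gmon r [seq x.1 + x.2 | x <- zip n n'].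
Proof.
elim: r n n' => [|r IHr] [|a n] [|b n'] //; first by rewrite mul1r.
move=> [szn] [szn']; apply/laurentP => k.
transitivity (lcoef (lmonomial (gmon r n) a * lmonomial (gmon r n') b) k); first by [].
rewrite lcoef_monomialM /= -IHr // subr_eq addrC; case: ifP => _ //.
by rewrite mulr0.
Qed.

Lemma gmonN r n : size n = r -> gmon r (map -%R n) * gmon r n = 1.
Proof.
elim: r n => [|r IHr] [|a n] //; first by rewrite mul1r.
move=> [szn]; apply/laurentP => k.
transitivity (lcoef (lmonomial (gmon r (map -%R n)) (- a) * lmonomial (gmon r n) a) k); first by [].
rewrite lcoef_monomialM /= opprK (_ : (k + a == a) = (k == 0)); last by lia.
by case: ifP => _; rewrite ?mulr0 // IHr.
Qed.

End Monomials.

Section MonomialFactor.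
Variables (K : fieldType) (r : nat).
Local Notation F := (iter_laurent K r).

Lemma zco_gmon q m k : size m = r -> size k = r ->
  zco 0 q (gmon K r (zexpc 0 q m)) k = (k == m)%:R.
Proof.
move=> szm szk; have /eqP szm' : size (zexpc 0 q m) = r by rewrite size_zexpc.
have /eqP szk' : size (zexpc 0 q k) = r by rewrite size_zexpc.
rewrite /zco -[zexpc 0 q m]/(tval (Tuple szm')) -gmonE.
rewrite -[zexpc 0 q k]/(tval (Tuple szk')) -gcoE gcoef_monomial -val_eqE /=.
by rewrite (inj_eq (@zexpc_inj 0 q)).
Qed.

Lemma zsupp_div q m (s : F) : size m = r -> zsupp 0 q s ->
  (forall k, size k = r -> zco 0 q s k != 0 -> leql m k) ->
  zsupp 0 q (gmon K r (map -%R (zexpc 0 q m)) * s).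
Proof.
move=> szm Rs mins n szn; rewrite gco_gmonM ?size_map ?size_zexpc // => nz.
have szsub : size (zsubl n [seq - i | i <- zexpc 0 q m]) = r.
  by rewrite size_zsubl ?size_map ?size_zexpc ?szm.
have [k szk Ek] := Rs _ szsub nz; have := mins k szk; rewrite /zco -Ek.
case/(_ nz)/leqlP=> l szl Dk; exists l; first by rewrite szl.
have := @zsubl_zexpc 0 0 q m l szl; rewrite -Dk addn0 -Ek => <-.
have: size n = size (zexpc 0 q m) by rewrite size_zexpc szm.
rewrite /zsubl; elim: n (zexpc 0 q m) {szn nz szsub Ek} => [|x n IHn] [|y e] //= [szn].
by rewrite opprK addrK -IHn.
Qed.

(* Two series whose product is a monomial have, for every coordinate i, minimal
   i-th exponents which add up to the i-th exponent of the monomial. So do their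
   initial exponents, which must be these minima. *)
Lemma monomial_factor q mu (g h : F) : size mu = r ->
  zsupp 0 q g -> zsupp 0 q h -> g * h = gmon K r (zexpc 0 q mu) ->
  exists m, [/\ size m = r, zco 0 q g m != 0,
    forall k, size k = r -> zco 0 q g k != 0 -> leql m k
    & exists w w', [/\ zsupp 0 q w, zsupp 0 q w', w * w' = 1
                     & g = gmon K r (zexpc 0 q m) * w]].
Proof.
move=> szmu Rg Rh gh.
have nz : g * h != 0.
  by rewrite gh; apply: (@zco_neq0 _ _ q _ mu); rewrite zco_gmon // eqxx oner_eq0.
have [g0 h0] : g != 0 /\ h != 0 by move: nz; rewrite mulf_eq0 negb_or => /andP.
(* The weight is left free: the constant 0 yields the lexicographic initial exponents m and m', the
   i-th coordinate yields the minimal i-th exponents. *)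
have leads wt : (forall k l, size k = r -> size l = r -> wt (addl k l) = (wt k + wt l)%N) ->
    exists a b, [/\ lead r wt (zco 0 q g) a, lead r wt (zco 0 q h) b & addl a b = mu].
  move=> wtD; have [a0 sza0 ga0] := zsupp_neq0 Rg g0; have [b0 szb0 hb0] := zsupp_neq0 Rh h0.
  have [a la] := lead_exists wt sza0 ga0; have [b lb] := lead_exists wt szb0 hb0.
  exists a, b; split=> //.
  have [sz] := lead_mul wtD (fun k => zcoM Rg Rh) la lb.
  by rewrite gh zco_gmon //; case: (_ =P mu) => // _; rewrite eqxx.
have [m [m' [lm lm' Emu]]] := leads (fun=> 0%N) (fun _ _ _ _ => erefl).
have [szm gm _] := lm; have [szm' hm' _] := lm'.
have nthD i x y : (i < r)%N -> size x = r -> size y = r ->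
    nth 0%N (addl x y) i = (nth 0 x i + nth 0 y i)%N.
  move=> lti szx szy; have : size y = size x by rewrite szy.
  move: lti; rewrite -szx; elim: (x) (y) (i) => [|c x1 IHx] [|e y1] [|j] //= ltj [szxy].
  exact: IHx.
have minmm' i k : size k = r -> (i < r)%N ->
    (zco 0 q g k != 0 -> (nth 0 m i <= nth 0 k i)%N) /\
    (zco 0 q h k != 0 -> (nth 0 m' i <= nth 0 k i)%N).
  (* Here a_i <= m_i and b_i <= m'_i by minimality, while a_i + b_i = m_i + m'_i; so both are
     equalities. *)
  move=> szk lti; have [a [b [la lb Eab]]] := leads (nth 0%N ^~ i) (fun x y => @nthD i x y lti).
  have [sza _ _] := la; have [szb _ _] := lb.
  have := lead_wt la szm gm; have := lead_wt lb szm' hm'.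
  have := congr1 (nth 0%N ^~ i) Eab; rewrite -Emu !nthD //= => Ei le1 le2.
  by split=> [/(lead_wt la szk)|/(lead_wt lb szk)]; lia.
have nth_leql x y : size x = r -> size y = r ->
    (forall i, (i < r)%N -> (nth 0 x i <= nth 0 y i)%N) -> leql x y.
  move=> szx szy lexy; rewrite all2E szx szy eqxx /=.
  apply/(all_nthP (0, 0)%N) => i; rewrite size2_zip ?szx ?szy // => lti.
  by rewrite nth_zip ?szx ?szy //=; apply: lexy.
have minm k : size k = r -> zco 0 q g k != 0 -> leql m k.
  by move=> szk gk; apply: nth_leql => // i lti; apply: (minmm' i k szk lti).1.
have minm' k : size k = r -> zco 0 q h k != 0 -> leql m' k.
  by move=> szk gk; apply: nth_leql => // i lti; apply: (minmm' i k szk lti).2.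
exists m; split=> //.
have sze k : size k = r -> size (zexpc 0 q k) = r by rewrite size_zexpc.
pose w := gmon K r (map -%R (zexpc 0 q m)) * g.
pose w' := gmon K r (map -%R (zexpc 0 q m')) * h.
exists w, w'; split; try exact: zsupp_div; last first.
  by rewrite /w mulrA [gmon _ _ _ * gmon _ _ _]mulrC gmonN ?mul1r ?sze.
have -> : w * w' = gmon K r (map -%R (zexpc 0 q m)) *
    (gmon K r (map -%R (zexpc 0 q m')) * (g * h)) by rewrite /w /w'; ring.
rewrite gh -Emu (zexpc_addl 0 0) ?szm' // -gmonM ?sze // (mulrC (gmon K r (zexpc 0 q m))).
by rewrite [X in _ * X]mulrA gmonN ?sze // mul1r gmonN ?sze.
Qed.

End MonomialFactor.

(** * Finitely many conditions *)

Section Weights.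
Variables (K : fieldType) (r : nat) (q : seq nat).
Hypothesis szq : (size q).+1 = r.
Local Notation F := (iter_laurent K r).
Local Notation Ru := (zsupp 0 q).
Local Notation ws := (weights q).
Local Notation wt := (zdot q ws).
Local Notation exp m := (zexpc 0 q m).

Lemma wdotB n e : size e = size n -> wdot ws (zsubl n e) = wdot ws n - wdot ws e.
Proof.
elim: ws n e => [|w l IHl] [|x n] [|y e] //=; rewrite /zsubl.
- by move=> _; rewrite /wdot !big_ord0 subrr.
- by move=> _; rewrite /wdot !big_ord0 subrr.
- by rewrite subrr => _; apply: big1 => i _; rewrite nth_nil mulr0.
by case=> sze; rewrite !wdot_cons /= -/(zsubl n e) IHl //; ring.
Qed.

Lemma wdot_wt m : size m = r -> wdot ws (exp m) = (wt m)%:Z.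
Proof. by move=> szm; apply: zdot_weights => //; rewrite szm. Qed.

(** Exponents of t are used, and an integer bound, because Q(x, y_0) need not lie in K[[u]] and
    monomial factors shift the bound either way. *)
Definition wge (s : F) (x : int) := forall n, size n = r -> gco s n != 0 -> x <= wdot ws n.

Lemma wge_mon e s x : size e = r -> wge s x -> wge (gmon K r e * s) (x + wdot ws e).
Proof.
move=> sze sx n szn; rewrite gco_gmonM // => /sx; rewrite size_zsubl ?szn ?sze //.
by rewrite wdotB ?sze ?szn // => /(_ erefl); lia.
Qed.

Lemma wdotN e : wdot ws (map -%R e) = - wdot ws e.
Proof.
have := @wdotB (nseq (size e) 0) e; rewrite size_nseq => /(_ erefl).
have -> : zsubl (nseq (size e) 0) e = map -%R e.
  by rewrite /zsubl; elim: e => //= x e ->; rewrite sub0r.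
move=> ->; rewrite [X in X - _]big1 ?sub0r // => i _.
by rewrite nth_nseq if_same mulr0.
Qed.

Lemma wge_monE e s x : size e = r -> wge (gmon K r e * s) (x + wdot ws e) <-> wge s x.
Proof.
move=> sze; split=> [sx|]; last exact: wge_mon.
have := @wge_mon (map -%R e) _ _ _ sx; rewrite size_map wdotN addrK mulrA gmonN //.
by rewrite mul1r; apply.
Qed.

Lemma wge_monX e s x d : size e = r ->
  wge (gmon K r e ^+ d * s) (x + wdot ws e *+ d) <-> wge s x.
Proof.
move=> sze; elim: d => [|d IHd]; first by rewrite mul1r addr0.
by rewrite exprS -mulrA mulrSr addrA wge_monE.
Qed.

Lemma wge_mul s w x : Ru s -> Ru w -> wge s x -> wge (s * w) x.
Proof.
move=> Rs Rw sx n szn nz; have [m szm En] := zsuppM Rs Rw szn nz.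
move: nz; rewrite En -/(zco 0 q _ m) zcoM // => /cauchy_neq0[k [l [szk szl -> sk _]]].
have := sx (exp k); rewrite size_zexpc szk szm => /(_ erefl sk).
rewrite !wdot_wt ?size_zipw ?szk // (wtD szq) ?szk ?szl //; lia.
Qed.

Lemma wge_Ru s c : Ru s ->
  wge s c%:Z <-> (forall m, size m = r -> zco 0 q s m != 0 -> (c <= wt m)%N).
Proof.
move=> Rs; split=> [sx m szm sm|sx n szn sn].
  by have := sx (exp m); rewrite size_zexpc szm wdot_wt // => /(_ erefl sm).
by have [m szm En] := Rs n szn sn; rewrite En wdot_wt //; apply: sx; rewrite // /zco -En.
Qed.

(** A monomial shifts weights by exactly its own. A unit and its inverse, having exponents of
    nonnegative weight, cannot lower them: X and A, which differ by the factor w^d, satisfy the same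
    bound. *)
Lemma wge_unit s mg w w' d nu : size mg = r -> Ru w -> Ru w' -> w * w' = 1 ->
  Ru (s * (gmon K r (exp mg) * w) ^+ d) ->
  wge s nu%:Z <-> wge (s * (gmon K r (exp mg) * w) ^+ d) (nu + d * wt mg)%N%:Z.
Proof.
move=> szmg Rw Rw' ww' RA; set A := s * _ in RA *.
pose X := gmon K r (exp mg) ^+ d * s.
have EA : A = X * w ^+ d by rewrite /A /X exprMn; ring.
have EX : X = A * w' ^+ d by rewrite EA -mulrA -exprMn ww' expr1n mulr1.
have RX : Ru X by rewrite EX; apply: zsuppM => //; apply: zsuppX.
rewrite -(@wge_monX (exp mg) s _ d) ?size_zexpc // -/X wdot_wt //.
have -> : nu%:Z + (wt mg)%:Z *+ d = (nu + d * wt mg)%N%:Z by rewrite -mulr_natr; lia.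
by split=> ge; [rewrite EA|rewrite EX]; apply: wge_mul => //; apply: zsuppX.
Qed.

End Weights.

Section Determination.
Variables (K : fieldType) (r : nat) (q q' : seq nat).
Hypotheses (szq : (size q).+1 = r) (szq' : (size q').+1 = r) (leqq : leqn q q').
Local Notation F := (iter_laurent K r).
Local Notation Rt := (zsupp 0 [::]).
Local Notation Rz := (zsupp 0 q).
Local Notation Ru := (zsupp 0 q').
Local Notation ws := (weights q').

(** The monomial part of g in u divides all its terms, so its exponent is also lexicographically
    least, and the change of coordinates preserves this order. Thus it can be read off the valuation
    given in zeta. *)
Lemma initial_exponent (g : F) mg vg : Rz g ->
  size mg = r -> zco 0 q' g mg != 0 ->
  (forall k, size k = r -> zco 0 q' g k != 0 -> leql mg k) ->
  size vg = r -> zco 0 q g vg != 0 ->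
  (forall k, size k = r -> zco 0 q g k != 0 -> lexl vg k) ->
  zexpc 0 q vg = zexpc 0 q' mg.
Proof.
move=> Rg szmg gmg min_mg szvg gvg min_vg.
have [v' Ev' levv'] := zexpc_le vg (leqnn 0) leqq.
have szv' : size v' = r by rewrite -(size_leql levv').
have [|v szv Ev] := Rg (zexpc 0 q' mg) _ gmg; first by rewrite size_zexpc.
have vgv : lexl vg v by apply: min_vg; rewrite // /zco -Ev.
have mgv' : leql mg v' by apply: min_mg; rewrite // /zco -Ev'.
rewrite Ev'; congr zexpc; apply: lexl_anti (leql_lexl mgv').
exact: lexl_zexpc Ev' (esym Ev) vgv.
Qed.

(** Reading v as an exponent of t, that is, dropping the denominators of zeta^v, gives a computable
    bound for the exponent in u of the same monomial. *)
Lemma leql_initial c c' c2 v m : zexpc c q v = zexpc c' q' m -> (c' <= c2)%N ->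
  leql m (tcoord c2 q' v).
Proof.
elim: v c c' c2 (q) (q') m => [|a v IHv] c c' c2 q1 q2 [|b m] //= [Eab Evm] lec.
have leb : (b <= a + c2)%N by lia.
by rewrite leb (IHv _ _ _ _ _ _ Evm) // leq_mul.
Qed.

(** Only the converse needs the cube. If A has a term of weight < c, so has its initial term, whose
    exponent is bounded by [lead_bound]; the corresponding coefficient is therefore among those
    tested, a contradiction. *)
Lemma finite_determination (P Q : {poly F}) (k : seq nat) (d B nu : nat) f g vg :
  let wS := sumn ws in
  let Lg := zdot q ws vg in
  let c := (nu + d * Lg)%N in
  let m := (d * wS.+1 ^ r + 1)%N in
  let beta := (m * c + m * d * Lg)%N in
  let n := (beta + B + m * d * r * B * wS.+1 ^ r)%N in
  let M := (sumn (tcoord 0 q' (nseq r n)) + m * d * sumn (tcoord 0 q' vg))%N in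
  let A := Q.[f / g] * g ^+ d in
  (0 < d)%N ->
  Rtpoly P -> (size P <= d.+1)%N -> size k = r -> polyco P k != 0 -> (sumn k <= B)%N ->
  P.[f / g] = 0 -> Rtpoly Q -> (size Q <= d.+1)%N -> Rz f -> Rz g -> g != 0 ->
  (exists mu h, [/\ size mu = r, Ru h & g * h = gmon K r (zexpc 0 q' mu)]) ->
  size vg = r -> zco 0 q g vg != 0 ->
  (forall l, size l = r -> zco 0 q g l != 0 -> lexl vg l) ->
  wge q' (Q.[f / g]) nu%:Z <->
  (forall l, l \in below (nseq r M) -> (zdot q ws l < c)%N -> zco 0 q A l = 0).
Proof.
move=> wS Lg c m beta n M A d0 RP szP szk Pk leB Pfg RQ szQ Rf Rg g0.
case=> mu [h [szmu Rh gh]] szvg gvg min_vg.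
have Rfu : Ru f := zsupp_le leqq Rf; have Rgu : Ru g := zsupp_le leqq Rg.
have [mg [szmg gmg min_mg [w [w' [Rw Rw' ww' Eg]]]]] := monomial_factor szmu Rgu Rh gh.
have Evg := initial_exponent Rg szmg gmg min_mg szvg gvg min_vg.
have wtz l l' : size l = r -> size l' = r -> zexpc 0 q l = zexpc 0 q' l' ->
    zdot q ws l = zdot q' ws l'.
  move=> szl szl' Ell'; have := wdot_wt szq' szl'; rewrite -Ell'.
  rewrite zdot_weights ?szl //; last by apply/succn_inj; rewrite szq.
  by case.
have ELg : Lg = zdot q' ws mg by apply: wtz.
have lg : ulead q' g mg.
  split=> // l szl gl; have lel := min_mg l szl gl.
  have /leqlP[x szx El] := lel.
  rewrite lexl_cons leql_lexl // andbT orbC -leq_eqVlt El (wtD szq') ?leq_addr //.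
  by rewrite szx.
have RA : Rz A.
  rewrite /A (homogenize _ szQ g0); apply: zsupp_sum => j _; apply: zsuppM.
    exact: zsupp_le (leqn_nil q) (RQ j).
  by apply: zsuppM; apply: zsuppX.
have RAu : Ru A := zsupp_le leqq RA.
have EA : A = Q.[f / g] * (gmon K r (zexpc 0 q' mg) * w) ^+ d by rewrite /A -Eg.
rewrite (wge_unit (d := d) szq' nu szmg Rw Rw' ww') -?EA // -ELg -/c (wge_Ru szq' c RAu).
split=> [hA l lM lc|hA l szl Al].
  have szl : size l = r by move: lM; rewrite mem_below => /size_leql->; rewrite size_nseq.
  apply: contrapT => /eqP Al.
  have [l' Ell' lell'] := zexpc_le l (leqnn 0) leqq.
  have szl' : size l' = r by rewrite -(size_leql lell').
  have := hA l' szl'; rewrite {1}/zco -Ell' => /(_ Al).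
  by rewrite -(wtz _ _ szl szl' Ell') leqNgt lc.
rewrite leqNgt; apply/negP => ltl.
have A0 : A != 0 by apply: zco_neq0 Al.
have [mA lA] := ulead_exists RAu A0; have [szmA AmA _] := lA.
have wmA : (zdot q' ws mA < c)%N := leq_ltn_trans (lead_wt lA szl Al) ltl.
have wS0 : (0 < wS)%N.
  by rewrite /wS; case: (q') (weights_gt0 (leq0n (size q'))) => //= a q1; lia.
have [r' Er] : exists r', r = r'.+1 by exists (size q').
have := more_unknowns r' B beta d0 wS0; rewrite -Er -/m -/n => -[leBn' count].
have := lead_bound szq' RP szP szk Pk leB RQ szQ _ _ count Rfu Rgu g0 Pfg lg lA (ltnW wmA).
rewrite subnKC // -ELg -/wS => H.
(* The two terms of M bound the contributions of c_(l0) and of the power of g, the latter in terms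
   of the given [vg] only. *)
have smA : (sumn mA <= M)%N.
  apply: leq_trans (H _ _ _) _ => //; first by rewrite /m addn1.
    by rewrite /beta; lia.
  rewrite leq_add2l leq_mul2l leql_sumn ?orbT //.
  exact: leql_initial Evg (leqnn 0).
have [|l1 szl1 El1] := RA (zexpc 0 q' mA) _ AmA; first by rewrite size_zexpc.
have := hA l1; rewrite (wtz _ _ szl1 szmA (esym El1)) wmA => /(_ _ isT).
rewrite {1}/zco -El1 => H1; case/negP: AmA; apply/eqP/H1.
(* The tests are made in zeta, where the exponent [l1] of this term is componentwise at most its
   exponent [mA] in u. *)
have [l2 El2 le12] := zexpc_le l1 (leqnn 0) leqq.
move: El2; rewrite -El1 => /zexpc_inj El2; rewrite mem_below leql_nseq //.
by apply: leq_trans smA; rewrite El2 leql_sumn.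
Qed.

End Determination.

(** * The (x)-adic order *)

Section XAdic.
Variables (K : fieldType) (r p : nat).
Hypothesis p_gt0 : (0 < p)%N.
Local Notation F := (iter_laurent K r).

Definition xvec (i : seq nat) : seq nat := map (muln p) i.
Local Notation xx i := (map Posz (xvec i)).

Lemma xexpE (i : r.-tuple nat) : tval (xexp p i) = xx i.
Proof.
apply: (@eq_from_nth _ 0); rewrite ?size_tuple // => j ltj.
have ltj' : (j < size i)%N by rewrite size_tuple.
rewrite (nth_map 0%N) ?size_map // (nth_map 0%N) //.
transitivity (tnth (xexp p i) (Ordinal ltj)); first by rewrite (tnth_nth 0).
by rewrite tnth_mktuple (tnth_nth 0%N).
Qed.

Lemma size_xx i : size (xx i) = size i.
Proof. by rewrite !size_map. Qed.

Lemma xx_inj i i' : xx i = xx i' -> i = i'.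
Proof.
move=> E; have := inj_map (can_inj absz_nat) E; apply: inj_map => x y Exy.
by apply/eqP; rewrite -(eqn_pmul2l p_gt0) Exy.
Qed.

Definition xsupp (s : F) :=
  forall n, size n = r -> gco s n != 0 -> exists2 i, size i = r & n = xx i.

Lemma in_KxE s : in_Kx p s <-> xsupp s.
Proof.
split=> [s_x n szn|s_x n].
  have /eqP szn' := szn; rewrite -[n]/(tval (Tuple szn')) -gcoE => /s_x[i ->].
  by exists i; rewrite ?size_tuple ?xexpE.
rewrite gcoE => nz; have [|i /eqP szi En] := s_x n _ nz; first exact: size_tuple.
by exists (Tuple szi); apply/val_inj/(etrans En)/esym/xexpE.
Qed.

Lemma xsupp_Rt s : xsupp s -> zsupp 0 [::] s.
Proof.
move=> s_x n szn /(s_x n szn)[i szi ->]; exists (xvec i); first by rewrite size_map.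
by rewrite zexpc_nil.
Qed.

Definition unit_exp (i : 'I_r) : seq nat := tval [tuple (j == i : nat) | j < r].

Lemma size_unit_exp i : size (unit_exp i) = r.
Proof. by rewrite size_tuple. Qed.

Lemma nth_unit_exp i j : (j < r)%N -> nth 0%N (unit_exp i) j = (j == i).
Proof.
move=> ltj; rewrite -[j]/(nat_of_ord (Ordinal ltj)) -tnth_nth tnth_mktuple.
by rewrite -val_eqE.
Qed.

Lemma sumn_unit_exp i : sumn (unit_exp i) = 1%N.
Proof.
rewrite sumnE big_tuple (bigD1 i) //= tnth_mktuple eqxx big1 // => j ne.
by rewrite tnth_mktuple (negPf ne).
Qed.

Lemma xvarE i : xvar K p i = gmon K r (xx (unit_exp i)).
Proof. by rewrite /xvar gmonE xexpE. Qed.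

Lemma xx_addl i j : size j = size i -> xx (addl i j) = [seq x.1 + x.2 | x <- zip (xx i) (xx j)].
Proof.
elim: i j => [|a i IHi] [|b j] //= [szj]; rewrite -IHi //; congr (_ :: _).
by rewrite mulnDr PoszD.
Qed.

Lemma zsubl_eq n e n' : size e = size n -> size n' = size n ->
  zsubl n e = n' <-> n = [seq x.1 + x.2 | x <- zip n' e].
Proof.
elim: n e n' => [|x n IHn] [|y e] [|z n'] //= [sze] [szn'].
rewrite /zsubl /= -/(zsubl n e); have IH := IHn e n' sze szn'.
split=> -[Ex En]; congr (_ :: _); first [by apply/IH | by lia].
Qed.

Lemma zsubl_xx_eq n i j : size n = r -> size j = r -> size i = r ->
  zsubl n (xx j) = xx i -> n = xx (addl i j).
Proof.
move=> szn szj szi /zsubl_eq; rewrite !size_map szn szj szi => /(_ erefl erefl) ->.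
by rewrite xx_addl ?szj.
Qed.

Lemma in_xpow_low k s : in_xpow p k s -> xsupp s /\
  forall i, size i = r -> (sumn i < k)%N -> gco s (xx i) = 0.
Proof.
elim: k s => [|k IHk] s /=; first by move/in_KxE.
case=> t [tk ->].
have key n : size n = r -> gco (\sum_i xvar K p i * t i) n != 0 ->
    exists i j, [/\ size j = r, n = xx (addl j (unit_exp i)) & gco (t i) (xx j) != 0].
  move=> szn; rewrite gco_sum => nz.
  have [i _ nzi] : exists2 i, i \in index_enum 'I_r & gco (xvar K p i * t i) n != 0.
    apply/hasP; apply: contraNT nz => /hasPn z; apply/eqP.
    by rewrite big_seq big1 // => j /z; rewrite negbK => /eqP.
  move: nzi; rewrite xvarE gco_gmonM ?size_xx ?size_unit_exp // => nzi.
  have [xt _] := IHk _ (tk i).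
  have [|j szj Ej] := xt _ _ nzi; first by rewrite size_zsubl size_xx size_unit_exp.
  exists i, j; split; rewrite -?Ej //.
  by apply: zsubl_xx_eq; rewrite ?size_unit_exp.
split=> [n szn /(key n szn)[i [j [szj -> _]]]|i szi lti].
  by exists (addl j (unit_exp i)); rewrite ?size_zipw.
apply: contrapT => /eqP /key; rewrite !size_map => /(_ szi)[l [j [szj /xx_inj Ei]]].
have [_ ->] := IHk _ (tk l); rewrite ?eqxx //.
move: lti; rewrite Ei sumn_addl ?size_unit_exp // sumn_unit_exp; lia.
Qed.

Lemma restriction r' (D : pred (seq int)) (s : iter_laurent K r') :
  exists s' : iter_laurent K r', forall n, size n = r' -> gco s' n = if D n then gco s n else 0.
Proof.
elim: r' D s => [|r' IHr] D s.
  by exists (if D [::] then s else 0) => n /size0nil->.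
pose ex n := IHr (fun m => D (n :: m)) (lcoef s n).
have bdd : exists m, vanish_below (fun n => sval (cid (ex n))) m.
  case: (lcoef_bounded s) => m sm; exists m => n /sm sn.
  apply: gco_inj => e sze; case: cid => /= x ->; rewrite // sn gco0 if_same.
  by [].
exists (Laurent bdd) => -[|n e] // [sze] /=.
by case: cid => /= x ->.
Qed.

(** The terms of s are sorted by the first variable x_i which occurs in them; each part is then
    divided by its x_i. *)
Lemma low_in_xpow k s : xsupp s ->
  (forall i, size i = r -> (sumn i < k)%N -> gco s (xx i) = 0) -> in_xpow p k s.
Proof.
elim: k s => [|k IHk] s xs low /=; first exact/in_KxE.
pose D (i : 'I_r) (n : seq int) := find (predC1 0) n == i.
pose part i := sval (cid (restriction (D i) s)).
have partE i n : size n = r -> gco (part i) n = if D i n then gco s n else 0.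
  by rewrite /part; case: cid => x /= xE; apply: xE.
exists (fun i => gmon K r (map -%R (xx (unit_exp i))) * part i); split; last first.
  apply: gco_inj => n szn; rewrite gco_sum.
  under eq_bigr => i _ do rewrite xvarE mulrA [gmon _ _ _ * _]mulrC gmonN
    ?size_xx ?size_unit_exp // mul1r partE //.
  have [ltf|lef] := ltnP (find (predC1 0) n) r.
    rewrite (bigD1 (Ordinal ltf)) //= /D /= eqxx big1 ?addr0 // => i ne.
    by case: eqP => // Ei; case/eqP: ne; apply: val_inj.
  rewrite big1 => [|i _]; last by rewrite /D gtn_eqF // (leq_trans (ltn_ord i)).
  (* An exponent without nonzero entry belongs to no part: it is the constant term, which vanishes
     by [low]. *)
  have n0 : n = xx (nseq r 0%N).
    apply: (@eq_from_nth _ 0); rewrite ?size_map ?size_nseq // => j ltj.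
    rewrite (nth_map 0%N) ?size_map ?size_nseq -?szn // (nth_map 0%N) ?size_nseq -?szn //.
    rewrite nth_nseq if_same muln0; have := before_find 0 (leq_trans _ lef).
    by move=> /(_ j); rewrite -szn => /(_ ltj) /= /negbFE/eqP.
  by rewrite n0 low ?size_nseq // sumn_nseq.
move=> i; set u := unit_exp i; have szu : size u = r by rewrite size_unit_exp.
have szxu : size (xx u) = r by rewrite size_xx.
have shift n : size n = r -> zsubl n (map -%R (xx u)) = [seq x.1 + x.2 | x <- zip n (xx u)].
  move=> szn; have : size n = size (xx u) by rewrite szxu.
  rewrite /zsubl; elim: n (xx u) {szn} => [|x n IHn] [|y e] //= [szn].
  by rewrite opprK IHn.
have gcot n : size n = r -> gco (gmon K r (map -%R (xx u)) * part i) n =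
    gco (part i) [seq x.1 + x.2 | x <- zip n (xx u)].
  by move=> szn; rewrite gco_gmonM ?shift // size_map.
have szadd n : size n = r -> size [seq x.1 + x.2 | x <- zip n (xx u)] = r.
  by move=> szn; rewrite size_map size2_zip ?szn ?szxu.
apply: IHk => [n szn|j szj ltj]; rewrite gcot ?size_xx // partE ?szadd ?size_xx //; last first.
  rewrite -xx_addl ?szu ?szj //; case: ifP => // _; apply: low.
    by rewrite size_zipw.
  by rewrite sumn_addl ?szu ?szj // sumn_unit_exp; lia.
case: ifP => [Dn /(xs _ (szadd _ szn))[j szj Ej]|]; last by rewrite eqxx.
(* The first nonzero entry of p j is the i-th one, so j_i >= 1 and x_i divides x^j. *)
have lei : leql u j.
  rewrite all2E szu szj eqxx /=; apply/(all_nthP (0, 0)%N) => l.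
  rewrite size2_zip ?szu ?szj // => ltl; rewrite nth_zip ?szu ?szj //= nth_unit_exp //.
  case: eqP => // Eli; move: Dn; rewrite /D Ej => /eqP fi.
  have : has (predC1 0) (xx j) by rewrite has_find fi size_xx szj.
  move/(nth_find 0); rewrite fi -Eli /= (nth_map 0%N) ?size_map ?szj //.
  by rewrite (nth_map 0%N) ?szj //; case: (nth 0%N j l); rewrite ?muln0.
have [j' szj' Ej'] := leqlP _ _ lei; exists j'; first by rewrite szj'.
have := Ej; rewrite Ej' addlC // xx_addl ?szj' // => E.
have addK m : size m = r -> zsubl [seq x.1 + x.2 | x <- zip m (xx u)] (xx u) = m.
  by move=> szm; apply/zsubl_eq; rewrite ?szadd.
by rewrite -(addK n szn) E addK // size_xx szj'.
Qed.

Lemma xadic_order_leP (Q : {poly F}) nu0 : in_Kx_poly p Q ->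
  xadic_order_le p Q nu0 <->
  exists (i : r.-tuple nat) j, (sumn i <= nu0)%N /\ gcoef Q`_j (xexp p i) != 0.
Proof.
move=> QK; split=> [[Q0 ord]|[i [j [lei nz]]]].
  apply: contrapT => no; suff /ord : forall j, in_xpow p nu0.+1 Q`_j by rewrite ltnn.
  move=> j; apply: low_in_xpow; first exact/in_KxE/QK.
  move=> i /eqP szi lti; apply: contrapT => /eqP nz; apply: no.
  by exists (Tuple szi), j; rewrite gcoE xexpE.
split=> [|k Qk]; first by apply: contraNneq nz => ->; rewrite coef0 gcoE gco0.
rewrite leqNgt; apply: contraNN nz => ltk; have [_ low] := in_xpow_low (Qk j).
by rewrite gcoE xexpE low ?size_tuple // (leq_ltn_trans lei).
Qed.

End XAdic.

(** * The algorithm and its correctness *)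

Section Algorithm.
Variable K : fieldType.
Implicit Types a b : seq nat -> K.

Definition delta (x m : seq nat) : K := if x == m then 1 else 0.

Definition spow (r : nat) a n : seq nat -> K :=
  iter n (fun b m => cauchy m a b) (delta (nseq r 0%N)).

(* The coefficient of zeta^l in x^i f^j g^(d-j). *)
Definition term_coef (r p d : nat) (q : seq nat) a b (l : seq nat) (ij : seq nat * nat) : K :=
  cauchy l (delta (tcoord 0 q (xvec p ij.1)))
    (fun m => cauchy m (spow r a ij.2) (spow r b (d - ij.2))).

Definition indices (r d N : nat) : seq (seq nat * nat) :=
  [seq (i, j) | i <- [seq i <- below (nseq r N) | (sumn i <= N)%N], j <- iota 0 d.+1].

Definition table (V : eqType) (s : seq V) (b : V -> K) := [seq (ij, b ij) | ij <- s].

Definition weight_bound (r d nu : nat) (q q' vg : seq nat) : nat :=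
  (nu + d * zdot q (weights q') vg)%N.

(* B bounds the t-degree of some term of P; the relation has degree m in Q, and
   its coefficients are supported on [0, n]^r. *)
Definition exponent_bound (r d c B : nat) (q q' vg : seq nat) : nat :=
  let wS := sumn (weights q') in
  let Lg := zdot q (weights q') vg in
  let V := (wS.+1 ^ r)%N in
  let m := (d * V + 1)%N in
  let n := (m * c + m * d * Lg + B + m * d * r * B * V)%N in
  (sumn (tcoord 0 q' (nseq r n)) + m * d * sumn (tcoord 0 q' vg))%N.

Definition equations (r p d N c M : nat) (q q' : seq nat) a b :
    seq ((seq nat * nat -> K) -> K) :=
  [seq form (indices r d N) (term_coef r p d q a b l)
     | l <- [seq l <- below (nseq r M) | (zdot q (weights q') l < c)%N]].

(** [N] is at least nu0, as the format requires, and at least [c], so that I_N contains all the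
    coefficients of Q on which the tested coefficients of A depend. The argument p nu0 bounds the
    t-degree of a term of P. Each coefficient of f or g is queried at its own total degree. *)
Definition description (d nu0 p nu : nat) (q q' vg : seq nat)
    (proc : nat -> seq (seq nat * K) * seq (seq nat * K)) :
    nat * seq (seq (seq nat * nat * K)) :=
  let r := size vg in
  let c := weight_bound r d nu q q' vg in
  let N := (nu0 + c)%N in
  let M := exponent_bound r d c (p * nu0) q q' vg in
  let a m := entry (proc (sumn m)).1 m in
  let b m := entry (proc (sumn m)).2 m in
  (N, [seq table (indices r d N) v |
       v <- kernel (indices r d N) (equations r p d N c M q q' a b)]).

Lemma cauchy_delta x m b : cauchy m (delta x) b = if x \in below m then b (subl m x) else 0.
Proof.
rewrite /cauchy; case: ifP => xm; last first.
  rewrite big_seq big1 // => k km; rewrite /delta; case: eqP => [Ek|_].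
    by rewrite Ek km in xm.
  by rewrite mul0r.
rewrite (bigD1_seq x) ?uniq_below //= /delta eqxx mul1r big1 ?addr0 // => k ne.
by rewrite eq_sym (negPf ne) mul0r.
Qed.

Lemma indicesE r d N : indices r d N =i index_set r d N.
Proof.
case=> i j; rewrite -[RHS]/[&& size i == r, (sumn i <= N)%N & (j <= d)%N].
apply/allpairsP/and3P => [[[x y] []]|[/eqP szi lei lej]].
  rewrite mem_filter mem_below mem_iota /= => /andP[lex /size_leql szx] lty [-> ->].
  by rewrite szx size_nseq.
exists (i, j); split=> //; last by rewrite mem_iota.
by rewrite mem_filter lei mem_below leql_nseq.
Qed.

Lemma uniq_indices r d N : uniq (indices r d N).
Proof.
apply: allpairs_uniq; rewrite ?iota_uniq ?filter_uniq ?uniq_below //.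
by move=> [x y] [x' y'] _ _ [-> ->].
Qed.

Lemma entry_table (V : eqType) (s : seq V) (v : V -> K) x : uniq s -> x \in s ->
  entry (table s v) x = v x.
Proof. move=> us sx; rewrite /entry big_map /= big_mkcond (bigD1_seq x) //= eqxx.
by rewrite big1 ?addr0 // => y /negPf->. Qed.

Lemma parametric_description_kernel (r p d nu0 N : nat) (cs : seq (seq nat * nat -> K))
    (S : {poly iter_laurent K r} -> Prop) :
  (0 < p)%N -> (nu0 <= N)%N ->
  (forall Q, in_Kx_poly p Q -> (size Q <= d.+1)%N ->
     S Q <-> (forall c, c \in cs -> form (indices r d N) c
                (fun ij => gco Q`_ij.2 (map Posz (xvec p ij.1))) = 0) /\
             (exists (i : r.-tuple nat) j, (sumn i <= nu0)%N /\ gcoef Q`_j (xexp p i) != 0)) ->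
  parametric_description p d nu0 S
    (N, [seq table (indices r d N) v |
         v <- kernel (indices r d N) (map (form (indices r d N)) cs)]).
Proof.
move=> p0 leN SP; set IN := indices r d N; set bs := kernel _ _.
have uIN := uniq_indices r d N; rewrite -/IN in uIN.
have Iapp ij : index_set r d N ij = (ij \in IN) by rewrite [RHS]indicesE.
have combE (theta : nat -> K) ij : ij \in IN ->
    \sum_(m < size (map (table IN) bs)) theta m * entry (nth [::] (map (table IN) bs) m) ij =
    \sum_(m < size bs) theta m * nth (fun=> 0) bs m ij.
  move=> ijN; rewrite size_map; apply: eq_bigr => m _.
  by rewrite (nth_map (fun=> 0)) ?ltn_ord // entry_table.
have ext n (theta : 'I_n -> K) : exists t : nat -> K, forall m : 'I_n, theta m = t m.
  by exists (fun m => if insub m is Some o then theta o else 0) => m; rewrite valK.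
split=> //.
- move=> _ /mapP[v _ ->]; rewrite /is_table /unzip1 -map_comp.
  have -> : map (fst \o (fun ij => (ij, v ij))) IN = IN by apply: map_id.
  by split=> // ij; rewrite indicesE.
- move=> theta; have [t Et] := ext _ theta; move=> eq0 m; rewrite Et.
  have ltm : (m < size bs)%N by apply: leq_trans (ltn_ord m) _; rewrite size_map.
  apply: (freeP (free_kernel cs uIN) _ ltm) => ij ijN; rewrite -combE //.
  rewrite -[RHS](eq0 ij) ?Iapp //.
  by apply: eq_bigr => m' _; rewrite Et.
move=> Q QK szQ a.
have aE (i : r.-tuple nat) j : a i j = gco Q`_j (map Posz (xvec p i)).
  by rewrite /a gcoE xexpE.
suff spanP : (exists theta : nat -> K, forall ij, ij \in IN ->
     gco Q`_ij.2 (map Posz (xvec p ij.1)) =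
     \sum_(m < size bs) theta m * nth (fun=> 0) bs m ij) <->
  (exists theta : 'I_(size (map (table IN) bs)) -> K,
     forall (i : r.-tuple nat) j, index_set r d N (tval i, j) ->
     a i j = \sum_m theta m * entry (nth [::] (map (table IN) bs) m) (tval i, j)).
  split=> [/(SP _ QK szQ)[/span_kernel/spanE/spanP ? ?] //|[/spanP/spanE/span_kernel ? ?]].
  exact/(SP _ QK szQ).
split=> [[t Et]|[theta]].
  exists (fun m => t m) => i j; rewrite Iapp => ijN.
  by rewrite combE // aE (Et _ ijN).
have [t Et] := ext _ theta => Da; exists t => -[i j] ijN.
have : index_set r d N (i, j) by rewrite Iapp.
move=> /[dup] /and3P[/= szi _ _] /(Da (Tuple szi) j); rewrite aE /= => ->.
by rewrite -combE //; apply: eq_bigr => m _; rewrite Et.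
Qed.

End Algorithm.

Lemma sumn_dot q e : size e = (size q).+1 -> (sumn e <= dot (weights q) e)%N.
Proof.
have : all (leq 1) (weights q).
  by apply/(all_nthP 0%N) => i; rewrite size_weights => /weights_gt0.
rewrite -size_weights /dot; elim: (weights q) e => [|w ws IHws] [|a e] //=.
by move=> /andP[w0 ws0] [sze]; rewrite leq_add ?IHws // leq_pmull.
Qed.

Section Correctness.
Variables (K : fieldType) (r p d : nat) (q q' : seq nat).
Hypotheses (p_gt0 : (0 < p)%N) (szq : (size q).+1 = r) (szq' : (size q').+1 = r).
Hypothesis leqq : leqn q q'.
Local Notation F := (iter_laurent K r).
Local Notation Rz := (zsupp 0 q).
Local Notation ws := (weights q').

Lemma spow_zco (s : F) a n : Rz s -> (forall m, size m = r -> a m = zco 0 q s m) ->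
  forall m, size m = r -> spow r a n m = zco 0 q (s ^+ n) m.
Proof.
move=> Rs Ea; elim: n => [|n IHn] m szm.
  rewrite /zco gco1 ?size_zexpc // -(zexpc_nseq0 q) (inj_eq (@zexpc_inj 0 q)).
  by rewrite /spow /= /delta eq_sym; case: eqP.
rewrite exprS zcoM //; last exact: zsuppX.
rewrite [LHS]/(cauchy m a (spow r a n)).
by apply: eq_cauchy => k; rewrite szm => szk; [apply: Ea | apply: IHn].
Qed.

Lemma zco_form (Q : {poly F}) (f g : F) a b (c N : nat) l :
  in_Kx_poly p Q -> (size Q <= d.+1)%N -> Rz f -> Rz g -> g != 0 ->
  (forall m, size m = r -> a m = zco 0 q f m) ->
  (forall m, size m = r -> b m = zco 0 q g m) ->
  size l = r -> (zdot q ws l < c)%N -> (c <= N)%N ->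
  zco 0 q (Q.[f / g] * g ^+ d) l =
  form (indices r d N) (term_coef r p d q a b l)
    (fun ij => gco Q`_ij.2 (map Posz (xvec p ij.1))).
Proof.
move=> QK szQ Rf Rg g0 Ea Eb szl ltc leN.
rewrite (homogenize _ szQ g0) zco_sum /form /indices big_allpairs_dep /=.
rewrite exchange_big -[X in _ = \sum_(j <- X) _]/(index_iota 0 d.+1) big_mkord.
apply: eq_bigr => j _; set X := fun i => tcoord 0 q (xvec p i).
have xQ : xsupp p Q`_j by apply/in_KxE.
have RQ : Rz Q`_j := zsupp_le (leqn_nil q) (xsupp_Rt xQ).
have Rfg : Rz (f ^+ j * g ^+ (d - j)) by apply: zsuppM; apply: zsuppX.
rewrite zcoM //; set h := f ^+ j * _ in Rfg *.
have Eh m : size m = r -> cauchy m (spow r a j) (spow r b (d - j)) = zco 0 q h m.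
  move=> szm; rewrite zcoM //; try exact: zsuppX.
  by apply: eq_cauchy => k; rewrite szm => szk; apply: spow_zco.
set I := [seq i <- _ | _].
have X_inj : injective X.
  move=> i i' EX; apply: (xx_inj p_gt0); rewrite -!(zexpc_tcoord 0 q).
  by rewrite -/(X i) EX.
have uX : uniq (map X I) by rewrite (map_inj_uniq X_inj) filter_uniq ?uniq_below.
transitivity (\sum_(k <- below l)
    if k \in map X I then zco 0 q Q`_j k * zco 0 q h (subl l k) else 0).
  rewrite /cauchy; apply: eq_big_seq => k; rewrite mem_below => lek.
  case: ifPn => // kX; have szk : size k = r by rewrite (size_leql lek).
  case: (eqVneq (zco 0 q Q`_j k) 0) => [->|nz]; first by rewrite mul0r.
  case/negP: kX; have [|i szi Ei] := xQ _ _ nz; first by rewrite size_zexpc.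
  have EkX : k = X i by apply/(@zexpc_inj 0 q); rewrite Ei zexpc_tcoord.
  apply/mapP; exists i => //; rewrite mem_filter mem_below.
  have szx : size (xvec p i) = (size q').+1 by rewrite size_map szi szq'.
  (* If x^i contributes to the coefficient at l, then |i| <= L(x^i) <= L(zeta^l) < c <= N, since
     every zeta_j has nonnegative weight. *)
  suff lei : (sumn i <= N)%N by rewrite lei leql_nseq.
  apply: leq_trans leN; apply: ltnW; apply: leq_ltn_trans ltc.
  have szqq : size q = size q' by apply/succn_inj; rewrite szq.
  have [k' szk' ->] := leqlP _ _ lek.
  rewrite zdotD ?szk' ?szk ?szq' //; apply: leq_trans (leq_addr _ _).
  rewrite EkX zdot_tcoord //; apply: leq_trans (sumn_dot szx).
  by rewrite /xvec; elim: (i) => //= x y IHy; rewrite leq_add // leq_pmull.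
rewrite big_seq_swap ?uniq_below // big_map; apply: eq_bigr => i _.
rewrite /term_coef cauchy_delta -/(X i) /=; case: ifP => [|_]; last by rewrite mulr0.
rewrite mem_below => leX; have szX : size (X i) = r by rewrite (size_leql leX).
by rewrite zco_tcoord zco_nil Eh // size_zipw.
Qed.

End Correctness.

Lemma description_correct (K : fieldType) (r d nu0 p : nat) (q : r.-1.-tuple nat)
    (f g : iter_laurent K r) (q' : r.-1.-tuple nat) (B : seq (nat * nat))
    (nu : nat) (vg : r.-tuple nat)
    (proc : nat -> seq (seq nat * K) * seq (seq nat * K)) :
  (0 < r)%N -> (0 < d)%N -> (0 < p)%N ->
  in_Kzeta q f -> in_Kzeta q g -> g != 0 ->
  (exists P, admissible_poly p d nu0 P /\ P.[f / g] = 0) ->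
  (forall i, tnth q i <= tnth q' i)%N ->
  monomialized q' (f * g) -> is_blocks q' B -> lex_valuation q g vg ->
  is_coef_procedure q f g proc ->
  parametric_description p d nu0 (in_Qnu p d nu0 q' B (f / g) nu)
    (description d nu0 p nu q q' vg proc).
Proof.
move=> r0 d0 p0 /in_KzetaE Rf /in_KzetaE Rg g0 [P [[PK szP ordP] Pfg]] leq_tnth.
move=> [mu [w [/in_KzetaE Rw [w' /in_KzetaE Rw' ww'] Efg]]] blocks [gvg min_vg] procP.
have szq : (size q).+1 = r by rewrite size_tuple prednK.
have szq' : (size q').+1 = r by rewrite size_tuple prednK.
have leqq : leqn q q'.
  move=> i; have [lti|lei] := ltnP i r.-1; last by rewrite nth_default ?size_tuple.
  by have := leq_tnth (Ordinal lti); rewrite !(tnth_nth 0%N).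
(* The order of P supplies its term of small degree; p i0 is the exponent of that term in t. *)
have [i0 [j0 [lei0 nz0]]] := (xadic_order_leP p0 nu0 PK).1 ordP.
have RP : Rtpoly P by move=> j; apply/(@xsupp_Rt _ _ p)/in_KxE/PK.
have szk : size (xvec p i0) = r by rewrite size_map size_tuple.
have leB : (sumn (xvec p i0) <= p * nu0)%N.
  apply: leq_trans (leq_mul (leqnn p) lei0); rewrite /xvec.
  by elim: (tval i0) => //= x y; lia.
have Pk : polyco P (xvec p i0) != 0.
  apply: contraNneq nz0 => /(congr1 (fun u : {poly K} => u`_j0)).
  by rewrite coef_polyco coef0 zco_nil gcoE xexpE => ->.
rewrite /description size_tuple; set c := weight_bound _ _ _ _ _ _.
set N := (nu0 + c)%N; set M := exponent_bound _ _ _ _ _ _ _.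
rewrite /equations [X in kernel _ X]map_comp.
apply: parametric_description_kernel; rewrite ?leq_addr // => Q QK szQ.
have RQ : Rtpoly Q by move=> j; apply/(@xsupp_Rt _ _ p)/in_KxE/QK.
have Ea m : size m = r -> entry (proc (sumn m)).1 m = zco 0 q f m.
  move=> /eqP szm; have [[_ /(_ (Tuple szm) (leqnn _)) Em] _] := procP (sumn m).
  by rewrite -[m]/(tval (Tuple szm)) Em zcoE.
have Eb m : size m = r -> entry (proc (sumn m)).2 m = zco 0 q g m.
  move=> /eqP szm; have [_ [_ /(_ (Tuple szm) (leqnn _)) Em]] := procP (sumn m).
  by rewrite -[m]/(tval (Tuple szm)) Em zcoE.
(* From fg = u^mu w, the cofactor of g in the monomial u^mu is f times the inverse of w. *)
have unit_fg : exists mu h, [/\ size mu = r, zsupp 0 q' h &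
    g * h = gmon K r (zexpc 0 q' mu)].
  exists mu, (f * w'); split; first exact: size_tuple.
    by apply: zsuppM => //; apply: zsupp_le Rf.
  by rewrite mulrCA mulrA Efg -mulrA ww' mulr1 gmonE zexpE.
have min_vg' l : size l = r -> zco 0 q g l != 0 -> lexl vg l.
  by move=> /eqP szl gl; apply: (min_vg (Tuple szl)); rewrite zcoE.
have gvg' : zco 0 q g vg != 0 by rewrite -zcoE.
have := @finite_determination K r q q' szq szq' leqq P Q _ d _ nu f g vg d0 RP szP szk Pk leB Pfg
  RQ szQ Rf Rg g0 unit_fg (size_tuple vg) gvg' min_vg'.
rewrite -[(nu + _)%N]/c => det.
(* The bound of [finite_determination] and [M] are the same expression after unfolding. *)
have {}det : wge q' Q.[f / g] nu%:Z <-> forall l, l \in below (nseq r M) ->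
    (zdot q (weights q') l < c)%N -> zco 0 q (Q.[f / g] * g ^+ d) l = 0 := det.
have ordQ := xadic_order_leP p0 nu0 QK.
have wgeE : (forall n, gcoef Q.[f / g] n != 0 -> nu%:Z <= Ltilde q' B n) <->
    wge q' Q.[f / g] nu%:Z.
  split=> [ge n /eqP szn|ge n].
    rewrite -[n]/(tval (Tuple szn)) -gcoE -(LtildeE _ r0 blocks); exact: ge.
  by rewrite gcoE (LtildeE _ r0 blocks) => /ge; rewrite size_tuple => /(_ erefl).
have zero_form l : l \in below (nseq r M) -> (zdot q (weights q') l < c)%N ->
    zco 0 q (Q.[f / g] * g ^+ d) l =
    form (indices r d N) (term_coef r p d q (fun m => entry (proc (sumn m)).1 m)
       (fun m => entry (proc (sumn m)).2 m) l)
      (fun ij => gco Q`_ij.2 (map Posz (xvec p ij.1))).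
  move=> lM lc; apply: (zco_form p0 szq szq' leqq) lc _ => //; last by rewrite leq_addl.
  by move: lM; rewrite mem_below => /size_leql->; rewrite size_nseq.
split=> [[[_ _ /ordQ ex] /wgeE/det wgeQ]|[eqs ex]].
  split=> // _ /mapP[l + ->]; rewrite mem_filter => /andP[lc lM].
  by rewrite -zero_form // wgeQ.
split; first by split=> //; apply/ordQ.
apply/wgeE/det => l lM lc; rewrite zero_form //; apply/eqs/map_f.
by rewrite mem_filter lc.
Qed.

(** * Programs *)

Local Notation V0 := (Var (VZ _ _)).
Local Notation V1 := (Var (VS _ (VZ _ _))).
Local Notation V2 := (Var (VS _ (VS _ (VZ _ _)))).
Local Notation V3 := (Var (VS _ (VS _ (VS _ (VZ _ _))))).
Local Notation V4 := (Var (VS _ (VS _ (VS _ (VS _ (VZ _ _)))))).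
Local Notation V5 := (Var (VS _ (VS _ (VS _ (VS _ (VS _ (VZ _ _))))))).
Local Notation V6 := (Var (VS _ (VS _ (VS _ (VS _ (VS _ (VS _ (VZ _ _)))))))).
Local Notation V8 := (Var (VS _ (VS _ (VS _ (VS _ (VS _ (VS _ (VS _ (VS _ (VZ _ _)))))))))).
Local Notation Lam2 t := (Lam (Lam t)).
Local Notation Lam3 t := (Lam (Lam (Lam t))).
Local Notation Lam4 t := (Lam (Lam (Lam (Lam t)))).
Local Notation Lam5 t := (Lam (Lam (Lam (Lam (Lam t))))).
Local Notation App2 t u v := (App (App t u) v).
Local Notation App3 t u v w := (App (App (App t u) v) w).
Local Notation nats := (TList TNat).

Section Terms.
Variable G : seq ty.
Implicit Types (x y : tm G TNat) (l : tm G nats).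

Definition oneT : tm G TNat := Succ (Zero G).
Definition addT x y : tm G TNat := NatRec y (Lam2 (Succ V0)) x.
Definition predT x : tm G TNat := NatRec (Zero G) (Lam2 V1) x.
Definition iszeroT x : tm G TBool := NatRec (TrueT G) (Lam2 (FalseT _)) x.
Definition andT (b c : tm G TBool) : tm G TBool := If b c (FalseT G).
Definition headT l : tm G TNat := ListRec (Zero G) (Lam3 V2) l.
Definition beheadT a (l : tm G (TList a)) : tm G (TList a) :=
  ListRec (Defs.Nil G a) (Lam3 V1) l.
Definition catT a (l1 l2 : tm G (TList a)) : tm G (TList a) :=
  ListRec l2 (Lam3 (Defs.Cons V2 V0)) l1.
Definition fsumT (l : tm G (TList TField)) : tm G TField :=
  ListRec (FZero G) (Lam3 (FAdd V2 V0)) l.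
(** The recursor is used at a function type because the start changes along the recursion; likewise
    for [zipwF], [eqseqT] and [tcoordT]. *)
Definition iotaT x y : tm G nats :=
  App (NatRec (Lam (Defs.Nil _ TNat)) (Lam3 (Defs.Cons V0 (App V1 (Succ V0)))) y) x.

End Terms.

Definition subT G (x y : tm G TNat) : tm G TNat := NatRec x (Lam2 (predT V0)) y.
(** An argument used under a binder would have to be weakened. A term of function type, ending in
    [F], receives it by application instead. *)
Definition mulF G : tm G (TNat =>> TNat =>> TNat) :=
  Lam2 (NatRec (Zero _) (Lam2 (addT V2 V0)) V1).
Definition mulT G (x y : tm G TNat) := App2 (mulF G) x y.
Definition expF G : tm G (TNat =>> TNat =>> TNat) :=
  Lam2 (NatRec (oneT _) (Lam2 (mulT V3 V0)) V0).
Definition expT G (x y : tm G TNat) := App2 (expF G) x y.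
Definition subF G : tm G (TNat =>> TNat =>> TNat) := Lam2 (subT V1 V0).
Definition leqT G (x y : tm G TNat) := iszeroT (subT x y).
Definition eqnT G (x y : tm G TNat) := andT (leqT x y) (leqT y x).
Definition sumnT G (l : tm G nats) : tm G TNat :=
  ListRec (Zero G) (Lam3 (addT V2 V0)) l.
Definition mapF G a b : tm G ((a =>> b) =>> TList a =>> TList b) :=
  Lam2 (ListRec (Defs.Nil _ b) (Lam3 (Defs.Cons (App V4 V2) V0)) V0).
Definition mapT G a b (f : tm G (a =>> b)) l := App2 (mapF G a b) f l.
Definition filterF G a : tm G ((a =>> TBool) =>> TList a =>> TList a) :=
  Lam2 (ListRec (Defs.Nil _ a) (Lam3 (If (App V4 V2) (Defs.Cons V2 V0) V0)) V0).
Definition filterT G a (f : tm G (a =>> TBool)) l := App2 (filterF G a) f l.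
Definition allpairsF G a b c :
    tm G ((a =>> b =>> c) =>> TList a =>> TList b =>> TList c) :=
  Lam3 (ListRec (Defs.Nil _ c) (Lam3 (catT (mapT (App V5 V2) V3) V0)) V1).
Definition allpairsT G a b c (f : tm G (a =>> b =>> c)) s t :=
  App3 (allpairsF G a b c) f s t.
Definition zipwF G : tm G ((TNat =>> TNat =>> TNat) =>> nats =>> nats =>> nats) :=
  Lam2 (ListRec (Lam (Defs.Nil _ TNat))
    (Lam4 (Defs.Cons (App2 V5 V3 (headT V0)) (App V1 (beheadT V0)))) V0).
Definition zipwT G op (l m : tm G nats) := App3 (zipwF G) op l m.
Definition belowT G (m : tm G nats) : tm G (TList nats) :=
  ListRec (Defs.Cons (Defs.Nil G TNat) (Defs.Nil G nats))
    (Lam3 (allpairsT (Lam2 (Defs.Cons V1 V0)) (iotaT (Zero _) (Succ V2)) V0)) m.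
Definition eqseqT G (l m : tm G nats) : tm G TBool :=
  App (ListRec (Lam (ListRec (TrueT _) (Lam3 (FalseT _)) V0))
    (Lam4 (ListRec (FalseT _) (Lam3 (andT (eqnT V6 V2) (App V4 V1))) V0)) l) m.
Definition nseqF G : tm G (TNat =>> TNat =>> nats) :=
  Lam2 (NatRec (Defs.Nil _ TNat) (Lam2 (Defs.Cons V2 V0)) V1).
Definition nseqT G (x y : tm G TNat) := App2 (nseqF G) x y.
Definition weightsT G (q : tm G nats) : tm G nats :=
  ListRec (Defs.Cons (oneT G) (Defs.Nil G TNat))
    (Lam3 (Defs.Cons (addT (mulT V2 (headT V0)) (subT (oneT _) V2)) V0)) q.
Definition tcoordT G (c : tm G TNat) (q a : tm G nats) : tm G nats :=
  App2 (ListRec (Lam2 (Defs.Nil _ TNat))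
    (Lam5 (Defs.Cons (addT V4 V1)
       (App2 V2 (mulT (headT V0) (addT V4 V1)) (beheadT V0)))) a) c q.
Definition dotT G (l m : tm G nats) := sumnT (zipwT (mulF G) l m).
Definition zdotT G (q ws m : tm G nats) :=
  subT (dotT ws m) (dotT (beheadT ws) (zipwT (mulF G) q m)).

Local Notation series := (nats =>> TField)%ty.
Local Notation idx := (nats ** TNat)%ty.
Local Notation vec := (idx =>> TField)%ty.

Definition deltaT G (x m : tm G nats) : tm G TField := If (eqseqT x m) (FOne G) (FZero G).
Definition cauchyF G : tm G (nats =>> series =>> series =>> TField) :=
  Lam3 (fsumT (mapT (Lam (FMul (App V2 V0) (App V1 (zipwT (subF _) V3 V0)))) (belowT V2))).
Definition spowF G : tm G (TNat =>> series =>> TNat =>> series) :=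
  Lam3 (NatRec (Lam (deltaT (nseqT V3 (Zero _)) V0))
    (Lam3 (App3 (cauchyF _) V0 V4 V1)) V0).
Definition term_coefF G : tm G (TNat =>> TNat =>> TNat =>> nats =>> series =>> series =>>
    nats =>> idx =>> TField) :=
  Lam3 (Lam5 (App3 (cauchyF _) V1
    (Lam (deltaT (tcoordT (Zero _) V5 (mapT (Lam (mulT V8 V0)) (Fst V1))) V0))
    (Lam (App3 (cauchyF _) V0 (App3 (spowF _) V8 V4 (Snd V1))
       (App3 (spowF _) V8 V3 (subT V6 (Snd V1))))))).
Definition entryF G : tm G (coef_table =>> nats =>> TField) :=
  Lam2 (ListRec (FZero _) (Lam3 (If (eqseqT (Fst V2) V3) (FAdd (Snd V2) V0) V0)) V1).
Definition formF G : tm G (TList idx =>> vec =>> vec =>> TField) :=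
  Lam3 (fsumT (mapT (Lam (FMul (App V1 V0) (App V2 V0))) V2)).
Definition elim_formF G : tm G ((vec =>> TField) =>> TList vec =>> TList vec) :=
  Lam2 (ListRec (Defs.Nil _ vec)
    (Lam3 (If (FIsZero (App V4 V2)) (Defs.Cons V2 V0)
       (mapT (Lam2 (FAdd (App V1 V0)
          (FOpp (FMul (FMul (App V6 V1) (FInv (App V6 V4))) (App V4 V0))))) V1))) V0).
Definition unit_vectorsF G : tm G (TList idx =>> TList vec) :=
  Lam (mapT (Lam2 (If (andT (eqseqT (Fst V0) (Fst V1)) (eqnT (Snd V0) (Snd V1)))
                     (FOne _) (FZero _))) V0).
Definition kernelF G : tm G (TList idx =>> TList (vec =>> TField) =>> TList vec) :=
  Lam2 (ListRec (App (unit_vectorsF _) V1) (Lam3 (App2 (elim_formF _) V2 V0)) V0).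
Definition indicesF G : tm G (TNat =>> TNat =>> TNat =>> TList idx) :=
  Lam3 (allpairsT (Lam2 (Pair V1 V0))
    (filterT (Lam (leqT (sumnT V0) V1)) (belowT (nseqT V2 V0))) (iotaT (Zero _) (Succ V1))).

Section Input.
Variables (G : seq ty) (x : tm G input).

Definition d_of : tm G TNat := Fst (Fst (Fst (Fst (Fst (Fst (Fst (Fst x))))))).
Definition nu0_of : tm G TNat := Snd (Fst (Fst (Fst (Fst (Fst (Fst (Fst x))))))).
Definition p_of : tm G TNat := Snd (Fst (Fst (Fst (Fst (Fst (Fst x)))))).
Definition nu_of : tm G TNat := Snd (Fst (Fst (Fst (Fst (Fst x))))).
Definition q_of : tm G nats := Snd (Fst (Fst (Fst (Fst x)))).
Definition q'_of : tm G nats := Snd (Fst (Fst (Fst x))).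
Definition vg_of : tm G nats := Snd (Fst x).
Definition r_of : tm G TNat := ListRec (Zero G) (Lam3 (Succ V0)) vg_of.
Definition c_of : tm G TNat :=
  addT nu_of (mulT d_of (zdotT q_of (weightsT q'_of) vg_of)).
Definition N_of : tm G TNat := addT nu0_of c_of.
Definition IN_of : tm G (TList idx) := App3 (indicesF G) r_of d_of N_of.
Definition M_of : tm G TNat :=
  let B := mulT p_of nu0_of in
  let wS := sumnT (weightsT q'_of) in
  let Lg := zdotT q_of (weightsT q'_of) vg_of in
  let V := expT (Succ wS) r_of in
  let m := addT (mulT d_of V) (oneT G) in
  let md := mulT m d_of in
  let n := addT (addT (addT (mulT m c_of) (mulT md Lg)) B)
                (mulT (mulT (mulT md r_of) B) V) in
  addT (sumnT (tcoordT (Zero G) q'_of (nseqT r_of n)))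
       (mulT md (sumnT (tcoordT (Zero G) q'_of vg_of))).

End Input.

Definition f_of G (x : tm (nats :: G) input) : tm G series :=
  Lam (App2 (entryF _) (Fst (App (Snd x) (sumnT V0))) V0).
Definition g_of G (x : tm (nats :: G) input) : tm G series :=
  Lam (App2 (entryF _) (Snd (App (Snd x) (sumnT V0))) V0).

Definition equationsT G : tm (input :: G) (TList (vec =>> TField)) :=
  mapT (Lam (App2 (formF _) (IN_of V1)
     (App (App3 (App3 (term_coefF _) (r_of V1) (p_of V1) (d_of V1))
             (q_of V1) (f_of V2) (g_of V2)) V0)))
   (filterT (Lam (leqT (Succ (zdotT (q_of V1) (weightsT (q'_of V1)) V0)) (c_of V1)))
      (belowT (nseqT (r_of V0) (M_of V0)))).

Definition descriptionT : tm [::] (input =>> output) :=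
  Lam (Pair (N_of V0) (mapT (Lam (mapT (Lam (Pair V0 (App V1 V0))) (IN_of V1)))
    (App2 (kernelF _) (IN_of V0) (equationsT _)))).

(** * The programs compute the functions that they transcribe *)

Section Eval.
Variable K : fieldType.

(** A recursor is identified with any function satisfying the same two equations, which for most
    programs hold by unfolding one step. *)
Lemma list_recE A B (z : B) (h : A -> seq A -> B -> B) (F : seq A -> B) :
  F [::] = z -> (forall x l, F (x :: l) = h x l (F l)) ->
  forall l, list_rec_sem z h l = F l.
Proof. by move=> F0 FS; elim=> //= x l ->. Qed.

Lemma nat_recE B (z : B) (h : nat -> B -> B) (F : nat -> B) :
  F 0%N = z -> (forall n, F n.+1 = h n (F n)) ->
  forall n, nat_rect (fun=> B) z h n = F n.
Proof. by move=> F0 FS; elim=> //= n ->. Qed.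

Ltac ev := cbn [eval lookup fst snd].

Lemma eval_add G (e : env K G) x y : eval (addT x y) e = (eval x e + eval y e)%N.
Proof. exact: (nat_recE (F := fun n => (n + eval y e)%N)). Qed.

Lemma eval_pred G (e : env K G) x : eval (predT x) e = (eval x e).-1.
Proof. exact: (nat_recE (F := predn)). Qed.

Lemma eval_iszero G (e : env K G) x : eval (iszeroT x) e = (eval x e == 0)%N.
Proof. exact: (nat_recE (F := fun n => n == 0)%N). Qed.

Lemma eval_and G (e : env K G) b c : eval (andT b c) e = eval b e && eval c e.
Proof. by []. Qed.

Lemma eval_head G (e : env K G) l : eval (headT l) e = head 0%N (eval l e).
Proof. exact: (list_recE (F := head 0%N)). Qed.

Lemma eval_behead G (e : env K G) a (l : tm G (TList a)) :
  eval (beheadT l) e = behead (eval l e).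
Proof. exact: (list_recE (F := behead)). Qed.

Lemma eval_cat G (e : env K G) a (l1 l2 : tm G (TList a)) :
  eval (catT l1 l2) e = eval l1 e ++ eval l2 e.
Proof. by rewrite /catT; ev; elim: (eval l1 e) => //= x s ->. Qed.

Lemma eval_fsum G (e : env K G) (l : tm G (TList TField)) :
  eval (fsumT l) e = \sum_(x <- (eval l e : seq K)) x :> K.
Proof.
rewrite /fsumT; ev; elim: (eval l e) => [|x s]; first by rewrite big_nil.
by rewrite big_cons => <-.
Qed.

Lemma eval_iota G (e : env K G) x y : eval (iotaT x y) e = iota (eval x e) (eval y e).
Proof.
rewrite /iotaT; ev; elim: (eval y e) (eval x e) => // n IHn m.
by congr (_ :: _); apply: IHn.
Qed.

Lemma eval_sub G (e : env K G) x y : eval (subT x y) e = (eval x e - eval y e)%N.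
Proof.
rewrite /subT; ev; apply: (nat_recE (F := fun n => (eval x e - n)%N)); first by rewrite subn0.
by move=> n; rewrite eval_pred subnS.
Qed.

Lemma eval_mulF G (e : env K G) : eval (mulF G) e = muln.
Proof.
apply/funext => x; apply/funext => y; rewrite /mulF; ev.
apply: (nat_recE (F := fun n => (n * y)%N)) => // n.
by rewrite eval_add.
Qed.

Lemma eval_mul G (e : env K G) x y : eval (mulT x y) e = (eval x e * eval y e)%N.
Proof. by rewrite /mulT; ev; rewrite eval_mulF. Qed.

Lemma eval_exp G (e : env K G) x y : eval (expT x y) e = (eval x e ^ eval y e)%N.
Proof.
rewrite /expT /expF; ev; apply: (nat_recE (F := fun n => (eval x e ^ n)%N)) => // n.
by rewrite eval_mul expnS.
Qed.

Lemma eval_subF G (e : env K G) : eval (subF G) e = subn.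
Proof.
by apply/funext => x; apply/funext => y; rewrite /subF; ev; rewrite eval_sub.
Qed.

Lemma eval_leq G (e : env K G) x y : eval (leqT x y) e = (eval x e <= eval y e)%N.
Proof. by rewrite /leqT eval_iszero eval_sub. Qed.

Lemma eval_eqn G (e : env K G) x y : eval (eqnT x y) e = (eval x e == eval y e :> nat).
Proof. by rewrite /eqnT eval_and !eval_leq eqn_leq. Qed.

Lemma eval_sumn G (e : env K G) l : eval (sumnT l) e = sumn (eval l e).
Proof.
rewrite /sumnT; ev; apply: (list_recE (F := sumn)) => // x s.
by rewrite eval_add.
Qed.

Lemma eval_map G (e : env K G) a b (f : tm G (a =>> b)) l :
  eval (mapT f l) e = map (eval f e) (eval l e).
Proof. by rewrite /mapT /mapF; ev; elim: (eval l e) => //= x s ->. Qed.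

Lemma eval_filter G (e : env K G) a (f : tm G (a =>> TBool)) l :
  eval (filterT f l) e = filter (eval f e) (eval l e).
Proof. by rewrite /filterT /filterF; ev; elim: (eval l e) => //= x s ->. Qed.

Lemma eval_allpairs G (e : env K G) a b c (f : tm G (a =>> b =>> c)) s t :
  eval (allpairsT f s t) e = [seq eval f e x y | x <- eval s e, y <- eval t e].
Proof.
rewrite /allpairsT /allpairsF; ev.
apply: (list_recE (F := fun s => [seq eval f e x y | x <- s, y <- eval t e])) => // x s'.
by rewrite eval_cat eval_map.
Qed.

Lemma eval_zipw G (e : env K G) op l m :
  eval (zipwT op l m) e = zipw (eval op e) (eval l e) (eval m e).
Proof.
rewrite /zipwT /zipwF; ev; rewrite (list_recE (F := zipw (eval op e))) // => x s.
by apply/funext => m'; rewrite eval_head eval_behead.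
Qed.

Lemma eval_below G (e : env K G) m : eval (belowT m) e = below (eval m e).
Proof.
rewrite /belowT; ev; apply: (list_recE (F := below)) => // x s.
by rewrite eval_allpairs; ev; rewrite eval_iota.
Qed.

Lemma eval_eqseq G (e : env K G) l m : eval (eqseqT l m) e = (eval l e == eval m e :> seq nat).
Proof.
rewrite /eqseqT; ev; rewrite (list_recE (F := fun l m => l == m :> seq nat)) //.
  by apply/funext => -[].
move=> x s; apply/funext => -[|y m'] //; cbn [list_rec_sem].
by rewrite eqseq_cons eval_and eval_eqn.
Qed.

Lemma eval_nseq G (e : env K G) x y : eval (nseqT x y) e = nseq (eval x e) (eval y e).
Proof.
by rewrite /nseqT /nseqF; ev; apply: (nat_recE (F := fun n => nseq n (eval y e))).
Qed.

Lemma eval_weights G (e : env K G) l : eval (weightsT l) e = weights (eval l e).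
Proof.
rewrite /weightsT; ev; apply: (list_recE (F := weights)) => // x s.
by rewrite eval_add eval_mul eval_head eval_sub.
Qed.

Lemma eval_tcoord G (e : env K G) c q a :
  eval (tcoordT c q a) e = tcoord (eval c e) (eval q e) (eval a e).
Proof.
rewrite /tcoordT; ev; rewrite (list_recE (F := fun a c q => tcoord c q a)) // => x s.
apply/funext => c'; apply/funext => q'.
by rewrite eval_mul eval_add eval_head eval_behead.
Qed.

Lemma eval_dot G (e : env K G) l m : eval (dotT l m) e = dot (eval l e) (eval m e).
Proof. by rewrite /dotT eval_sumn eval_zipw eval_mulF. Qed.

Lemma eval_zdot G (e : env K G) q ws m :
  eval (zdotT q ws m) e = zdot (eval q e) (eval ws e) (eval m e).
Proof. by rewrite /zdotT eval_sub !eval_dot eval_behead eval_zipw eval_mulF. Qed.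

Lemma eval_cauchy G (e : env K G) : eval (cauchyF G) e = @cauchy K.
Proof.
apply/funext => m; apply/funext => a; apply/funext => b; rewrite /cauchyF; ev.
rewrite eval_fsum eval_map eval_below /cauchy big_map; apply: eq_bigr => k _.
by ev; rewrite eval_zipw eval_subF.
Qed.

Lemma eval_delta G (e : env K G) x m : eval (deltaT x m) e = delta K (eval x e) (eval m e).
Proof. by rewrite /deltaT; ev; rewrite eval_eqseq. Qed.

Lemma eval_spow G (e : env K G) : eval (spowF G) e = @spow K.
Proof.
apply/funext => r; apply/funext => a; apply/funext => n; rewrite /spowF; ev.
apply: (nat_recE (F := @spow K r a)) => [|n'].
  by apply/funext => m; rewrite eval_delta eval_nseq.
by apply/funext => m; rewrite eval_cauchy.
Qed.

Lemma eval_term_coef G (e : env K G) : eval (term_coefF G) e = @term_coef K.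
Proof.
apply/funext => r; apply/funext => p; apply/funext => d; apply/funext => q.
apply/funext => a; apply/funext => b; apply/funext => l; apply/funext => ij.
rewrite /term_coefF; ev; rewrite eval_cauchy; congr (cauchy _ _ _).
  apply/funext => m; rewrite eval_delta eval_tcoord eval_map; ev.
  by congr (delta _ (tcoord _ _ _) _); apply: eq_map => i; rewrite eval_mul.
by apply/funext => m; rewrite eval_spow eval_sub eval_cauchy.
Qed.

Lemma eval_entry G (e : env K G) :
  eval (entryF G) e = fun (T : seq (seq nat * K)) x => entry T x.
Proof.
apply/funext => T; apply/funext => x; rewrite /entryF; ev.
apply: (list_recE (F := fun T : seq (seq nat * K) => entry T x)).
  by rewrite /entry big_nil.
by move=> y T'; rewrite eval_eqseq /entry big_cons.
Qed.

Lemma eval_form G (e : env K G) : eval (formF G) e = @form K (seq nat * nat)%type.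
Proof.
apply/funext => s; apply/funext => c; apply/funext => v; rewrite /formF; ev.
by rewrite eval_fsum eval_map big_map.
Qed.

Lemma eval_elim_form G (e : env K G) :
  eval (elim_formF G) e = @elim_form K (seq nat * nat)%type.
Proof.
apply/funext => phi; apply/funext => bs; rewrite /elim_formF; ev.
apply: (list_recE (F := elim_form phi)) => //.
Qed.

Lemma eval_unit_vectors G (e : env K G) :
  eval (unit_vectorsF G) e = @unit_vectors K (seq nat * nat)%type.
Proof.
apply/funext => s; rewrite /unit_vectorsF; ev; rewrite eval_map; apply: eq_map => j.
case: j => j1 j2; apply/funext => -[i1 i2]; ev.
by rewrite eval_and eval_eqseq eval_eqn xpair_eqE; ev; case: (_ && _).
Qed.

Lemma eval_kernel G (e : env K G) : eval (kernelF G) e = @kernel K (seq nat * nat)%type.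
Proof.
apply/funext => s; apply/funext => phis; rewrite /kernelF; ev.
apply: (list_recE (F := @kernel K (seq nat * nat)%type s)).
  by rewrite eval_unit_vectors.
by move=> phi phis'; rewrite eval_elim_form.
Qed.

Lemma eval_indices G (e : env K G) : eval (indicesF G) e = indices.
Proof.
apply/funext => r; apply/funext => d; apply/funext => N; rewrite /indicesF; ev.
rewrite eval_allpairs eval_filter eval_below eval_nseq eval_iota; ev.
congr (allpairs_dep _ _ _); apply: eq_filter => i.
by rewrite eval_leq eval_sumn.
Qed.

Section EvalInput.
Variables (d nu0 p nu : nat) (q q' vf vg : seq nat).
Variable proc : nat -> seq (seq nat * K) * seq (seq nat * K).
Let inp : sem K input := (d, nu0, p, nu, q, q', vf, vg, proc).
Variables (G : seq ty) (e : env K G) (x : tm G input).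
Hypothesis Dx : eval x e = inp.

Lemma eval_r : eval (r_of x) e = size vg.
Proof.
by rewrite /r_of; ev; rewrite /vg_of; ev; rewrite Dx; apply: (list_recE (F := size)).
Qed.

Lemma eval_c : eval (c_of x) e = weight_bound (size vg) d nu q q' vg.
Proof.
rewrite /c_of eval_add eval_mul eval_zdot eval_weights.
by rewrite /nu_of /d_of /q_of /q'_of /vg_of; ev; rewrite Dx.
Qed.

Lemma eval_IN : eval (IN_of x) e =
  indices (size vg) d (nu0 + weight_bound (size vg) d nu q q' vg).
Proof.
rewrite /IN_of; ev; rewrite eval_indices eval_r eval_add eval_c.
by rewrite /d_of /nu0_of; ev; rewrite Dx.
Qed.

Lemma eval_M : eval (M_of x) e =
  exponent_bound (size vg) d (weight_bound (size vg) d nu q q' vg) (p * nu0) q q' vg.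
Proof.
rewrite /M_of !(eval_add, eval_mul, eval_sumn, eval_tcoord, eval_nseq, eval_exp, eval_zdot,
  eval_weights, eval_r, eval_c); ev.
rewrite /p_of /nu0_of /d_of /q_of /q'_of /vg_of !eval_sumn; ev.
by rewrite !eval_weights; ev; rewrite Dx.
Qed.

End EvalInput.

Lemma eval_equations (d nu0 p nu : nat) (q q' vf vg : seq nat) proc G (e : env K G) :
  let c := weight_bound (size vg) d nu q q' vg in
  eval (equationsT G) ((d, nu0, p, nu, q, q', vf, vg, proc) : sem K input, e) =
  equations (size vg) p d (nu0 + c) c
    (exponent_bound (size vg) d c (p * nu0) q q' vg) q q'
    (fun m => entry (proc (sumn m)).1 m) (fun m => entry (proc (sumn m)).2 m).
Proof.
move=> c; rewrite /equationsT; set inp : sem K input := (_, proc).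
have Er e' (l : seq nat) := @eval_r d nu0 p nu q q' vf vg proc [:: nats, input & G]
  (l, (inp, e')) V1 erefl.
have Ec e' (l : seq nat) := @eval_c d nu0 p nu q q' vf vg proc [:: nats, input & G]
  (l, (inp, e')) V1 erefl.
have EIN e' (l : seq nat) := @eval_IN d nu0 p nu q q' vf vg proc [:: nats, input & G]
  (l, (inp, e')) V1 erefl.
rewrite eval_map eval_filter eval_below eval_nseq.
rewrite (@eval_r d nu0 p nu q q' vf vg proc (input :: G) (inp, e) V0 erefl).
rewrite (@eval_M d nu0 p nu q q' vf vg proc (input :: G) (inp, e) V0 erefl).
have -> : filter (eval (Lam (leqT (Succ (zdotT (q_of V1) (weightsT (q'_of V1)) V0)) (c_of V1)))
    (inp, e)) = filter (fun l => zdot q (weights q') l < c)%N.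
  apply/funext => s; apply: eq_filter => l; ev.
  by rewrite eval_leq Ec; ev; rewrite eval_zdot eval_weights.
apply: eq_map => l; ev; rewrite eval_form EIN eval_term_coef Er; congr (form _ _).
rewrite /f_of /g_of; ev.
congr (term_coef _ _ _ _ _ _ _); apply/funext => m; ev;
by rewrite eval_entry; ev; rewrite eval_sumn.
Qed.

Lemma eval_description (d nu0 p nu : nat) (q q' vf vg : seq nat) proc :
  eval descriptionT (tt : env K [::])
    ((d, nu0, p, nu, q, q', vf, vg, proc) : sem K input) =
  description d nu0 p nu q q' vg proc.
Proof.
rewrite /descriptionT; ev; set inp : sem K input := (_, proc).
have EIN v := @eval_IN d nu0 p nu q q' vf vg proc [:: vec; input]
  (v, (inp, tt)) V1 erefl.
rewrite /description; congr pair.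
  by rewrite eval_add (@eval_c d nu0 p nu q q' vf vg proc [:: input] (inp, tt) V0 erefl).
rewrite eval_map; ev.
rewrite eval_kernel (@eval_IN d nu0 p nu q q' vf vg proc [:: input] (inp, tt) V0 erefl).
by rewrite eval_equations; apply: eq_map => v; rewrite eval_map EIN.
Qed.

End Eval.

(** All the bounds are computed from the input, so the whole description is one total term,
    evaluated by [init]; the loop stops at once. *)
Definition description_algorithm : algorithm input output :=
  Algorithm descriptionT (Lam V0) (Lam (TrueT _)) (Lam V0).

Theorem theorem5p4 :
  exists A : algorithm input output,
  forall (K : closedFieldType) (r d nu0 p : nat) (q : r.-1.-tuple nat)
    (f g : iter_laurent K r) (q' : r.-1.-tuple nat) (B : seq (nat * nat))
    (nu : nat) (vf vg : r.-tuple nat)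
    (proc : nat -> seq (seq nat * K) * seq (seq nat * K)),
  [pchar K] =i pred0 ->
  (2 <= r)%N -> (0 < d)%N -> (0 < p)%N ->
  in_Kzeta q f -> in_Kzeta q g -> g != 0 ->
  (exists P, admissible_poly p d nu0 P /\ P.[f / g] = 0) ->
  (forall i, tnth q i <= tnth q' i)%N -> (exists i, 0 < tnth q' i)%N ->
  monomialized q' (f * g) ->
  is_blocks q' B ->
  lex_valuation q f vf -> lex_valuation q g vg ->
  is_coef_procedure q f g proc ->
  exists out : nat * seq (seq (seq nat * nat * K)),
    returns A
      (d, nu0, p, nu, tval q, tval q', tval vf, tval vg, proc) out /\
    parametric_description p d nu0 (in_Qnu p d nu0 q' B (f / g) nu) out.
Proof.
exists description_algorithm => K r d nu0 p q f g q' B nu vf vg proc _ r2 d0 p0 Rf Rg g0 exP.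
move=> leqq _ mono blocks _ vgP procP.
exists (description d nu0 p nu q q' vg proc); split.
  by exists 0%N; split=> //; apply/esym/eval_description.
by apply: description_correct procP => //; apply: ltnW.
Qed.
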